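(* Let $f$ be the cardinality of $\kappa$. The local density of $(L,q)$ is $$\beta_L=\frac{1}{[\mathrm{O}(V,q):\mathrm{SO}(V,q)]}\,f^{N}\cdot f^{-\dim\mathrm{O}(V,q)}\cdot\#\tilde G(\kappa),$$ where $N=t+\sum_{i<j}i\cdot n_i\cdot n_j+\sum_i d_i-b+c$, with $t$ the total number of $L_i$ of type I, $b$ the number of pairs of adjacent constituents $L_i,L_{i+1}$ both of type I, $c$ the sum of the ranks $n_i$ of all nonzero $L_i$ of type II, and $d_i=i\cdot n_i(n_i+1)/2$.
   Context: Let $F$ be a finite unramified extension of $\mathbb{Q}_2$, $A$ its ring of integers and $\kappa=A/2A$. Let $L$ be a free $A$-module of rank $n$ with a quadratic form $q:L\to A$, $\langle x,y\rangle=\frac12(q(x+y)-q(x)-q(y))$, nondegenerate on $V=L\otimes_AF$, with $\langle L,L\rangle\subseteq A$. For a lattice $M\subset V$ put $M^{\perp}=\{x\in V:\langle x,M\rangle\subseteq A\}$. Jordan splitting: $L=\bigoplus_{i\ge0}L_i$ orthogonally, each $L_i$ zero or such that $2^{-i}\langle-,-\rangle$ on $L_i$ has Gram matrix over $A$ with unit determinant; $n_i=\mathrm{rank}\,L_i$. A nonzero $L_i$ is of type I if $2^{-i}q(L_i)$ contains a unit, type II otherwise (zero lattices count as type II). These data do not depend on the splitting. Local density: identify $\mathrm{End}_F(V)$ with $M_n(F)$ via an $A$-basis of $L$, and let $S$ be the Gram matrix of $\langle-,-\rangle$. Let $\omega_M$ be the translation-invariant top form on $M_n(F)$ with $\int_{M_n(A)}|\omega_M|=1$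 and $\omega_Q$ the translation-invariant top form on symmetric $n\times n$ matrices with $\int_{\mathrm{Sym}_n(A)}|\omega_Q|=1$. With $\rho(m)={}^tmSm$ on $\mathrm{GL}_n(F)$, let $\omega^{\mathrm{ld}}=\omega_M/\rho^*\omega_Q$ be the induced top form on $\mathrm{O}(V,q)=\rho^{-1}(S)$. Then $\beta_L=\frac{1}{[\mathrm{O}(V,q):\mathrm{SO}(V,q)]}\int_{\mathrm{Aut}_A(L,q)}|\omega^{\mathrm{ld}}|$. Group scheme: for $i\ge0$: $A_i=\{x\in L:\langle x,L\rangle\subseteq 2^iA\}$, $b_i=2^{-i}\langle-,-\rangle\bmod2$ on $A_i/2A_i$; $X_i$ with $X_i/2A_i$ the radical of $b_i$; $B_i$ with $B_i/2A_i$ the kernel of $x\mapsto2^{-i}q(x)\bmod2$; $e\in A_i/X_i$ the unique vector with $b_i(v,e)^2=2^{-i}q(v)\bmod2$ for all $v$, $W_i$ the preimage of $\kappa e$; $Y_i$ with $Y_i/2A_i$ the radical of $b_i$ on $B_i/2A_i$; $Z_i$ with $Z_i/2A_i=\{x\in Y_i/2A_i:2^{-i-1}q(x)\equiv0\bmod2\}$. For flat $R$, $M_R=M\otimes_AR$; $\underline M(R)$ is the set of $m\in\mathrm{End}_R(L_R)$ stabilizing $(A_i)_R,(B_i)_R,(W_i)_R,(X_i)_R,(Y_i)_R,(Z_i)_R$ for all $i$ with $m-1$ mapping $(A_i)_R\to(B_i)_R$, $(W_i)_R\to(X_i\cap Z_i)_R$, $((X_i\cap Z_i)^\perp)_R\to(W_i^\perp)_R$;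 it is represented by an affine space over $A$ with coordinate ring $A(\underline M)$; $\underline M^*=\mathrm{Spec}\,A(\underline M)_{\det}$; $\underline G\subset\underline M^*$ the stabilizer of $q$ (a smooth model of $\mathrm{O}(V,q)$); $\tilde G=\underline G\otimes_A\kappa$ its special fiber. *)

(* Defs.v *)
From HB Require Import structures.
From mathcomp Require Import all_boot all_order all_algebra all_field.
From mathcomp Require Import all_classical all_reals all_analysis.
(* The notations of mpoly clash with those of MathComp-Analysis. *)
From mathcomp Require Import -(notations) mpoly.

Set Implicit Arguments.
Unset Strict Implicit.
Unset Printing Implicit Defensive.

Import Order.TTheory GRing.Theory Num.Theory.
Local Open Scope classical_set_scope.
Local Open Scope ring_scope.

(* The cardinality of a set when it is finite, and 0 otherwise. *)
Definition ncard (T : Type) (X : set T) : nat :=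
  xget 0%N [set k : nat | (X #= `I_k)%card].

Section BaseField.
Variables (R : realType) (K : fieldType) (nrm : K -> R).

(* (K, nrm) is the completion of the rational numbers for the 2-adic absolute
   value. *)
Record is_Q2 : Prop := {
  nrm_eq0 : forall x, nrm x = 0 <-> x = 0;
  nrmM : forall x y, nrm (x * y) = nrm x * nrm y;
  nrm_triangle : forall x y, nrm (x + y) <= nrm x + nrm y;
  nrm_nat : forall m : nat, (0 < m)%N -> nrm m%:R = 2 ^- logn 2 m;
  rat_dense : forall (x : K) (eps : R), 0 < eps ->
    exists r : rat, nrm (x - ratr r) < eps;
  nrm_complete : forall u : nat -> K,
    (forall eps : R, 0 < eps -> exists N : nat, forall i j : nat,
       (N <= i)%N -> (N <= j)%N -> nrm (u i - u j) < eps) ->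
    exists l : K, forall eps : R, 0 < eps -> exists N : nat, forall i : nat,
       (N <= i)%N -> nrm (u i - l) < eps }.

(* The integral closure of { x | nrm x <= 1 } in F. *)
Definition ring_of_integers (F : fieldExtType K) : set F :=
  [set x | exists p : {poly K},
     [/\ p \is monic, (forall i, nrm p`_i <= 1)
       & root (map_poly (in_alg F) p) x]].

End BaseField.

Arguments ring_of_integers {R K} nrm F _.

Section Integers.
Variables (F : fieldType) (A : set F).

Definition A_unit : set F := [set u | [/\ u != 0, A u & A u^-1]].

(* 2 generates the maximal ideal of A.  The residue extension is automatically
   separable, the residue fields being finite. *)
Definition unramified : Prop :=
  forall x, A x -> ~ (exists2 a, A a & x = 2 * a) -> A_unit x.

(* pi : A -> kappa is onto with kernel 2A, i.e. it identifies A/2A with kappa;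
   its values outside A are irrelevant. *)
Record is_residue_map (kappa : finFieldType) (pi : F -> kappa) : Prop := {
  residue1 : pi 1 = 1;
  residueD : forall x y, A x -> A y -> pi (x + y) = pi x + pi y;
  residueM : forall x y, A x -> A y -> pi (x * y) = pi x * pi y;
  residue_onto : forall c, exists2 x, A x & pi x = c;
  residue_ker : forall x, A x -> (pi x = 0 <-> exists2 a, A a & x = 2 * a) }.

Definition integral_mx (m n : nat) : set 'M[F]_(m, n) :=
  [set M | forall i j, A (M i j)].

Definition ord2 (x : F) : int :=
  xget 0%R [set k : int | A_unit (x * 2 ^ (- k))].

End Integers.

(* A matrix space as a measurable space has to be pointed, which F need not be;
   hence the alias. *)
Definition mxspace (F : fieldType) (m n : nat) : Type := 'M[F]_(m, n).
HB.instance Definition _ (F : fieldType) m n :=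
  Choice.copy (mxspace F m n) 'M[F]_(m, n).
HB.instance Definition _ (F : fieldType) m n :=
  isPointed.Build (mxspace F m n) (0 : 'M[F]_(m, n)).

Section Topology.
Variables (R : realType) (F : fieldType) (A : set F) (f : nat).

(* The normalized absolute value of F, f being the cardinality of A/2A. *)
Definition absF (x : F) : R := if x == 0 then 0 else f%:R ^ (- ord2 A x).

Definition mxabs (m n : nat) (M : 'M[F]_(m, n)) : R :=
  \big[Num.max/0]_(p : 'I_m * 'I_n) absF (M p.1 p.2).

Definition mxopen (m n : nat) : set (set (mxspace F m n)) :=
  [set U | forall x : 'M[F]_(m, n), U x ->
     exists2 r : R, 0 < r & forall y : 'M[F]_(m, n), mxabs (y - x) < r -> U y].

Definition borel (m n : nat) := g_sigma_algebraType (@mxopen m n).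

Definition borel_measure (m n : nat) := {measure set (borel m n) -> \bar R}.

Definition is_haar (d : nat) (mu : borel_measure 1 d) : Prop :=
  (forall (U : set (borel 1 d)) (a : 'rV[F]_d), measurable U ->
     mu [set (x : 'rV[F]_d) + a | x in U] = mu U) /\
  mu (@integral_mx F A 1 d) = 1%E.

(* Strict (Frechet) differentiability of g at x with derivative v |-> v J in
   the coordinates mxvec.  Analytic maps are strictly differentiable, and the
   inverse function theorem and the change of variables formula hold for
   strictly differentiable maps, so that using these as parametrizations
   yields the usual measure attached to a differential form. *)
Definition strict_derivative (d n : nat) (g : 'rV[F]_d -> 'M[F]_n)
    (x : 'rV[F]_d) (J : 'M[F]_(d, n * n)) : Prop :=
  forall eps : R, 0 < eps -> exists2 r : R, 0 < r &
    forall y z, mxabs (y - x) < r -> mxabs (z - x) < r ->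
      mxabs (g y - g z - vec_mx ((y - z) *m J)) <= eps * mxabs (y - z).

(* A translation invariant top form on F^k, c dx_1 /\ ... /\ dx_k, evaluated on
   the rows of T. *)
Definition top_form (k : nat) (c : F) (T : 'M[F]_k) : F := c * \det T.

Definition normalized_form (k : nat) (mu : borel_measure 1 k) (c : F) : Prop :=
  (\int[mu]_(x in (@integral_mx F A 1 k : set (borel 1 k))) (absF c)%:E = 1)%E.

End Topology.

Section OrthogonalGroup.
Variables (F : fieldType) (n : nat) (S : 'M[F]_n).

Definition rho (m : 'M[F]_n) : 'M[F]_n := m^T *m S *m m.

Definition drho (m X : 'M[F]_n) : 'M[F]_n := X^T *m S *m m + m^T *m S *m X.

Definition OV : set 'M[F]_n := [set m | rho m = S].
Definition SOV : set 'M[F]_n := [set m | OV m /\ \det m = 1].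

Definition index_OV_SOV : nat :=
  ncard [set [set g *m h | h in SOV] | g in OV].

End OrthogonalGroup.

(* The entries (i, j), i <= j, are the coordinates on symmetric matrices. *)
Definition upper (n : nat) : {set 'I_n * 'I_n} :=
  finset (fun p : 'I_n * 'I_n => p.1 <= p.2)%N.

Lemma dim_fiber_base (n : nat) : ('C(n, 2) + #|upper n| = n * n)%N.
Proof.
have <- : #|{: 'I_n * 'I_n}| = (n * n)%N by rewrite card_prod !card_ord.
rewrite -(cardsC (upper n)) addnC; congr (_ + _)%N.
rewrite -bin2_sum big_mkord -sum1_card.
rewrite [RHS](eq_bigl (fun p : 'I_n * 'I_n => true && (p.2 < p.1)%N)); last first.
  by move=> p; rewrite !inE -ltnNge.
rewrite -(pair_big_dep xpredT (fun i j : 'I_n => j < i)%N (fun _ _ => 1%N)) /=.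
apply: eq_bigr => i _.
by rewrite -(big_ord_widen n (fun=> 1%N)) ?(ltnW (ltn_ord i)) // sum1_card card_ord.
Qed.

Definition symcoord (F : fieldType) (n : nat) (Y : 'M[F]_n) : 'rV[F]_#|upper n| :=
  \row_k Y (enum_val k).1 (enum_val k).2.

Section LocalDensity.
Variables (R : realType) (F : fieldType) (A : set F) (f n : nat) (S : 'M[F]_n).

(* omega = omega_M / rho^* omega_Q, that is, omega_M = omega /\ rho^* omega_Q
   along O(V,q): a tangent d-frame v and any complementary family w are stored
   as the rows of matrices, through mxvec. *)
Definition is_quotient_form (cM cQ : F)
    (omega : 'M[F]_n -> 'M[F]_('C(n, 2), n * n) -> F) : Prop :=
  forall m, OV S m ->
  forall (v : 'M[F]_('C(n, 2), n * n)) (w : 'M[F]_(#|upper n|, n * n)),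
  (forall i, drho S m (vec_mx (row i v)) = 0) ->
  top_form cM (castmx (dim_fiber_base n, erefl) (col_mx v w)) =
  omega m v *
  top_form cQ (\matrix_k symcoord (drho S m (vec_mx (row k w)))).

(* nu is the measure |omega| on O(V,q): on the image of a local parametrization
   it is given by integrating the absolute value of the pulled-back form. *)
Definition is_form_measure (mu : borel_measure R A f 1 'C(n, 2))
    (omega : 'M[F]_n -> 'M[F]_('C(n, 2), n * n) -> F)
    (nu : borel_measure R A f n n) : Prop :=
  forall (U : set 'rV[F]_('C(n, 2))) (psi : 'rV[F]_('C(n, 2)) -> 'M[F]_n)
    (J : 'rV[F]_('C(n, 2)) -> 'M[F]_('C(n, 2), n * n)),
  mxopen R A f U ->
  (forall x, U x -> OV S (psi x)) ->
  {in U &, injective psi} ->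
  (forall x, U x -> strict_derivative R A f psi x (J x)) ->
  (forall x, U x -> row_free (J x)) ->
  nu [set psi x | x in U] =
    (\int[mu]_(x in (U : set (borel R A f 1 'C(n, 2))))
       (absF R A f (omega (psi x) (J x)))%:E)%E.

(* L = A^n is the lattice of integral column vectors. *)
Definition lattice_L : set 'cV[F]_n := @integral_mx F A n 1.

Definition Aut_L : set 'M[F]_n :=
  [set m | OV S m /\ [set m *m x | x in lattice_L] = lattice_L].

Definition local_density (nu : borel_measure R A f n n) : \bar R :=
  (((index_OV_SOV S)%:R^-1)%:E * nu Aut_L)%E.

End LocalDensity.

Section QuadraticLattice.
Variables (F : fieldType) (A : set F) (n : nat) (q : 'cV[F]_n -> F).

Notation L := (lattice_L A (n := n)).

Definition bil (x y : 'cV[F]_n) : F := 2^-1 * (q (x + y) - q x - q y).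

Definition is_quadratic_form : Prop :=
  (forall a x, q (a *: x) = a ^+ 2 * q x) /\
  (forall a x y z, bil (a *: x + y) z = a * bil x z + bil y z).

Definition nondegenerate_quad : Prop :=
  forall x, (forall y, bil x y = 0) -> x = 0.

Definition gram : 'M[F]_n :=
  \matrix_(i, j) bil (delta_mx i 0) (delta_mx j 0).

Definition dual_lat (N : set 'cV[F]_n) : set 'cV[F]_n :=
  [set x | forall y, N y -> A (bil x y)].

Definition pow2A (i : nat) : set F := [set 2 ^+ i * a | a in A].

Definition bili (i : nat) (x y : 'cV[F]_n) : F := (2 ^+ i)^-1 * bil x y.
Definition qi (i : nat) (x : 'cV[F]_n) : F := (2 ^+ i)^-1 * q x.

Definition latA (i : nat) : set 'cV[F]_n :=
  [set x | L x /\ forall y, L y -> pow2A i (bil x y)].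

Definition latX (i : nat) : set 'cV[F]_n :=
  [set x | latA i x /\ forall y, latA i y -> pow2A 1 (bili i x y)].

Definition latB (i : nat) : set 'cV[F]_n :=
  [set x | latA i x /\ pow2A 1 (qi i x)].

(* e represents the vector of A_i / X_i such that
   b_i(v, e)^2 = 2^-i q(v) mod 2 for all v. *)
Definition char_vector (i : nat) (e : 'cV[F]_n) : Prop :=
  latA i e /\ forall v, latA i v -> pow2A 1 (bili i v e ^+ 2 - qi i v).

Definition latW (i : nat) : set 'cV[F]_n :=
  [set x | latA i x /\
     exists e a, [/\ char_vector i e, A a & latX i (x - a *: e)]].

Definition latY (i : nat) : set 'cV[F]_n :=
  [set x | latB i x /\ forall y, latB i y -> pow2A 1 (bili i x y)].

Definition latZ (i : nat) : set 'cV[F]_n :=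
  [set x | latY i x /\ pow2A 1 (qi i.+1 x)].

(* r bounds the indices of the nonzero constituents; the columns of J i form an
   A-basis of L_i, whose Gram matrix is 2^i G with G of unit determinant.  The
   columns are free and the sum is direct because the L_i are orthogonal and
   their Gram matrices are invertible. *)
Definition constituent (ni : nat -> nat) (J : forall i, 'M[F]_(n, ni i))
    (i : nat) : set 'cV[F]_n :=
  [set J i *m c | c in @integral_mx F A (ni i) 1].

Record is_jordan_splitting (r : nat) (ni : nat -> nat)
    (J : forall i, 'M[F]_(n, ni i)) : Prop := {
  jordan_bound : forall i, (r <= i)%N -> ni i = 0%N;
  jordan_orthogonal : forall i j x y, i <> j ->
    constituent J i x -> constituent J j y -> bil x y = 0;
  jordan_modular : forall i, exists G : 'M[F]_(ni i),
    [/\ integral_mx A G, A_unit A (\det G)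
      & forall k l, bil (col k (J i)) (col l (J i)) = 2 ^+ i * G k l];
  jordan_sum : forall x, L x <->
    exists2 y : nat -> 'cV[F]_n,
      (forall i, constituent J i (y i)) & x = \sum_(i < r) y i }.

Definition type_I (ni : nat -> nat) (J : forall i, 'M[F]_(n, ni i)) (i : nat)
    : bool :=
  `[< exists2 x, constituent J i x & A_unit A (qi i x) >].

Definition N_exponent (r : nat) (ni : nat -> nat)
    (J : forall i, 'M[F]_(n, ni i)) : int :=
  let t := (\sum_(i < r) type_I J i)%N in
  let cross := (\sum_(i < r) \sum_(j < r | i < j) i * ni i * ni j)%N in
  let d i := (i * (ni i * (ni i).+1) %/ 2)%N in
  let b := (\sum_(i < r) (type_I J i && type_I J i.+1))%N in
  let c := (\sum_(i < r | ~~ type_I J i) ni i)%N in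
  t%:Z + cross%:Z + (\sum_(i < r) d i)%N%:Z - b%:Z + c%:Z.

End QuadraticLattice.

(* A is a discrete valuation ring with uniformizer 2, so an A-algebra T is flat
   iff it has no 2-torsion, iff it embeds in E = T (x)_A F.  Flat A-algebras
   are therefore presented as A-subalgebras T of F-algebras E, and N (x)_A T as
   the T-span of N in V (x)_F E, for every lattice N of V. *)
Section GroupScheme.
Variables (F : fieldType) (A : set F) (n : nat) (q : 'cV[F]_n -> F).

Definition is_A_subalgebra (E : comAlgType F) (T : set E) : Prop :=
  [/\ (forall a, A a -> T (in_alg E a)),
      (forall x y, T x -> T y -> T (x - y))
    & (forall x y, T x -> T y -> T (x * y))].

Definition lat_ext (E : comAlgType F) (T : set E) (N : set 'cV[F]_n)
    : set 'cV[E]_n :=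
  [set y | exists (k : nat) (t : 'I_k -> E) (x : 'I_k -> 'cV[F]_n),
     (forall i, T (t i) /\ N (x i)) /\
     y = \sum_i t i *: map_mx (in_alg E) (x i)].

Definition maps_into (E : comAlgType F) (T : set E) (g : 'M[E]_n)
    (N N' : set 'cV[F]_n) : Prop :=
  forall x, lat_ext T N x -> lat_ext T N' (g *m x).

Definition uM (E : comAlgType F) (T : set E) : set 'M[E]_n :=
  [set m : 'M[E]_n | (forall i j, T (m i j)) /\
   forall i : nat,
     let A_ := latA A q i in let B_ := latB A q i in
     let W_ := latW A q i in let X_ := latX A q i in
     let Y_ := latY A q i in let Z_ := latZ A q i in
     [/\ (forall N, [set A_; B_; W_; X_; Y_; Z_] N -> maps_into T m N N),
         maps_into T (m - 1%:M) A_ B_,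
         maps_into T (m - 1%:M) W_ (X_ `&` Z_)
       & maps_into T (m - 1%:M) (dual_lat A q (X_ `&` Z_)) (dual_lat A q W_)]].

Definition uMstar (E : comAlgType F) (T : set E) : set 'M[E]_n :=
  [set m : 'M[E]_n | uM T m /\ exists2 s, T s & s * \det m = 1].

Definition uG (E : comAlgType F) (T : set E) : set 'M[E]_n :=
  [set m : 'M[E]_n | uMstar T m /\
     let SE := map_mx (in_alg E) (gram q) in m^T *m SE *m m = SE].

(* The generic fiber of M is the affine space of n x n matrices; F[x_ij] is the
   polynomial ring whose variables are numbered by mxvec_index. *)
Definition eval_at (E : comAlgType F) (m : 'M[E]_n) (p : mpoly (n * n) F) : E :=
  mmap (in_alg E) (fun k => mxvec m 0 k) p.

Definition det_poly : mpoly (n * n) F :=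
  \det (\matrix_(i, j) mpolyX F (mnm1 (mxvec_index i j))).

(* The coordinate ring A(M), as a subring of F[x_ij]: the regular functions on
   M, i.e. the natural maps from M(T) to T. *)
Definition coord_ring_M : set (mpoly (n * n) F) :=
  [set p | forall (E : comAlgType F) (T : set E), is_A_subalgebra T ->
     forall m, uM T m -> T (eval_at m p)].

(* The elements of A(M) vanishing on G.  They generate in A(M)_det the ideal of
   the closed subscheme G of M^*, G being flat over A. *)
Definition ideal_G : set (mpoly (n * n) F) :=
  [set p | coord_ring_M p /\
     forall (E : comAlgType F) (T : set E), is_A_subalgebra T ->
     forall m, uG T m -> eval_at m p = 0].

(* The kappa-points of the special fiber of G: the A-algebra morphisms phi from
   A(M) to kappa which are nonzero at det and kill the ideal of G.  They are
   extended by 0 outside A(M), so that distinct maps phi are distinct points. *)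
Record is_special_point (kappa : finFieldType) (pi : F -> kappa)
    (phi : mpoly (n * n) F -> kappa) : Prop := {
  pointD : forall p p', coord_ring_M p -> coord_ring_M p' ->
    phi (p + p') = phi p + phi p';
  pointM : forall p p', coord_ring_M p -> coord_ring_M p' ->
    phi (p * p') = phi p * phi p';
  pointC : forall a, A a -> phi (in_alg (mpoly (n * n) F) a) = pi a;
  point_out : forall p, ~ coord_ring_M p -> phi p = 0;
  point_det : phi det_poly != 0;
  point_ideal : forall p, ideal_G p -> phi p = 0 }.

Definition special_points (kappa : finFieldType) (pi : F -> kappa) :=
  [set phi | is_special_point pi phi].

End GroupScheme.

(* Main.v *)
(* Let M' be the lattice of the X such that 1 + X is a point of M over A.  In a
   Jordan frame v_a adapted to the characteristic vectors of the type I
   constituents, M' is cut out by the conditions 2^w(a,b) | <v_a, X v_b> for a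
   symmetric weight w.  Hence the differential X |-> X^T S + S X of rho at 1 maps
   M' onto the lattice of the symmetric matrices whose entries in the frame are
   divisible by 2^(w(a,b) + [a = b]), and M' has a basis whose first n(n-1)/2
   vectors span the kernel.
   Every automorphism of L lies in 1 + M', the reduction of Aut(L) modulo 2 M' is
   identified with the points of the special fiber by Hensel's lemma, and each
   fiber g0 (1 + 2 M') of this reduction is parametrized by the kernel
   coordinates, with |omega^ld| constant.  The integral is therefore f^(-dim) times
   the number of points times the quotient of the covolumes of the two lattices,
   whose exponent, the sum of w(a,b) + [a = b] over a <= b minus that of
   w(a,b) - lev a over all (a,b), is N. *)
Require Import Defs.
From HB Require Import structures.
From mathcomp Require Import all_boot all_order all_algebra all_field.
From mathcomp Require Import all_classical all_reals all_analysis.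
From mathcomp Require Import ring lra zify.
(* The notations of mpoly clash with those of MathComp-Analysis. *)
From mathcomp Require Import -(notations) mpoly.
Set Implicit Arguments.
Unset Strict Implicit.
Unset Printing Implicit Defensive.
Import Order.TTheory GRing.Theory Num.Theory.
Local Open Scope classical_set_scope.
Local Open Scope ring_scope.

(** * The ring of integers as a complete discrete valuation ring *)

(** The lattice M' is described twice, because neither description does all the work. The mapping
    conditions on A_i, W_i and the dual lattices ([preserves]) are visibly stable under products and
    hold for g - 1 with g in Aut(L); the inequalities in a frame ([tangent]) give a basis and its
    covolume. Their equivalence is delicate at one place: the additional 2 in the entries between
    special vectors of adjacent type I levels cannot be read off at a single level. The condition of
    Z_i and its dual only couple the pair of levels (i-1, i) with the pair (i, i+1), and an
    induction starting at level 0 decouples them. The quadratic term X^T S X of rho(1 + X) has to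
    lie in the image lattice of the differential, whose diagonal entries carry one more 2; the
    conditions modulo 2 on q in B_i and Z_i provide this. Substituting 1 + 2X and dividing by 2
    turns the equation of O(V,q) into z = -2 Q(l, z), with l the kernel coordinates, z the remaining
    ones and Q integral and quadratic. This is a fixed point equation of a 2-adic contraction. It
    parametrizes the fibres and, in a perturbed form, lifts the points of the special fiber. *)

Section SubringSets.
Variables (V : pzRingType) (T : set V).

Definition subring_set : Prop :=
  [/\ T 1, forall x y, T x -> T y -> T (x - y) & forall x y, T x -> T y -> T (x * y)].

Hypothesis hT : subring_set.

Let T1 : T 1. Proof. by case: hT. Qed.
Let TB x y : T x -> T y -> T (x - y). Proof. by case: hT => _ h _; apply: h. Qed.
Let TM x y : T x -> T y -> T (x * y). Proof. by case: hT => _ _ h; apply: h. Qed.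

Lemma subring_set0 : T 0.
Proof. by rewrite -(subrr 1); apply: TB. Qed.

Lemma subring_setN x : T x -> T (- x).
Proof. by move=> Tx; rewrite -sub0r; apply: TB => //; exact: subring_set0. Qed.

Lemma subring_setD x y : T x -> T y -> T (x + y).
Proof. by move=> Tx Ty; rewrite -[y]opprK; apply: TB => //; exact: subring_setN. Qed.

Lemma subring_set_nat m : T m%:R.
Proof.
by elim: m => [|m IH]; rewrite ?mulr0n -?natr1; [exact: subring_set0 | exact: subring_setD].
Qed.

Lemma subring_setX x k : T x -> T (x ^+ k).
Proof. by move=> Tx; elim: k => [|k IH]; rewrite ?expr0 ?exprS //; apply: TM. Qed.

Lemma subring_set_sum I (s : seq I) (P : pred I) (g : I -> V) :
  (forall i, P i -> T (g i)) -> T (\sum_(i <- s | P i) g i).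
Proof. by move=> h; elim/big_ind: _ => //; [exact: subring_set0 | exact: subring_setD]. Qed.

Lemma subring_set_prod I (s : seq I) (P : pred I) (g : I -> V) :
  (forall i, P i -> T (g i)) -> T (\prod_(i <- s | P i) g i).
Proof. by move=> h; elim/big_ind: _. Qed.

End SubringSets.

(** * The 2-adic norm and the ring Z_2 *)

Section TwoAdicNumbers.
Variables (R : realType) (K : fieldType) (nrm : K -> R) (hK : is_Q2 nrm).

Lemma nrm1 : nrm 1 = 1.
Proof. by have := nrm_nat hK (ltn0Sn 0); rewrite logn1 expr0 invr1. Qed.

Lemma nrm0 : nrm 0 = 0.
Proof. exact/(nrm_eq0 hK). Qed.

Lemma nrm2 : nrm 2 = 2^-1.
Proof. by have := nrm_nat hK (ltn0Sn 1); rewrite (pfactorK 1 (isT : prime 2)) expr1. Qed.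

Lemma nrmN1 : nrm (-1) = 1.
Proof.
have e : nrm (-1) ^+ 2 = 1 by rewrite expr2 -(nrmM hK) mulrNN mulr1 nrm1.
have := nrm_triangle hK 2 (-1); rewrite (_ : 2 - 1 = 1); last by ring.
rewrite nrm1 nrm2 => h.
have : (nrm (-1) - 1) * (nrm (-1) + 1) = 0 by rewrite -subr_sqr e expr1n subrr.
by move/eqP; rewrite mulf_eq0 => /orP[] /eqP h'; lra.
Qed.

Lemma nrmN x : nrm (- x) = nrm x.
Proof. by rewrite -mulN1r (nrmM hK) nrmN1 mul1r. Qed.

Lemma nrm_ge0 x : 0 <= nrm x.
Proof. by have := nrm_triangle hK x (- x); rewrite subrr nrm0 nrmN; lra. Qed.

Lemma nrmX x k : nrm (x ^+ k) = nrm x ^+ k.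
Proof. by elim: k => [|k IH]; rewrite ?expr0 ?nrm1 // !exprS (nrmM hK) IH. Qed.

Lemma nrm_nat_le1 m : nrm m%:R <= 1.
Proof.
case: m => [|m]; first by rewrite nrm0.
by rewrite (nrm_nat hK) // invf_le1 ?exprn_ege1 ?exprn_gt0 //; lra.
Qed.

Lemma two_neq0_Q2 : (2 : K) != 0.
Proof. by apply/eqP => /(nrm_eq0 hK); rewrite nrm2 => /eqP; rewrite invr_eq0 pnatr_eq0. Qed.

Lemma nrm_sum I (s : seq I) (P : pred I) (F : I -> K) :
  nrm (\sum_(i <- s | P i) F i) <= \sum_(i <- s | P i) nrm (F i).
Proof.
elim/big_rec2: _ => [|i y1 y2 _ le]; first by rewrite nrm0.
exact: le_trans (nrm_triangle hK _ _) (lerD _ _).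
Qed.

(* Applied to powers of nrm (x + y), this makes nrm ultrametric. *)
Lemma subexponential_le1 (t : R) : 0 <= t -> (forall k : nat, t ^+ k <= k.+1%:R) -> t <= 1.
Proof.
move=> t0 H; rewrite leNgt; apply/negP => t1.
set d := t - 1; have d0 : 0 < d by rewrite subr_gt0.
have bern k : 1 + k%:R * d <= t ^+ k.
  elim: k => [|k IH]; first by rewrite mul0r addr0 expr0.
  rewrite exprS -natr1 mulrDl mul1r.
  have -> : t = 1 + d by rewrite /d; ring.
  rewrite -/d in IH *.
  have h1 : (1 + d) * (1 + k%:R * d) <= (1 + d) * (1 + d) ^+ k.
    by rewrite ler_wpM2l //; [lra | have -> : 1 + d = t by rewrite /d; ring].
  apply: le_trans h1; have : 0 <= k%:R * d * d by rewrite !mulr_ge0 // ltW.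
  by nra.
(* At the exponent 2k the growth is quadratic: t^(2k) >= (1 + k d)^2 > (k d)^2 > 3k >= 2k + 1. *)
pose k := (Num.bound (3 / d ^+ 2)).+1.
have kd : 3 < k%:R * d ^+ 2.
  rewrite -ltr_pdivrMr ?exprn_gt0 //.
  have : 3 / d ^+ 2 < (Num.bound (3 / d ^+ 2))%:R.
    by apply: archi_boundP; rewrite divr_ge0 ?exprn_ge0 // ltW.
  by move=> h; apply: lt_trans h _; rewrite ltr_nat.
have := H (k * 2)%N; rewrite exprM => h.
have h2 : (1 + k%:R * d) ^+ 2 <= (t ^+ k) ^+ 2.
  by rewrite lerXn2r ?nnegrE ?exprn_ge0 // addr_ge0 // mulr_ge0 // ltW.
have := le_trans h2 h; rewrite -natr1 natrM => h3.
have k1 : 1 <= k%:R :> R by rewrite ler1n.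
have : 3 * k%:R < (k%:R * d) ^+ 2.
  by rewrite exprMn expr2 -mulrA [X in _ < X]mulrC ltr_pM2r //; lra.
by have := mulr_ge0 (ler0n R k) (ltW d0); nra.
Qed.

Lemma nrm_add_le1 x y : nrm x <= 1 -> nrm y <= 1 -> nrm (x + y) <= 1.
Proof.
move=> hx hy; apply: subexponential_le1 => [|k]; first exact: nrm_ge0.
rewrite -nrmX exprDn; apply: le_trans (nrm_sum _ _ _) _.
apply: le_trans (_ : _ <= \sum_(i < k.+1) 1) _; last first.
  by rewrite sumr_const card_ord.
apply: ler_sum => i _; rewrite -mulr_natr !(nrmM hK) !nrmX.
rewrite mulr_ile1 ?nrm_ge0 ?nrm_nat_le1 ?mulr_ge0 ?exprn_ge0 ?nrm_ge0 //.
by rewrite mulr_ile1 ?exprn_ge0 ?nrm_ge0 ?exprn_ile1 ?nrm_ge0.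
Qed.

Lemma nrm_sub_le1 x y : nrm x <= 1 -> nrm y <= 1 -> nrm (x - y) <= 1.
Proof. by move=> hx hy; apply: nrm_add_le1; rewrite ?nrmN. Qed.

Lemma nrm_mul_le1 x y : nrm x <= 1 -> nrm y <= 1 -> nrm (x * y) <= 1.
Proof. by move=> hx hy; rewrite (nrmM hK) mulr_ile1 ?nrm_ge0. Qed.

(** The proof of [is_Q2 nrm] is an argument so that the subring instance, which depends on it, can
    be attached to the predicate. The resulting ring [Z2] gives access to [integralOver], hence to
    the closure properties of integral elements. *)
Definition Z2_pred of is_Q2 nrm : {pred K} := fun x => nrm x <= 1.

Fact Z2_subring_closed : subring_closed (Z2_pred hK).
Proof.
split; first by rewrite unfold_in nrm1.
- by move=> x y; apply: nrm_sub_le1.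
- by move=> x y; apply: nrm_mul_le1.
Qed.
HB.instance Definition _ :=
  GRing.isSubringClosed.Build K (Z2_pred hK) Z2_subring_closed.

Record Z2 := MkZ2 { Z2val : K; _ : Z2val \in Z2_pred hK }.
HB.instance Definition _ := [isSub for Z2val].
HB.instance Definition _ := [Choice of Z2 by <:].
HB.instance Definition _ := [SubChoice_isSubComNzRing of Z2 by <:].

Lemma nrm_scale k x : nrm (2 ^+ k * x) = 2 ^- k * nrm x.
Proof. by rewrite (nrmM hK) nrmX nrm2 exprVn. Qed.

Lemma two_power_small (eps : R) : 0 < eps -> exists k : nat, 2 ^- k < eps.
Proof.
move=> e0; exists (Num.bound eps^-1).
rewrite invf_plt ?posrE ?exprn_gt0 //.
have h : eps^-1 < (Num.bound eps^-1)%:R by apply: archi_boundP; rewrite invr_ge0 ltW.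
apply: lt_le_trans h _; rewrite -natrX ler_nat; exact: ltnW (ltn_expl _ _).
Qed.

Lemma nrm_divX k x : (2 : K) != 0 -> nrm (x / 2 ^+ k) = 2 ^+ k * nrm x.
Proof.
move=> two0; have e : x = 2 ^+ k * (x / 2 ^+ k) by rewrite mulrC divfK ?expf_neq0.
rewrite {2}e nrm_scale mulrA divff ?mul1r // expf_neq0 //; lra.
Qed.

Lemma nrm_add_le k x y : nrm x <= 2 ^- k -> nrm y <= 2 ^- k -> nrm (x + y) <= 2 ^- k.
Proof.
have e z : (nrm z <= 2 ^- k) = (nrm (z / 2 ^+ k) <= 1).
  by rewrite nrm_divX ?two_neq0_Q2 // mulrC -ler_pdivlMr ?exprn_gt0 // div1r.
by rewrite !e mulrDl; apply: nrm_add_le1.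
Qed.

(** The tail of the series beyond index k is divisible by 2^k, so the partial sums are Cauchy and
    the limit inherits the explicit bound. *)
Lemma Z2_series (z : nat -> K) : (forall k, nrm (z k) <= 1) ->
  exists w, forall k, nrm (w - \sum_(j < k) 2 ^+ j * z j) <= 2 ^- k.
Proof.
move=> hz; set s := fun k : nat => \sum_(j < k) 2 ^+ j * z j.
have Cs k i : nrm (s (k + i)%N - s k) <= 2 ^- k.
  elim: i => [|i IH]; first by rewrite addn0 subrr nrm0 invr_ge0 exprn_ge0.
  rewrite addnS /s big_ord_recr /= addrAC -/(s _) -/(s k); apply: nrm_add_le => //.
  rewrite nrm_scale exprD invfM -mulrA ler_piMr ?invr_ge0 ?exprn_ge0 //.
  rewrite mulr_ile1 ?invr_ge0 ?exprn_ge0 ?nrm_ge0 //.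
  by rewrite invf_le1 ?exprn_gt0 // exprn_ege1 //; lra.
have Cs2 k i : (k <= i)%N -> nrm (s i - s k) <= 2 ^- k by move/subnKC <-.
have [|w hw] := nrm_complete hK (u := s).
  move=> eps /two_power_small[k ke]; exists k => i j ki kj.
  have -> : s i - s j = (s i - s k) + - (s j - s k) by ring.
  by apply: le_lt_trans ke; apply: nrm_add_le; rewrite ?nrmN; apply: Cs2.
exists w => k; have [|N hN] := hw (2 ^- k); first by rewrite invr_gt0 exprn_gt0.
have -> : w - s k = - (s (maxn N k) - w) + (s (maxn N k) - s k) by ring.
apply: nrm_add_le; last by apply: Cs2; rewrite leq_maxr.
by rewrite nrmN ltW // hN // leq_maxl.
Qed.

End TwoAdicNumbers.

(** The interface between the arithmetic of F and the rest of the proof: 2 is a uniformizer, and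
    completeness is stated for sequences that stabilize modulo 2^k at step k. *)
Record complete_dvr (F : fieldType) (A : set F) : Prop := {
  dvr1 : A 1;
  dvrB : forall x y, A x -> A y -> A (x - y);
  dvrM : forall x y, A x -> A y -> A (x * y);
  dvr_half : ~ A 2^-1;
  dvr_ord : forall x, x != 0 -> exists k : int, A_unit A (x * 2 ^ (- k));
  dvr_complete : forall u : nat -> F, (forall k, pow2A A k (u k.+1 - u k)) ->
    exists l, forall k, pow2A A k (l - u k) }.

Section RingOfIntegers.
Variables (R : realType) (K : fieldType) (nrm : K -> R) (hK : is_Q2 nrm).
Variables (F : fieldExtType K) (A : set F) (hA : A = ring_of_integers nrm F).

Let iota : {rmorphism Z2 hK -> F} := in_alg F \o val.

Lemma ring_of_integersE x : A x <-> integralOver iota x.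
Proof.
rewrite hA; split.
  case=> p [mp hp rp]; pose q : {poly Z2 hK} := \poly_(i < size p) insubd 0 p`_i.
  have qv i : val q`_i = p`_i.
    rewrite coef_poly; case: ltnP => si; last by rewrite raddf0 nth_default.
    exact: (insubdK 0 (hp i : p`_i \in Z2_pred hK)).
  have qp : map_poly val q = p by apply/polyP => i; rewrite coef_map; exact: qv.
  exists q; last by rewrite map_poly_comp /= qp.
  have sq : size q = size p.
    by apply/eqP; rewrite eqn_leq size_poly /= -{1}qp size_poly.
  apply/eqP/val_inj; rewrite lead_coefE sq qv -lead_coefE (eqP mp).
  by rewrite rmorph1.
case=> q mq rq; exists (map_poly val q); split.
- exact: monic_map.
- by move=> i; rewrite coef_map; apply: (valP q`_i).
- by rewrite -map_poly_comp.
Qed.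

Lemma integer1 : A 1.
Proof. by apply/ring_of_integersE; apply: integral1. Qed.

Lemma integerB x y : A x -> A y -> A (x - y).
Proof. by move=> /ring_of_integersE ? /ring_of_integersE ?; apply/ring_of_integersE/integral_sub. Qed.

Lemma integerM x y : A x -> A y -> A (x * y).
Proof. by move=> /ring_of_integersE ? /ring_of_integersE ?; apply/ring_of_integersE/integral_mul. Qed.

Lemma integer_alg z : nrm z <= 1 -> A (in_alg F z).
Proof. by move=> hz; apply/ring_of_integersE; apply: (integral_id iota (MkZ2 (hz : z \in Z2_pred hK))). Qed.

(** In a monic equation of degree m for 1/2, multiplication by 2^m turns the leading term into 1 and
    all other terms into multiples of 2. *)
Lemma integer_half : ~ A 2^-1.
Proof.
rewrite hA => -[p [mp hp]]; set h := (2^-1 : K).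
have -> : (2^-1 : F) = in_alg F h by rewrite fmorphV rmorph_nat.
rewrite rootE horner_map fmorph_eq0 horner_coef.
have p0 : (0 < size p)%N by rewrite size_poly_gt0 monic_neq0.
rewrite -(prednK p0) big_ord_recr /=; set m := (size p).-1.
have -> : p`_m = 1 by have := eqP mp; rewrite lead_coefE.
move/eqP=> e; have two0 := two_neq0_Q2 hK.
have : nrm (2 ^+ m * - \sum_(i < m) p`_i * h ^+ i) <= 2^-1.
  rewrite mulrN mulr_sumr nrmN //.
  apply: (@le_trans _ _ (2 ^- 1)); last by rewrite expr1.
  elim/big_ind: _ => [|x y|i _]; first by rewrite nrm0 // invr_ge0.
    exact: (@nrm_add_le _ _ _ hK 1).
  have -> : 2 ^+ m * (p`_i * h ^+ i) = 2 * (2 ^+ (m - i).-1 * p`_i).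
    have im : (m = (m - i).-1 + i + 1)%N by have := ltn_ord i; lia.
    rewrite {1}im !exprD expr1 /h exprVn; field.
    exact: expf_neq0.
  rewrite (nrmM hK) nrm2 // expr1 ler_piMr ?invr_ge0 // nrm_mul_le1 //.
  by rewrite nrmX // exprn_ile1 ?nrm_ge0 // nrm2 // invf_le1 // ler1n.
have -> : - (\sum_(i < m) p`_i * h ^+ i) = 1 * h ^+ m.
  by apply/eqP; rewrite eq_sym -addr_eq0 addrC e.
by rewrite mul1r /h exprVn divff ?expf_neq0 // nrm1 //; lra.
Qed.

Lemma integer_two_neq0 : (2 : F) != 0.
Proof. by apply/eqP => h; apply: integer_half; rewrite h invr0 -(subrr 1); apply: integerB; apply: integer1. Qed.

Lemma integer_subring : subring_set A.
Proof. by split; [exact: integer1 | exact: integerB | exact: integerM]. Qed.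

(** If the coefficients of the minimal polynomial have norm at most 2^k, then 2^k x is a root of the
    monic polynomial with coefficients p_i 2^(k (m - i)), and these have norm at most 1. *)
Lemma integer_denom (x : F) : exists k : nat, A (2 ^+ k * x).
Proof.
have /polyOver1P[p ep] := minPolyOver 1%AS x.
have two0 := two_neq0_Q2 hK.
have rp : root (map_poly (in_alg F) p) x by rewrite -ep root_minPoly.
have mp : p \is monic by rewrite -(map_monic (in_alg F)) -ep monic_minPoly.
have [k hk] : exists k : nat, forall i, nrm p`_i <= 2 ^+ k.
  pose B := \sum_(i < size p) nrm p`_i.
  have B0 : 0 <= B by apply: sumr_ge0 => i _; apply: nrm_ge0.
  exists (Num.bound B) => i.
  have hB : B <= 2 ^+ Num.bound B.
    apply: ltW; apply: lt_le_trans (archi_boundP B0) _.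
    by rewrite -natrX ler_nat ltnW // ltn_expl.
  apply: le_trans hB; case: (ltnP i (size p)) => si.
    rewrite /B (bigD1 (Ordinal si)) //= lerDl sumr_ge0 // => j _; exact: nrm_ge0.
  by rewrite nth_default // nrm0.
exists k; rewrite hA; set m := (size p).-1.
have p0 : (0 < size p)%N by rewrite size_poly_gt0 monic_neq0.
exists (\poly_(i < size p) (p`_i * 2 ^+ (k * (m - i)))); split.
- apply/monicP; rewrite lead_coefE.
  have lp : p`_m = 1 by have := eqP mp; rewrite lead_coefE.
  have sz : size (\poly_(i < size p) (p`_i * 2 ^+ (k * (m - i)))) = size p.
    apply: size_poly_eq; rewrite -/m lp mul1r subnn muln0 expr0; exact: oner_neq0.
  by rewrite sz coef_poly prednK ?leqnn // -/m lp subnn muln0 expr0 mul1r.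
- move=> i; rewrite coef_poly; case: ltnP => si; last by rewrite nrm0 // ler01.
  have := si; rewrite -(prednK p0) ltnS leq_eqVlt => /orP[/eqP ->|im].
    rewrite -/m subnn muln0 expr0 mulr1.
    by have -> : p`_m = 1 by [have := eqP mp; rewrite lead_coefE]; rewrite nrm1.
  rewrite (nrmM hK) nrmX // nrm2 // exprVn ler_pdivrMr ?exprn_gt0 // mul1r.
  apply: le_trans (hk i) _; rewrite ler_weXn2l //; first by lra.
  by rewrite -/m in im; nia.
- rewrite rootE horner_coef.
  have spF : size (map_poly (in_alg F) p) = size p by rewrite size_map_poly.
  have -> : size (map_poly (in_alg F) (\poly_(i < size p) (p`_i * 2 ^+ (k * (m - i))))) = size p.
    rewrite size_map_poly; apply: size_poly_eq.
    rewrite -/m subnn muln0 expr0 mulr1 -lead_coefE (eqP mp); exact: oner_neq0.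
  move/eqP: rp; rewrite horner_coef spF => rp.
  apply/eqP; apply: (@eq_trans _ _ ((2 ^+ k) ^+ m * \sum_(i < size p) (map_poly (in_alg F) p)`_i * x ^+ i)); last by rewrite rp mulr0.
  rewrite mulr_sumr.
  apply: eq_bigr => i _; rewrite !(coef_map (in_alg F)) coef_poly ltn_ord /= -!in_algE.
  have -> : in_alg F (p`_i * 2 ^+ (k * (m - i))) = in_alg F p`_i * 2 ^+ (k * (m - i)).
    by rewrite rmorphM rmorphXn rmorph_nat.
  have im : (k * m = k * (m - i) + k * i)%N.
    by rewrite -mulnDr subnK // -ltnS prednK.
  by rewrite exprMn -!exprM im exprD; ring.
Qed.

Section Complete.
Variables (hF : unramified A) (kappa : finFieldType) (pi : F -> kappa) (hpi : is_residue_map A pi).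

Let lift (c : kappa) : F := xget 0 [set x | A x /\ pi x = c].

Let liftP c : A (lift c) /\ pi (lift c) = c.
Proof.
by rewrite /lift; case: xgetP => [x _ [] //|h]; have [x Ax px] := residue_onto hpi c; case: (h x).
Qed.

(** The 2-divisibility of an integral y <> 0 is bounded by any l with 2^l / y integral, since 1/2 is
    not integral. At the largest exponent the cofactor is not in 2A, and [unramified] makes it a
    unit. *)
Lemma integer_ord (x : F) : x != 0 -> exists k : int, A_unit A (x * 2 ^ (- k)).
Proof.
move=> x0; have two0 := integer_two_neq0.
have [k hk] := integer_denom x; have [l hl] := integer_denom (2 ^+ k * x)^-1.
set y := 2 ^+ k * x in hk hl; have y0 : y != 0 by rewrite mulf_neq0 ?expf_neq0.
have bound j a : A a -> y = 2 ^+ j * a -> (j <= l)%N.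
  move=> Aa ya; rewrite leqNgt; apply/negP => lj; apply: integer_half.
  have a0 : a != 0 by apply: contra_neq y0 => a0; rewrite ya a0 mulr0.
  have := integerM Aa hl; rewrite ya.
  have jE : (j = (j - l).-1 + l + 1)%N by lia.
  move=> /(integerM (subring_setX integer_subring (j - l).-1 (subring_set_nat integer_subring 2))).
  suff -> : 2 ^+ (j - l).-1 * (a * (2 ^+ l * (2 ^+ j * a)^-1)) = 2^-1 by [].
  by rewrite {2}jE !exprD expr1; field; rewrite a0 two0 !expf_neq0.
have [j [a Aa ya] na] : exists2 j, (exists2 a, A a & y = 2 ^+ j * a) &
    ~ exists2 a, A a & y = 2 ^+ j.+1 * a.
  apply: contrapT => H; have : forall j, exists2 a, A a & y = 2 ^+ j * a.
    elim=> [|j IH]; first by exists y; rewrite ?mul1r.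
    by apply: contrapT => na; apply: H; exists j.
  by move=> /(_ l.+1) [a Aa /(bound _ _ Aa)]; rewrite ltnn.
exists (j%:Z - k%:Z).
have -> : x * 2 ^ (- (j%:Z - k%:Z)) = a.
  rewrite opprB expfzDr // -exprnP -exprnN mulrCA mulrC.
  have -> : x / 2 ^+ j * 2 ^+ k = y / 2 ^+ j by rewrite /y; ring.
  by rewrite ya; field; exact: expf_neq0.
apply: hF => // -[b Ab ab]; apply: na; exists b => //.
by rewrite ya ab exprSr mulrA.
Qed.

Lemma pow2_cancel0 (x : F) : (forall k, pow2A A k x) -> x = 0.
Proof.
move=> h; apply/eqP/negPn/negP => x0; have [l hl] := integer_denom x^-1.
have two0 := integer_two_neq0.
have [a Aa ax] := h l.+1; apply: integer_half.
have a0 : a != 0 by apply: contra_neq x0 => a0; rewrite -ax a0 mulr0.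
have := integerM Aa hl; rewrite -ax exprS.
by congr A; field; rewrite a0 two0 expf_neq0.
Qed.

(** In the 2-adic expansion of b with digits [lift c], the powers of 2 carrying the same digit c are
    collected into one coefficient z c, which converges in K. So finitely many lifts span A over
    Z_2, and the completeness of A is reduced to that of K. *)
Lemma integer_span (b : F) : A b ->
  exists2 z : kappa -> K, (forall c, nrm (z c) <= 1) & b = \sum_c in_alg F (z c) * lift c.
Proof.
move=> Ab.
have /choice[step hstep] : forall x, exists y, A x -> A y /\ x = lift (pi x) + 2 * y.
  move=> x.
  have [Ax|nAx] := pselect (A x); last by exists 0.
  have [Al pl] := liftP (pi x).
  have Ad := integerB Ax Al.
  have pd : pi (x - lift (pi x)) = 0.
    have := residueD hpi Ad Al; rewrite subrK pl.
    by move/(congr1 (fun t => t - pi x)); rewrite addrK subrr.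
  have /(residue_ker hpi Ad)[a Aa ea] := pd.
  by exists a => _; split=> //; rewrite -ea addrC subrK.
(* [t k] is the remainder after k digits, and [pi (t k)] is the next digit. *)
pose t k := iter k step b; have At k : A (t k).
  by elim: k => //= k IH; case: (hstep _ IH).
have tE k : b = \sum_(j < k) 2 ^+ j * lift (pi (t j)) + 2 ^+ k * t k.
  elim: k => [|k IH]; first by rewrite big_ord0 add0r mul1r.
  have [_ e] := hstep _ (At k).
  rewrite big_ord_recr /= [LHS]IH {1}e exprSr; ring.
have /choice[z hz] : forall c, exists w, forall k,
    nrm (w - \sum_(j < k) 2 ^+ j * (pi (t j) == c)%:R) <= 2 ^- k.
  by move=> c; apply: (Z2_series hK (z := fun j => (pi (t j) == c)%:R)) => k; exact: nrm_nat_le1.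
exists z => [c|]; first by have := hz c 0%N; rewrite big_ord0 subr0 expr0 invr1.
apply/eqP; rewrite -subr_eq0; apply/eqP/pow2_cancel0 => k.
exists (t k - \sum_c in_alg F ((z c - \sum_(j < k) 2 ^+ j * (pi (t j) == c)%:R) / 2 ^+ k) * lift c).
  apply: integerB => //; elim/big_ind: _ => [|x y Ax Ay|c _].
  - exact: subring_set0 integer_subring.
  - exact: (subring_setD integer_subring).
  - apply: integerM; last by case: (liftP c).
    apply: integer_alg; rewrite (nrm_divX hK _ _ (two_neq0_Q2 hK)).
    have := hz c k; rewrite -(ler_pM2l (_ : 0 < 2 ^+ k)) ?exprn_gt0 //.
    by rewrite divff // expf_neq0 //; lra.
rewrite mulrBr [b in RHS](tE k) mulr_sumr; set Z := \sum_c in_alg F (z c) * lift c.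
have -> : \sum_c 2 ^+ k * (in_alg F ((z c - \sum_(j < k) 2 ^+ j * (pi (t j) == c)%:R) / 2 ^+ k) * lift c)
   = Z - \sum_c in_alg F (\sum_(j < k) 2 ^+ j * (pi (t j) == c)%:R) * lift c.
  rewrite -sumrB; apply: eq_bigr => c _.
  rewrite fmorph_div rmorphXn rmorph_nat mulrA mulrCA divff ?mulr1 ?expf_neq0 ?integer_two_neq0 //.
  by rewrite rmorphB mulrBl.
suff -> : \sum_c in_alg F (\sum_(j < k) 2 ^+ j * (pi (t j) == c)%:R) * lift c
   = \sum_(j < k) 2 ^+ j * lift (pi (t j)) by ring.
under eq_bigr do rewrite rmorph_sum mulr_suml.
rewrite exchange_big /=; apply: eq_bigr => j _.
rewrite (bigD1 (pi (t j))) //= big1 ?addr0 => [|c].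
  by rewrite eqxx mulr1 -in_algE rmorphXn rmorph_nat.
by rewrite eq_sym => /negPf ->; rewrite mulr0 scale0r mul0r.
Qed.

(** Each increment is written in the finite spanning set of lifts, and the coefficients of each lift
    are summed in K. *)
Lemma integer_complete (u : nat -> F) : (forall k, pow2A A k (u k.+1 - u k)) ->
  exists l, forall k, pow2A A k (l - u k).
Proof.
move=> hu.
have /choice[z hz] : forall k, exists z : kappa -> K, (forall c, nrm (z c) <= 1) /\
    u k.+1 - u k = 2 ^+ k * \sum_c in_alg F (z c) * lift c.
  by move=> k; have [b /integer_span[z hz ->] <-] := hu k; exists z.
have /choice[w hw] : forall c, exists w, forall k,
    nrm (w - \sum_(j < k) 2 ^+ j * z j c) <= 2 ^- k.
  by move=> c; apply: (Z2_series hK (z := fun j => z j c)) => k; case: (hz k).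
have uE k : u k = u 0%N + \sum_c in_alg F (\sum_(j < k) 2 ^+ j * z j c) * lift c.
  elim: k => [|k IH].
    by rewrite big1 ?addr0 // => c _; rewrite big_ord0 rmorph0 mul0r.
  have [_ e] := hz k; rewrite -[LHS](subrK (u k)) e IH mulr_sumr addrC -addrA -big_split /=.
  congr (_ + _); apply: eq_bigr => c _.
  by rewrite big_ord_recr -!in_algE rmorphD rmorphM rmorphXn rmorph_nat; ring.
exists (u 0%N + \sum_c in_alg F (w c) * lift c) => k.
exists (\sum_c in_alg F ((w c - \sum_(j < k) 2 ^+ j * z j c) / 2 ^+ k) * lift c).
  elim/big_ind: _ => [|x y Ax Ay|c _].
  - exact: subring_set0 integer_subring.
  - exact: (subring_setD integer_subring).
  - apply: integerM; last by case: (liftP c).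
    apply: integer_alg; rewrite (nrm_divX hK _ _ (two_neq0_Q2 hK)).
    have := hw c k; rewrite -(ler_pM2l (_ : 0 < 2 ^+ k)) ?exprn_gt0 //.
    by rewrite divff // expf_neq0 //; lra.
rewrite (uE k) opprD addrACA subrr add0r -sumrB mulr_sumr.
apply: eq_bigr => c _.
rewrite fmorph_div rmorphXn rmorph_nat mulrA mulrCA divff ?mulr1 ?expf_neq0 ?integer_two_neq0 //.
by rewrite rmorphB mulrBl.
Qed.

Lemma ring_of_integers_complete_dvr : complete_dvr A.
Proof.
split; [exact: integer1 | exact: integerB | exact: integerM | exact: integer_half
  | exact: integer_ord | exact: integer_complete].
Qed.

End Complete.
End RingOfIntegers.

(** * Integral matrices and the absolute value *)

Section CompleteDvr.
Variables (F : fieldType) (A : set F) (hA : complete_dvr A).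
Local Notation dv := (pow2A A).

Let A1 := dvr1 hA.
Let AB := dvrB hA.
Let AM := dvrM hA.

Lemma dvr_subring : subring_set A.
Proof. by []. Qed.

Lemma dvr0 : A 0.
Proof. exact: subring_set0 dvr_subring. Qed.

Lemma dvrN x : A x -> A (- x).
Proof. exact: subring_setN dvr_subring x. Qed.

Lemma dvrD x y : A x -> A y -> A (x + y).
Proof. exact: (subring_setD dvr_subring). Qed.

Lemma dvr_two_neq0 : (2 : F) != 0.
Proof. by apply/eqP => h; apply: (dvr_half hA); rewrite h invr0; exact: dvr0. Qed.
Let two0 := dvr_two_neq0.
Let twoX0 k : (2 : F) ^+ k != 0. Proof. exact: expf_neq0. Qed.

Lemma dvr_nat m : A m%:R.
Proof. exact: subring_set_nat dvr_subring m. Qed.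

Lemma dvrX x k : A x -> A (x ^+ k).
Proof. exact: (subring_setX dvr_subring). Qed.

Lemma dvr_sum I (s : seq I) (P : pred I) (g : I -> F) :
  (forall i, P i -> A (g i)) -> A (\sum_(i <- s | P i) g i).
Proof. exact: (subring_set_sum dvr_subring). Qed.

Lemma dvr_prod I (s : seq I) (P : pred I) (g : I -> F) :
  (forall i, P i -> A (g i)) -> A (\prod_(i <- s | P i) g i).
Proof. exact: (subring_set_prod dvr_subring). Qed.

Lemma dvE k x : dv k x <-> A (x / 2 ^+ k).
Proof.
split; first by case=> a Aa <-; rewrite mulrAC divff // mul1r.
by move=> h; exists (x / 2 ^+ k) => //; rewrite mulrC divfK.
Qed.

Lemma dv_mul k a : A a -> dv k (2 ^+ k * a).
Proof. by exists a. Qed.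

Lemma dv0E x : dv 0 x <-> A x.
Proof. by rewrite dvE expr0 divr1. Qed.

Lemma dv_0 k : dv k 0.
Proof. by apply/dvE; rewrite mul0r; exact: dvr0. Qed.

Lemma dvD k x y : dv k x -> dv k y -> dv k (x + y).
Proof. by move=> /dvE hx /dvE hy; apply/dvE; rewrite mulrDl; apply: dvrD. Qed.

Lemma dvN k x : dv k x -> dv k (- x).
Proof. by move=> /dvE hx; apply/dvE; rewrite mulNr; apply: dvrN. Qed.

Lemma dvB k x y : dv k x -> dv k y -> dv k (x - y).
Proof. by move=> hx /dvN; apply: dvD. Qed.

Lemma dvM j k x y : dv j x -> dv k y -> dv (j + k) (x * y).
Proof.
move=> [a Aa <-] [b Ab <-]; exists (a * b); first exact: AM.
by rewrite exprD; ring.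
Qed.

Lemma dvMl k a x : A a -> dv k x -> dv k (a * x).
Proof. by move=> /dv0E Aa hx; rewrite -[k]add0n; apply: dvM. Qed.

Lemma dvMr k a x : A a -> dv k x -> dv k (x * a).
Proof. by rewrite mulrC; apply: dvMl. Qed.

Lemma dv_le j k x : (j <= k)%N -> dv k x -> dv j x.
Proof.
move=> jk [a Aa <-]; exists (2 ^+ (k - j) * a).
  by apply: AM => //; apply: dvrX; apply: dvr_nat.
by rewrite mulrA -exprD subnKC.
Qed.

Lemma dv_int k x : dv k x -> A x.
Proof. by move/(dv_le (leq0n k))/dv0E. Qed.

Lemma dv_sum k I (s : seq I) (P : pred I) (g : I -> F) :
  (forall i, P i -> dv k (g i)) -> dv k (\sum_(i <- s | P i) g i).
Proof. by move=> h; elim/big_ind: _ => //; [apply: dv_0 | apply: dvD]. Qed.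

Lemma dv_pow2 j k : (j <= k)%N -> dv j (2 ^+ k).
Proof. by move=> jk; apply: (dv_le jk); exists 1; rewrite ?mulr1. Qed.

Lemma dv_shift j k x : dv (j + k) (2 ^+ j * x) <-> dv k x.
Proof.
split; last by apply: dvM; apply: dv_pow2.
case=> a Aa; rewrite exprD -mulrA => /(mulfI (twoX0 j)) <-; exact: dv_mul.
Qed.

Lemma dv_infty x : (forall k, dv k x) -> x = 0.
Proof.
move=> h; apply/eqP/negPn/negP => x0; apply: (dvr_half hA).
have [k [_ Au Av]] := dvr_ord hA x0.
have [l hl] : exists l : nat, A (2 ^+ l * x^-1).
  case: k Au Av => k Au Av; exists k.
    by move: Av; rewrite -exprnN invfM invrK mulrC.
  move: Av; rewrite NegzE opprK -exprnP invfM => Av.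
  have -> : 2 ^+ k / x = 2 ^+ (k + k.+1) * (x^-1 / 2 ^+ k.+1).
    by rewrite exprD; field; rewrite x0 twoX0.
  by apply: AM => //; apply: dvrX; apply: dvr_nat.
have [a Aa ax] := h l.+1.
have a0 : a != 0 by apply: contra_neq x0 => a0; rewrite -ax a0 mulr0.
by have := AM Aa hl; rewrite -ax exprS; congr A; field; rewrite a0 two0 twoX0.
Qed.

Lemma dv1_1 : ~ dv 1 1.
Proof. by move/dvE; rewrite expr1 div1r; exact: dvr_half hA. Qed.

Lemma unit_ndv u : A_unit A u -> ~ dv 1 u.
Proof. by case=> u0 Au Av /(dvMl Av); rewrite mulVf //; exact: dv1_1. Qed.

Lemma unit1 : A_unit A 1.
Proof. by split; rewrite ?invr1 ?oner_neq0. Qed.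

Lemma unitM u v : A_unit A u -> A_unit A v -> A_unit A (u * v).
Proof.
case=> u0 Au Au' [v0 Av Av']; split; first by rewrite mulf_neq0.
  exact: AM.
by rewrite invfM; apply: AM.
Qed.

Lemma unitN u : A_unit A u -> A_unit A (- u).
Proof. by case=> u0 Au Av; split; rewrite ?oppr_eq0 ?invrN //; apply: dvrN. Qed.

Lemma unit_mul_eq1 u v : A u -> A v -> u * v = 1 -> A_unit A u.
Proof.
move=> Au Av e; have u0 : u != 0.
  by apply: contra_eq_neq e => ->; rewrite mul0r eq_sym oner_neq0.
split=> //; by have -> : u^-1 = v by rewrite -[LHS]mulr1 -e mulKf.
Qed.

Lemma nonunit_dv x : A x -> ~ dv 1 x -> A_unit A x.
Proof.
move=> Ax nx; have x0 : x != 0 by apply/eqP => x0; apply: nx; rewrite x0; exact: dv_0.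
have [[[|k]|k] hu] := dvr_ord hA x0.
- by move: hu; rewrite oppr0 expr0z mulr1.
- case: hu => _ hu _; case: nx.
  apply: (dv_le (ltn0Sn k)); apply/dvE.
  by move: hu; rewrite -exprnN.
- case: (unit_ndv hu); rewrite NegzE opprK -exprnP.
  by apply: dvMl => //; apply: dv_pow2.
Qed.

Lemma dv1M x y : A x -> A y -> dv 1 (x * y) -> dv 1 x \/ dv 1 y.
Proof.
move=> Ax Ay h; have [?|nx] := pselect (dv 1 x); first by left.
have [?|ny] := pselect (dv 1 y); first by right.
by case: (unit_ndv (unitM (nonunit_dv Ax nx) (nonunit_dv Ay ny)) h).
Qed.

Lemma dv1_sqr x : A x -> dv 1 (x ^+ 2) -> dv 1 x.
Proof. by move=> Ax; rewrite expr2 => /dv1M[]. Qed.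

Lemma unitD u x : A_unit A u -> dv 1 x -> A_unit A (u + x).
Proof.
move=> hu hx; apply: nonunit_dv; first by apply: dvrD; [case: hu | apply: dv_int hx].
by move/dvB/(_ hx); rewrite addrK; exact: unit_ndv.
Qed.

Section Integral.

Definition mdv (m n k : nat) : set 'M[F]_(m, n) :=
  [set M | forall i j, dv k (M i j)].

Lemma mdv0E m n (M : 'M[F]_(m, n)) : mdv 0 M <-> integral_mx A M.
Proof. by split=> h i j; apply/dv0E. Qed.

Lemma mdvD m n k (M N : 'M[F]_(m, n)) : mdv k M -> mdv k N -> mdv k (M + N).
Proof. by move=> hM hN i j; rewrite mxE; apply: dvD. Qed.

Lemma mdvN m n k (M : 'M[F]_(m, n)) : mdv k M -> mdv k (- M).
Proof. by move=> hM i j; rewrite mxE; apply: dvN. Qed.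

Lemma mdvB m n k (M N : 'M[F]_(m, n)) : mdv k M -> mdv k N -> mdv k (M - N).
Proof. by move=> hM hN; apply: mdvD => //; apply: mdvN. Qed.

Lemma mdvM m n p j k (M : 'M[F]_(m, n)) (N : 'M[F]_(n, p)) :
  mdv j M -> mdv k N -> mdv (j + k) (M *m N).
Proof. by move=> hM hN a b; rewrite mxE; apply: dv_sum => i _; apply: dvM. Qed.

Lemma mdvZ m n j k x (M : 'M[F]_(m, n)) : dv j x -> mdv k M -> mdv (j + k) (x *: M).
Proof. by move=> hx hM a b; rewrite mxE; apply: dvM. Qed.

Lemma mdv_0 m n k : mdv k (0 : 'M[F]_(m, n)).
Proof. by move=> i j; rewrite mxE; apply: dv_0. Qed.

Lemma mdv_le m n j k (M : 'M[F]_(m, n)) : (j <= k)%N -> mdv k M -> mdv j M.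
Proof. by move=> jk h a b; apply: dv_le jk _. Qed.

Lemma mdv_int m n k (M : 'M[F]_(m, n)) : mdv k M -> integral_mx A M.
Proof. by move/(mdv_le (leq0n k))/mdv0E. Qed.

Lemma mdv_infty m n (M : 'M[F]_(m, n)) : (forall k, mdv k M) -> M = 0.
Proof. by move=> h; apply/matrixP => i j; rewrite mxE; apply: dv_infty => k; apply: h. Qed.

Lemma mdv_scale m n j k (M : 'M[F]_(m, n)) : mdv (j + k) (2 ^+ j *: M) <-> mdv k M.
Proof.
split=> [h a b|h]; last by apply: mdvZ => //; apply: dv_pow2.
by apply/(dv_shift j); have := h a b; rewrite mxE.
Qed.

Lemma mdv_mul m n k (M : 'M[F]_(m, n)) : integral_mx A M -> mdv k (2 ^+ k *: M).
Proof. by move=> hM; rewrite -[X in mdv X]addn0; apply/mdv_scale/mdv0E. Qed.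

Lemma mdv_double m n k (M : 'M[F]_(m, n)) : mdv k M -> mdv k.+1 (2 *: M).
Proof. by move=> hM; rewrite -[k.+1]add1n -[2]expr1; apply/mdv_scale. Qed.

Lemma mdvP m n k (M : 'M[F]_(m, n)) : mdv k M -> exists2 N, integral_mx A N & M = 2 ^+ k *: N.
Proof.
move=> h; exists (2 ^- k *: M); last by rewrite scalerA divff // scale1r.
by apply/mdv0E/(mdv_scale k); rewrite addn0 scalerA divff // scale1r.
Qed.

Lemma integral_mxD m n (M N : 'M[F]_(m, n)) :
  integral_mx A M -> integral_mx A N -> integral_mx A (M + N).
Proof. by move=> /mdv0E hM /mdv0E hN; apply/mdv0E/mdvD. Qed.

Lemma integral_mxB m n (M N : 'M[F]_(m, n)) :
  integral_mx A M -> integral_mx A N -> integral_mx A (M - N).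
Proof. by move=> /mdv0E hM /mdv0E hN; apply/mdv0E/mdvB. Qed.

Lemma integral_mxM m n p (M : 'M[F]_(m, n)) (N : 'M[F]_(n, p)) :
  integral_mx A M -> integral_mx A N -> integral_mx A (M *m N).
Proof. by move=> /mdv0E hM /mdv0E hN; apply/mdv0E; apply: (mdvM hM hN). Qed.

Lemma integral_mxZ m n x (M : 'M[F]_(m, n)) :
  A x -> integral_mx A M -> integral_mx A (x *: M).
Proof. by move=> Ax hM i j; rewrite mxE; apply: AM. Qed.

Lemma integral_tr m n (M : 'M[F]_(m, n)) : integral_mx A M -> integral_mx A M^T.
Proof. by move=> h i j; rewrite mxE; apply: h. Qed.

Lemma integral_0 m n : integral_mx A (0 : 'M[F]_(m, n)).
Proof. by apply/mdv0E/mdv_0. Qed.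

Lemma integral_1 n : integral_mx A (1%:M : 'M[F]_n).
Proof. by move=> i j; rewrite mxE; apply: dvr_nat. Qed.

Lemma integral_delta m n i j : integral_mx A (delta_mx i j : 'M[F]_(m, n)).
Proof. by move=> a b; rewrite mxE; apply: dvr_nat. Qed.

Lemma integral_det n (M : 'M[F]_n) : integral_mx A M -> A (\det M).
Proof.
move=> h; rewrite /determinant; apply: dvr_sum => s _; apply: AM.
  by apply: dvrX; apply: dvrN.
by apply: dvr_prod => i _.
Qed.

Lemma integral_invmx n (M : 'M[F]_n) :
  integral_mx A M -> A_unit A (\det M) -> integral_mx A (invmx M).
Proof.
move=> hM [d0 _ hd]; rewrite /invmx unitmxE unitfE d0 => i j.
rewrite !mxE; apply: AM => //; rewrite /cofactor; apply: AM.
  by apply: dvrX; apply: dvrN.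
by apply: integral_det => a b; rewrite !mxE.
Qed.

Lemma det_unit_unitmx n (M : 'M[F]_n) : A_unit A (\det M) -> M \in unitmx.
Proof. by case=> d0 _ _; rewrite unitmxE unitfE. Qed.

Lemma integral_mulmx1_det n (M N : 'M[F]_n) :
  integral_mx A M -> integral_mx A N -> M *m N = 1%:M -> A_unit A (\det M).
Proof.
move=> hM hN e; apply: (unit_mul_eq1 (v := \det N)); try exact: integral_det.
by rewrite -det_mulmx e det1.
Qed.

Lemma det_unit_mul n (M N : 'M[F]_n) :
  A_unit A (\det M) -> A_unit A (\det N) -> A_unit A (\det (M *m N)).
Proof. by rewrite det_mulmx; exact: unitM. Qed.

Lemma det_one_add2 n (M : 'M[F]_n) : integral_mx A M -> A_unit A (\det (1%:M + 2 *: M)).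
Proof.
move=> hM.
suff [a Aa ->] : exists2 a, A a & \det (1%:M + 2 *: M) = 1 + 2 * a.
  by apply: unitD; [exact: unit1 | rewrite -[2]expr1; exact: dv_mul].
elim: n M hM => [|n IH] M hM; first by exists 0; rewrite ?det_mx00 ?mulr0 ?addr0 //; exact: dvr0.
rewrite (expand_det_row _ ord0) big_ord_recl.
have [|a Aa ea] := IH (row' ord0 (col' ord0 M)); first by move=> i j; rewrite !mxE.
have -> : cofactor (1%:M + 2 *: M) ord0 ord0 = 1 + 2 * a.
  rewrite /cofactor addn0 expr0 mul1r -ea; congr (\det _).
  by apply/matrixP => i j; rewrite !mxE (inj_eq (lift_inj)).
pose c j := cofactor (1%:M + 2 *: M) ord0 j.
have hc j : A (c j).
  rewrite /c /cofactor; apply: AM; first by apply: dvrX; apply: dvrN.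
  apply: integral_det => i k; rewrite !mxE; apply: dvrD; first exact: dvr_nat.
  by apply: AM => //; apply: dvr_nat.
(* The first row contributes (1 + 2 M_00)(1 + 2a) from the diagonal, by induction, and 2 M_0j times
   an integral cofactor from each other entry; this is the half of the sum minus 1. *)
exists (a + M ord0 ord0 * (1 + 2 * a) + \sum_(j < n) M ord0 (lift ord0 j) * c (lift ord0 j)).
  apply: dvrD; last by apply: dvr_sum => j _; apply: AM.
  apply: dvrD => //; apply: AM => //; apply: dvrD => //; apply: AM => //; apply: dvr_nat.
rewrite !mulrDr mulr_sumr !mxE /= -!addrA.
have -> : \sum_(j < n) (1%:M + 2 *: M) ord0 (lift ord0 j) * c (lift ord0 j)
  = \sum_(j < n) 2 * (M ord0 (lift ord0 j) * c (lift ord0 j)).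
  by apply: eq_bigr => j _; rewrite !mxE mulr0n add0r mulrA.
ring.
Qed.

Lemma mx_complete m n (u : nat -> 'M[F]_(m, n)) :
  (forall k, mdv k (u k.+1 - u k)) -> exists l, forall k, mdv k (l - u k).
Proof.
move=> hu.
have /choice[l hl] : forall p : 'I_m * 'I_n, exists l, forall k, dv k (l - u k p.1 p.2).
  move=> p; apply: (dvr_complete hA) => k.
  by have := hu k p.1 p.2; rewrite !mxE.
by exists (\matrix_(i, j) l (i, j)) => k i j; rewrite !mxE; apply: (hl (i, j)).
Qed.

(** Non-expanding for the 2-adic metric, so that [x |-> h + 2 *: G x] is a contraction of the
    integral vectors. This is the form in which the implicit function theorem and Hensel's lemma are
    used. *)
Definition dv_lipschitz (m n : nat) (G : 'rV[F]_m -> 'rV[F]_n) : Prop :=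
  (forall x, integral_mx A x -> integral_mx A (G x)) /\
  (forall k x y, integral_mx A x -> integral_mx A y -> mdv k (x - y) ->
     mdv k (G x - G y)).

Lemma fixpoint_unique m (G : 'rV[F]_m -> 'rV[F]_m) h x y : dv_lipschitz G ->
  integral_mx A x -> integral_mx A y ->
  x = h + 2 *: G x -> y = h + 2 *: G y -> x = y.
Proof.
move=> [_ hG] Ax Ay ex ey; apply/eqP; rewrite -subr_eq0; apply/eqP/mdv_infty.
elim=> [|k IH]; first exact/mdv0E/integral_mxB.
rewrite ex ey opprD addrACA subrr add0r -scalerBr.
by rewrite -[k.+1]add1n -[2]expr1; apply/mdv_scale; apply: hG.
Qed.

Lemma fixpoint_exists m (G : 'rV[F]_m -> 'rV[F]_m) h : dv_lipschitz G ->
  integral_mx A h -> exists2 z, integral_mx A z & z = h + 2 *: G z.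
Proof.
move=> [iG hG] Ah; pose T z := h + 2 *: G z.
have iT z : integral_mx A z -> integral_mx A (T z).
  by move=> Az; apply: integral_mxD => //; apply: integral_mxZ; [apply: dvr_nat | apply: iG].
have hT k x y : integral_mx A x -> integral_mx A y -> mdv k (x - y) -> mdv k.+1 (T x - T y).
  move=> Ax Ay h1; rewrite /T opprD addrACA subrr add0r -scalerBr.
  by rewrite -[k.+1]add1n -[2]expr1; apply/mdv_scale; apply: hG.
pose u k := iter k T 0; have iu k : integral_mx A (u k).
  by elim: k => [|k IH]; [apply: integral_0 | apply: iT].
have [|l hl] := @mx_complete _ _ u.
  elim=> [|k IH]; first exact/mdv0E/integral_mxB.
  have uS i : u i.+1 = T (u i) by [].
  by rewrite (uS k.+1) [in X in _ - X]uS; apply: hT => //; apply: iu.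
have Al : integral_mx A l by rewrite -[l]subr0; apply/mdv0E; exact: (hl 0%N).
exists l => //; apply/eqP; rewrite -subr_eq0; apply/eqP/mdv_infty => k.
apply: (@mdv_le _ _ _ k.+1) => //.
have -> : l - (h + 2 *: G l) = (l - u k.+1) + (T (u k) - T l).
  by rewrite /u iterS -/(u k) addrA subrK.
apply: mdvD => //; apply: hT => //; rewrite -opprB; exact: mdvN.
Qed.

End Integral.

(** * The normalized absolute value and its topology *)

Section AbsoluteValue.
Variables (R : realType) (f : nat) (hf : (1 < f)%N).

Let f0 : (0 : R) < f%:R. Proof. by rewrite ltr0n ltnW. Qed.
Let f1 : (1 : R) < f%:R. Proof. by rewrite ltr1n. Qed.

Lemma ord2_unit x : x != 0 -> A_unit A (x * 2 ^ (- ord2 A x)).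
Proof.
move=> x0; rewrite /ord2; case: xgetP => [k -> //|h].
by have [k hk] := dvr_ord hA x0; case: (h k).
Qed.

Lemma ord2_dv x (k : nat) : x != 0 -> dv k x <-> (k%:Z <= ord2 A x)%R.
Proof.
move=> x0; have hu := ord2_unit x0; set o := ord2 A x in hu *.
have xE : x = (x * 2 ^ (- o)) * 2 ^ o by rewrite -mulrA -expfzDr // addNr expr0z mulr1.
split=> [h|ko].
  rewrite leNgt; apply/negP => ok; apply: (unit_ndv hu).
  have [j hj] : exists j : nat, (- o = j%:Z + 1 - k%:Z)%R.
    by exists `|(k%:Z - o - 1)%R|%N; lia.
  have [a Aa <-] := h; rewrite hj; apply/dvE; rewrite expr1.
  have -> : 2 ^+ k * a * 2 ^ (j%:Z + 1 - k%:Z) / 2 = 2 ^+ j * a.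
    rewrite !expfzDr // expr1z -exprnN -!exprnP; field; by rewrite twoX0 two0.
  by apply: AM => //; apply: dvrX; apply: dvr_nat.
have [j hj] : exists j : nat, (o = k%:Z + j%:Z)%R by exists `|(o - k%:Z)%R|%N; lia.
rewrite xE {2}hj expfzDr // -!exprnP mulrCA; apply: dvMr.
  by apply: AM; [case: hu | apply: dvrX; apply: dvr_nat].
exact: dv_pow2.
Qed.

Lemma ord2_unique x k : A_unit A (x * 2 ^ (- k)) -> ord2 A x = k.
Proof.
move=> hk; have x0 : x != 0 by case: hk; rewrite mulf_eq0 negb_or => /andP[].
have ho := ord2_unit x0; set o := ord2 A x in ho *.
have key a b : A_unit A (x * 2 ^ (- a)) -> A_unit A (x * 2 ^ (- b)) -> (b <= a)%R.
  move=> ha hb; rewrite leNgt; apply/negP => ab; apply: (unit_ndv ha).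
  have [j hj] : exists j : nat, (b = a + j.+1%:Z)%R by exists `|(b - a - 1)%R|%N; lia.
  have -> : x * 2 ^ (- a) = (x * 2 ^ (- b)) * 2 ^+ j.+1.
    by rewrite -mulrA exprnP -expfzDr // hj opprD addrNK.
  by apply: dvMl; [case: hb | apply: dv_pow2].
by apply/eqP; rewrite eq_le !key.
Qed.

Local Notation abs := (absF R A f).

Lemma absF0 : abs 0 = 0. Proof. by rewrite /absF eqxx. Qed.

Lemma absF_gt0 x : x != 0 -> 0 < abs x.
Proof. by move=> /negPf x0; rewrite /absF x0 exprz_gt0. Qed.

Lemma absF_ge0 x : 0 <= abs x.
Proof. by have [->|/absF_gt0/ltW //] := eqVneq x 0; rewrite absF0. Qed.

Lemma absFM x y : abs (x * y) = abs x * abs y.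
Proof.
have [->|x0] := eqVneq x 0; first by rewrite mul0r absF0 mul0r.
have [->|y0] := eqVneq y 0; first by rewrite mulr0 absF0 mulr0.
rewrite /absF mulf_eq0 (negPf x0) (negPf y0) /= -expfzDr ?lt0r_neq0 // -opprD.
congr (_ ^ (- _)); apply: ord2_unique.
have -> : x * y * 2 ^ (- (ord2 A x + ord2 A y)) =
  (x * 2 ^ (- ord2 A x)) * (y * 2 ^ (- ord2 A y)) by rewrite opprD expfzDr //; ring.
by apply: unitM; exact: ord2_unit.
Qed.

Lemma absF_unit u : A_unit A u -> abs u = 1.
Proof.
move=> hu; have [/negPf u0 _ _] := hu; rewrite /absF u0.
by rewrite (@ord2_unique u 0) ?oppr0 ?expr0z ?mulr1.
Qed.

Lemma absF_pow2 (k : int) : abs (2 ^ k) = f%:R ^ (- k).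
Proof.
rewrite /absF (negPf (expfz_neq0 _ two0)) (@ord2_unique _ k) //.
by rewrite -expfzDr // subrr expr0z; exact: unit1.
Qed.

Lemma absF_dv k x : (abs x <= f%:R ^- k) <-> dv k x.
Proof.
have [->|x0] := eqVneq x 0.
  by rewrite absF0 invr_ge0 exprn_ge0 ?ltW //; split=> // _; exact: dv_0.
rewrite ord2_dv // /absF (negPf x0) exprnN ler_eXz2l // lerN2.
by split.
Qed.

Lemma mxabs_le m n (M : 'M[F]_(m, n)) c : 0 <= c ->
  (mxabs R A f M <= c) <-> (forall i j, abs (M i j) <= c).
Proof.
move=> c0; split.
  move=> h i j; apply: le_trans h; rewrite /mxabs.
  by rewrite (bigD1 (i, j)) //= le_max lexx.
move=> h; rewrite /mxabs; elim/big_ind: _ => // x y hx hy.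
by rewrite ge_max hx hy.
Qed.

Lemma mxabs_dv m n k (M : 'M[F]_(m, n)) : (mxabs R A f M <= f%:R ^- k) <-> mdv k M.
Proof.
rewrite mxabs_le ?invr_ge0 ?exprn_ge0 ?(ltW f0) //.
by split=> h i j; apply/absF_dv.
Qed.

Lemma mxabs0 m n : mxabs R A f (0 : 'M[F]_(m, n)) = 0.
Proof.
apply/eqP; rewrite eq_le; apply/andP; split.
  by apply/mxabs_le => // i j; rewrite mxE absF0.
rewrite /mxabs; elim/big_ind: _ => // [x y hx hy|p _]; last exact: absF_ge0.
by rewrite le_max hx.
Qed.

Lemma inv_f_small (eps : R) : 0 < eps -> exists k : nat, f%:R ^- k < eps.
Proof.
move=> /(@two_power_small R)[k hk]; exists k; apply: le_lt_trans hk.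
rewrite lef_pV2 ?posrE ?exprn_gt0 // -!natrX ler_nat.
by elim: k => // k IH; rewrite !expnS leq_mul.
Qed.

Lemma mxabs_attained m n (M : 'M[F]_(m, n)) : integral_mx A M -> M != 0 ->
  exists2 j : nat, mdv j M & f%:R ^- j <= mxabs R A f M.
Proof.
move=> iM M0.
have [j hj nj] : exists2 j, mdv j M & ~ mdv j.+1 M.
  apply: contrapT => H; case/eqP: M0; apply: mdv_infty; elim=> [|j IH]; first exact/mdv0E.
  by apply: contrapT => nj; apply: H; exists j.
exists j => //; rewrite leNgt; apply/negP => lt; apply: nj => a b.
have [M0'|Mab] := eqVneq (M a b) 0; first by rewrite M0'; exact: dv_0.
apply/ord2_dv => //.
have : abs (M a b) < f%:R ^- j.
  apply: le_lt_trans lt.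
  have c0 : 0 <= mxabs R A f M.
    rewrite /mxabs; elim/big_ind: _ => // [x y hx hy|p _]; last exact: absF_ge0.
    by rewrite le_max hx.
  by have [h _] := mxabs_le M c0; apply: h.
rewrite /absF (negPf Mab) exprnN ltr_eXz2l // ltrN2.
by move: (ord2 A (M a b)) => o ?; lia.
Qed.

(** The hypothesis is applied at the exact valuation j of y - z, where f^-j is bounded by the norm
    of y - z, with e such that f^-e < eps. For y = z no such j exists, but then every j is
    admissible and the difference vanishes. *)
Lemma strict_derivative_dv d n (g : 'rV[F]_d -> 'M[F]_n) x J :
  (forall e : nat, exists k : nat, forall y z, mdv k (y - x) -> mdv k (z - x) ->
     forall j, mdv j (y - z) -> mdv (j + e) (g y - g z - vec_mx ((y - z) *m J))) ->
  strict_derivative R A f g x J.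
Proof.
move=> H eps /inv_f_small[e he]; have [k hk] := H e.
exists (f%:R ^- k); first by rewrite invr_gt0 exprn_gt0.
move=> y z /ltW/mxabs_dv hy /ltW/mxabs_dv hz.
have [yz|yz] := eqVneq (y - z) 0.
  have -> : g y - g z - vec_mx ((y - z) *m J) = 0.
    apply: mdv_infty => j; apply: (mdv_le (leq_addr e j)); apply: (hk _ _ hy hz).
    by rewrite yz; exact: mdv_0.
  by rewrite yz !mxabs0 mulr0.
have iyz : integral_mx A (y - z).
  have -> : y - z = (y - x) - (z - x) by rewrite opprB addrA subrK.
  by apply: (@mdv_int _ _ k); apply: mdvB.
have [j hj lj] := mxabs_attained iyz yz.
have /mxabs_dv h := hk _ _ hy hz _ hj; apply: le_trans h _.
rewrite exprD invfM mulrC; apply: ler_pM => //; rewrite ?invr_ge0 ?exprn_ge0 ?(ltW f0) //.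
exact: ltW.
Qed.

Lemma mxopen_dv m n (U : set (mxspace F m n)) :
  (forall x : 'M[F]_(m, n), U x ->
     exists k : nat, forall y : 'M[F]_(m, n), mdv k (y - x) -> U y) -> mxopen R A f U.
Proof.
move=> H x /H[k hk]; exists (f%:R ^- k); first by rewrite invr_gt0 exprn_gt0.
by move=> y /ltW/mxabs_dv; apply: hk.
Qed.

End AbsoluteValue.
End CompleteDvr.

(** * Parametrization of the cosets in the automorphism group *)

Section SymmetricCoordinates.
Variables (F : fieldType) (n : nat).

Lemma symcoord_inj (Y : 'M[F]_n) : Y^T = Y -> symcoord Y = 0 -> Y = 0.
Proof.
move=> sY Y0; have h (i j : 'I_n) : (i <= j)%N -> Y i j = 0.
  move=> ij; have pu : (i, j) \in upper n by rewrite inE.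
  have := congr1 (fun v : 'rV_#|upper n| => v 0 (enum_rank_in pu (i, j))) Y0.
  by rewrite !mxE enum_rankK_in.
apply/matrixP => i j; rewrite mxE; case: (leqP i j) => [/h //|/ltnW /h].
by rewrite -{1}sY mxE.
Qed.

Lemma symcoordD (Y Z : 'M[F]_n) : symcoord (Y + Z) = symcoord Y + symcoord Z.
Proof. by apply/rowP => k; rewrite !mxE. Qed.

Lemma symcoordZ a (Y : 'M[F]_n) : symcoord (a *: Y) = a *: symcoord Y.
Proof. by apply/rowP => k; rewrite !mxE. Qed.

End SymmetricCoordinates.

Lemma trmxD (V : zmodType) m n (M N : 'M[V]_(m, n)) : (M + N)^T = M^T + N^T.
Proof. by apply/matrixP => i j; rewrite !mxE. Qed.

Lemma trmxZ (V : pzRingType) m n a (M : 'M[V]_(m, n)) : (a *: M)^T = a *: M^T.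
Proof. by apply/matrixP => i j; rewrite !mxE. Qed.

Section OrthogonalLattice.
Variables (F : fieldType) (A : set F) (hA : complete_dvr A) (n : nat) (S : 'M[F]_n).
Hypotheses (hSu : S \in unitmx).

Lemma OV_det m : OV S m -> \det m ^+ 2 = 1.
Proof.
move=> /(congr1 determinant); rewrite /rho !det_mulmx det_tr mulrAC -expr2 => e.
have dS : \det S != 0 by rewrite -unitfE -unitmxE.
by apply: (mulIf dS); rewrite mul1r.
Qed.

Lemma OV_unitmx m : OV S m -> m \in unitmx.
Proof.
move/OV_det => e; rewrite unitmxE unitfE; apply: contra_eq_neq e => ->.
by rewrite expr0n /= eq_sym oner_neq0.
Qed.

Lemma OV_det_unit m : OV S m -> A_unit A (\det m).
Proof.
move=> /OV_det/eqP; rewrite sqrf_eq1 => /orP[] /eqP ->; first exact: unit1.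
by apply: unitN => //; exact: unit1.
Qed.

Lemma OV_mul m m' : OV S m -> OV S m' -> OV S (m *m m').
Proof.
by rewrite /OV /rho /= => e e'; rewrite trmx_mul -!mulmxA (mulmxA S) (mulmxA m^T) (mulmxA m^T) e mulmxA.
Qed.

Lemma OV_inv m : OV S m -> OV S (invmx m).
Proof.
move=> h; have um := OV_unitmx h; move: h; rewrite /OV /rho /= => e.
rewrite -{1}e !mulmxA -trmx_mul mulmxV // trmx1 mul1mx.
by rewrite -mulmxA mulmxV // mulmx1.
Qed.

(** Integrality of m is enough for m L = L, because the determinant is 1 or -1 and so the inverse is
    integral too. *)
Lemma Aut_LP m : Aut_L A S m <-> OV S m /\ integral_mx A m.
Proof.
split=> [[hO hL]|[hO im]].
  split=> // i j.
  have : (lattice_L A (n := n)) (m *m delta_mx j 0).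
    by rewrite -hL; exists (delta_mx j 0) => //; exact: integral_delta.
  by move/(_ i 0); rewrite -colE mxE.
split=> //; apply/seteqP; split=> [_ [x hx <-]|x hx]; first exact: integral_mxM.
have um := OV_unitmx hO.
exists (invmx m *m x); last by rewrite mulmxA mulmxV // mul1mx.
by apply: integral_mxM => //; exact: (integral_invmx hA im (OV_det_unit hO)).
Qed.

Lemma Aut_L_inv m : Aut_L A S m -> Aut_L A S (invmx m).
Proof.
move/Aut_LP => [hO im]; apply/Aut_LP; split; first exact: OV_inv.
by exact: (integral_invmx hA im (OV_det_unit hO)).
Qed.

End OrthogonalLattice.

(* The tangent lattice of M at 1 is spanned by the rows of [Bas], the last
   rows of which are mapped by the differential [dr] of rho at 1 onto a basis
   of the lattice of the forms on which [Qc] is integral, while the first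
   ones span the kernel of [dr]. *)
Record tangent_basis (F : fieldType) (A : set F) (n : nat) (S : 'M[F]_n)
    (Bas : 'M[F]_('C(n, 2) + #|upper n|, n * n))
    (Bas' : 'M[F]_(n * n, 'C(n, 2) + #|upper n|)) (HB HB' : 'M[F]_#|upper n|) : Prop := {
  tb_sym : S^T = S;
  tb_unit : S \in unitmx;
  tb_inv : Bas *m Bas' = 1%:M;
  tb_inv' : Bas' *m Bas = 1%:M;
  tb_int : integral_mx A Bas;
  tb_Hinv : HB *m HB' = 1%:M;
  tb_dr : forall c, let X := vec_mx (c *m Bas) in
    symcoord (X^T *m S + S *m X) *m HB' = rsubmx c;
  tb_quad : forall c, integral_mx A c -> let X := vec_mx (c *m Bas) in
    integral_mx A (symcoord (X^T *m S *m X) *m HB');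
  tb_mul : forall c c', integral_mx A c -> integral_mx A c' ->
    integral_mx A (mxvec (vec_mx (c *m Bas) *m vec_mx (c' *m Bas)) *m Bas');
  tb_aut : forall g, Aut_L A S g -> integral_mx A (mxvec (g - 1%:M) *m Bas') }.

Section Parametrization.
Variables (F : fieldType) (A : set F) (hA : complete_dvr A) (n : nat) (S : 'M[F]_n).
Local Notation d := 'C(n, 2).
Local Notation u := #|upper n|.
Variables (Bas : 'M[F]_(d + u, n * n)) (Bas' : 'M[F]_(n * n, d + u)) (HB HB' : 'M[F]_u).
Hypothesis tb : tangent_basis A S Bas Bas' HB HB'.
Local Notation mdv := (mdv A).
Local Notation int := (integral_mx A).

Let hSt := tb_sym tb.
Let hSu := tb_unit tb.

(** [tX] and [co] pass between the coordinates c and the matrix X, and [Qc] reads a symmetric matrix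
    in the target lattice. In these coordinates rho(1 + X) - S has the linear part [rsubmx c] and
    the quadratic part [qX c], with polar form [pX]. *)
Definition tX (c : 'rV[F]_(d + u)) : 'M[F]_n := vec_mx (c *m Bas).
Definition co (M : 'M[F]_n) : 'rV[F]_(d + u) := mxvec M *m Bas'.
Definition Qc (Y : 'M[F]_n) : 'rV[F]_u := symcoord Y *m HB'.
Definition dr (Y : 'M[F]_n) : 'M[F]_n := Y^T *m S + S *m Y.
Definition qX (c : 'rV[F]_(d + u)) : 'rV[F]_u := Qc ((tX c)^T *m S *m tX c).
Definition pX (c c' : 'rV[F]_(d + u)) : 'rV[F]_u :=
  Qc ((tX c)^T *m S *m tX c' + (tX c')^T *m S *m tX c).

Lemma tXK c : co (tX c) = c.
Proof. by rewrite /co /tX vec_mxK -mulmxA (tb_inv tb) mulmx1. Qed.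

Lemma coK M : tX (co M) = M.
Proof. by rewrite /co /tX -mulmxA (tb_inv' tb) mulmx1 mxvecK. Qed.

Lemma tXD c c' : tX (c + c') = tX c + tX c'.
Proof. by rewrite /tX mulmxDl linearD. Qed.

Lemma tXZ a c : tX (a *: c) = a *: tX c.
Proof. by rewrite /tX -scalemxAl linearZ. Qed.

Lemma tXB c c' : tX (c - c') = tX c - tX c'.
Proof. by rewrite tXD -scaleN1r tXZ scaleN1r. Qed.

Lemma coD M N : co (M + N) = co M + co N.
Proof. by rewrite /co linearD mulmxDl. Qed.

Lemma coZ a M : co (a *: M) = a *: co M.
Proof. by rewrite /co linearZ scalemxAl. Qed.

Lemma tX_int c : int c -> int (tX c).
Proof.
move=> hc i j; rewrite mxE; apply: integral_mxM => //; exact: tb_int tb.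
Qed.

Lemma QcD Y Z : Qc (Y + Z) = Qc Y + Qc Z.
Proof. by rewrite /Qc symcoordD mulmxDl. Qed.

Lemma QcZ a Y : Qc (a *: Y) = a *: Qc Y.
Proof. by rewrite /Qc symcoordZ scalemxAl. Qed.

Lemma Qc_inj Y : Y^T = Y -> Qc Y = 0 -> Y = 0.
Proof.
move=> sY /(congr1 (mulmx^~ HB)); rewrite /Qc -mulmxA mul0mx.
by rewrite (mulmx1C (tb_Hinv tb)) mulmx1; apply: symcoord_inj.
Qed.

Lemma Qc_dr c : Qc (dr (tX c)) = rsubmx c.
Proof. exact: tb_dr tb c. Qed.

Lemma qX_int c : int c -> int (qX c).
Proof. exact: tb_quad tb c. Qed.

Lemma qXD c e : qX (c + e) = qX c + pX e c + qX e.
Proof.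
rewrite /qX /pX !tXD -!QcD; congr Qc.
rewrite trmxD !mulmxDl !mulmxDr.
by apply/matrixP => i j; rewrite !mxE; ring.
Qed.

Lemma qXZ a c : qX (a *: c) = a ^+ 2 *: qX c.
Proof.
by rewrite /qX tXZ trmxZ -!scalemxAl -scalemxAr scalerA -expr2 QcZ.
Qed.

Lemma pX_sym c e : pX c e = pX e c.
Proof. by rewrite /pX addrC. Qed.

Lemma pXDl c e g : pX (c + e) g = pX c g + pX e g.
Proof.
rewrite /pX -QcD; congr Qc; rewrite tXD trmxD !mulmxDl !mulmxDr.
by apply/matrixP => i j; rewrite !mxE; ring.
Qed.

Lemma pXZl a c e : pX (a *: c) e = a *: pX c e.
Proof.
rewrite /pX -QcZ; congr Qc; rewrite tXZ trmxZ -!scalemxAl -scalemxAr.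
by rewrite scalerDr.
Qed.

Lemma pXBr c e g : pX c (e - g) = pX c e - pX c g.
Proof. by rewrite pX_sym pXDl -scaleN1r pXZl scaleN1r !(pX_sym _ c). Qed.

Lemma pX_int c e : int c -> int e -> int (pX e c).
Proof.
move=> hc he; have -> : pX e c = qX (c + e) - qX c - qX e.
  by rewrite qXD; apply/matrixP => i j; rewrite !mxE; ring.
have hce : int (c + e) by apply: integral_mxD.
by apply: (integral_mxB hA); first apply: (integral_mxB hA); apply: qX_int.
Qed.

Lemma pX_dv j k c e : mdv j c -> mdv k e -> mdv (j + k) (pX c e).
Proof.
move=> /(mdvP hA)[c' hc' ->] /(mdvP hA)[e' he' ->].
rewrite pXZl pX_sym pXZl pX_sym scalerA -exprD.
by apply: (mdv_mul hA); apply: pX_int.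
Qed.

Lemma qX_dv j c : mdv j c -> mdv (j + j) (qX c).
Proof.
move=> /(mdvP hA)[c' hc' ->]; rewrite qXZ -exprM muln2 -addnn.
by apply: (mdv_mul hA); apply: qX_int.
Qed.

Lemma qX_lip k c c' : int c -> int c' -> mdv k (c - c') -> mdv k (qX c - qX c').
Proof.
move=> hc hc' h; have -> : qX c = qX c' + pX (c - c') c' + qX (c - c') by rewrite -qXD addrC subrK.
rewrite -[qX c' + _ + _]addrA addrAC subrr add0r; apply: mdvD => //.
  by rewrite -[k]addn0; apply: pX_dv => //; apply/(mdv0E hA).
by apply: (mdv_le hA (leq_addr k k)); apply: qX_dv.
Qed.

(** The derivative of [qX] at [c0], as a matrix acting on rows. *)
Definition pD (c0 : 'rV[F]_(d + u)) : 'M[F]_(d + u, u) := \matrix_i pX (delta_mx 0 i) c0.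

Lemma pDE c c0 : c *m pD c0 = pX c c0.
Proof.
rewrite mulmx_sum_row [in RHS](row_sum_delta c).
under eq_bigr do rewrite rowK -pXZl.
elim/big_rec2: _ => [|i y1 y2 _ ->]; last by rewrite pXDl.
by rewrite -[0 in RHS](scale0r 0) pXZl scale0r.
Qed.

Lemma pD_int c0 : int c0 -> int (pD c0).
Proof. by move=> hc i j; rewrite mxE; apply: pX_int => //; exact: integral_delta. Qed.

(** The partial derivative of the equation z + 2 qX(l, z) = 0 in the direction z; it is invertible
    over A because it is 1 modulo 2. *)
Definition Wz (c0 : 'rV[F]_(d + u)) : 'M[F]_u := 1%:M + 2 *: dsubmx (pD c0).

Lemma Wz_det c0 : int c0 -> A_unit A (\det (Wz c0)).
Proof. by move=> hc; apply: det_one_add2 => // i j; rewrite mxE; apply: pD_int. Qed.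

Lemma Wz_unit c0 : int c0 -> Wz c0 \in unitmx.
Proof. by move/Wz_det; exact: det_unit_unitmx. Qed.

(** The derivative of the implicit function z(l), obtained by implicit differentiation of z + 2
    qX(l, z) = 0. *)
Definition Kz (c0 : 'rV[F]_(d + u)) : 'M[F]_(d, u) :=
  - (2 *: usubmx (pD c0) *m invmx (Wz c0)).

Lemma KzE c0 : int c0 -> Kz c0 *m Wz c0 = - (2 *: usubmx (pD c0)).
Proof. by move=> hc; rewrite mulNmx -mulmxA mulVmx ?Wz_unit // mulmx1. Qed.

Lemma Qc_drho c X0 : let g := 1%:M + 2 *: tX X0 in
  Qc (drho S g (tX c)) = rsubmx c + 2 *: (c *m pD X0).
Proof.
rewrite /= pDE -Qc_dr /pX -QcZ -QcD; congr Qc; rewrite /drho /dr.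
rewrite trmxD trmxZ trmx1 !mulmxDr !mulmxDl mulmx1 mul1mx.
by rewrite -!scalemxAl -!scalemxAr; apply/matrixP => i j; rewrite !mxE; ring.
Qed.

Lemma rho_one_add X : rho S (1%:M + 2 *: X) = S + 2 *: (dr X + 2 *: (X^T *m S *m X)).
Proof.
rewrite /rho /dr trmxD trmxZ trmx1 !mulmxDr !mulmxDl !mulmx1 !mul1mx.
rewrite -!scalemxAl -!scalemxAr -?scalemxAl ?scalerA.
by apply/matrixP => i j; rewrite !mxE; ring.
Qed.

(** rho(1 + 2X) - S is divisible by 2, and the quotient has the coordinates z + 2 qX(c). The
    remaining factor 2 makes the equation solvable for z; this is why the cosets of 1 + 2M' are the
    ones to parametrize. *)
Lemma OV_one_add c : OV S (1%:M + 2 *: tX c) <-> rsubmx c = - (2 *: qX c).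
Proof.
have two0 := dvr_two_neq0 hA.
set Y := dr (tX c) + 2 *: ((tX c)^T *m S *m tX c).
have sY : Y^T = Y.
  rewrite /Y /dr !trmxD trmxZ !trmx_mul !trmxK hSt [_ + S *m _]addrC.
  by rewrite mulmxA.
have QY : Qc Y = rsubmx c + 2 *: qX c by rewrite QcD QcZ Qc_dr.
split=> [|h].
  rewrite /OV /= rho_one_add -/Y -[X in _ = X]addr0 => /addrI/(congr1 (fun M => 2^-1 *: M)).
  rewrite scalerA mulVf // scale1r scaler0 => Y0; apply/eqP; rewrite -addr_eq0 -QY Y0.
  by rewrite /Qc -[0](scale0r 0) symcoordZ scale0r mul0mx.
rewrite /OV /= rho_one_add -/Y (_ : Y = 0) ?scaler0 ?addr0 //.
by apply: Qc_inj; rewrite ?QY ?h ?addNr.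
Qed.

Lemma zf_lip l : int l -> dv_lipschitz A (fun z : 'rV[F]_u => - qX (row_mx l z)).
Proof.
have irow z : int l -> int z -> int (row_mx l z).
  by move=> hl hz i j; rewrite mxE; case: fintype.split.
move=> hl; split=> [x hx|k x y hx hy hxy].
  by apply/(mdv0E hA)/(mdvN hA)/(mdv0E hA)/qX_int/irow.
rewrite -opprD; apply: mdvN => //; apply: qX_lip; try exact: irow.
rewrite opp_row_mx add_row_mx subrr => i j; rewrite mxE; case: fintype.split => a //.
by rewrite mxE; exact: dv_0.
Qed.

Lemma row_mx_int p q' (l : 'rV[F]_p) (z : 'rV[F]_q') : int l -> int z -> int (row_mx l z).
Proof. by move=> hl hz i j; rewrite mxE; case: fintype.split. Qed.

(** The implicit function z(l). The default 0 of [xget] is not reached for integral l, where a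
    solution exists by contraction. *)
Definition zf (l : 'rV[F]_d) : 'rV[F]_u :=
  xget 0 [set z | int z /\ z = 2 *: - qX (row_mx l z)].

Lemma zfP l : int l -> int (zf l) /\ zf l = 2 *: - qX (row_mx l (zf l)).
Proof.
move=> hl; rewrite /zf; case: xgetP => [z -> //|h].
have [z hz ez] := fixpoint_exists hA (zf_lip hl) (@integral_0 _ _ hA 1 u).
by case: (h z); split=> //; rewrite {1}ez add0r.
Qed.

Lemma zf_unique l z : int l -> int z -> z = 2 *: - qX (row_mx l z) -> z = zf l.
Proof.
move=> hl hz ez; have [hz' ez'] := zfP hl.
by apply: (fixpoint_unique hA (zf_lip hl) (h := 0)); rewrite ?add0r.
Qed.

Definition cf (l : 'rV[F]_d) : 'rV[F]_(d + u) := row_mx l (zf l).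

Lemma cf_int l : int l -> int (cf l).
Proof. by move=> hl; apply: row_mx_int => //; case: (zfP hl). Qed.

Lemma cf_lip j l l' : int l -> int l' -> mdv j (l - l') -> mdv j (cf l - cf l').
Proof.
move=> hl hl' h.
suff H i : (i <= j)%N -> mdv i (cf l - cf l') by exact: H.
elim: i => [_|i IH ij].
  apply/(mdv0E hA); exact: (integral_mxB hA (cf_int hl) (cf_int hl')).
have := qX_lip (cf_int hl) (cf_int hl') (IH (ltnW ij)) => hq.
rewrite /cf opp_row_mx add_row_mx => a b; rewrite mxE; case: fintype.split => c.
  exact: (mdv_le hA ij h).
have [_ ->] := zfP hl; have [_ ->] := zfP hl'.
rewrite -/(cf l) -/(cf l') -scalerBr opprK addrC -opprB.
by apply: (mdv_double hA); apply: mdvN => //; rewrite opprB.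
Qed.

(** An exact Taylor formula around [cf z]: [qX] is quadratic, so its first and second order terms
    account for the whole difference. *)
Lemma zfB y z : int y -> int z ->
  zf y - zf z = - (2 *: (pX (cf y - cf z) (cf z) + qX (cf y - cf z))).
Proof.
move=> iy iz.
have ey : zf y = 2 *: - qX (cf y) := proj2 (zfP iy).
have ez : zf z = 2 *: - qX (cf z) := proj2 (zfP iz).
apply: (eq_trans (f_equal2 (fun a b => a - b) ey ez)).
have e c c' : qX c = qX c' + pX (c - c') c' + qX (c - c') by rewrite -qXD addrC subrK.
have aux (a a' b c : 'rV[F]_u) : a = a' + b + c ->
    2 *: - a - 2 *: - a' = - (2 *: (b + c)).
  by move=> ->; apply/rowP => i; rewrite !mxE; ring.
exact: aux (e _ _).
Qed.

(** * The coset of one automorphism *)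

Section Coset.
Variables (g0 : 'M[F]_n) (hg0 : Aut_L A S g0).

Let ig0 : int g0. Proof. by case/(Aut_LP hA hSu): hg0. Qed.
Let Og0 : OV S g0. Proof. by case: hg0. Qed.
Let ug0 : g0 \in unitmx. Proof. exact: OV_unitmx Og0. Qed.

Definition aut_coset : set 'M[F]_n := [set g | Aut_L A S g /\ mdv 1 (co (g - g0))].

Definition psi (l : 'rV[F]_d) : 'M[F]_n := g0 *m (1%:M + 2 *: tX (cf l)).

Lemma psi_OV l : int l -> OV S (psi l).
Proof.
move=> hl; apply: OV_mul => //; apply/OV_one_add; rewrite row_mxKr.
by have [_ {1}->] := zfP hl; rewrite scalerN.
Qed.

(** g X = X + (g - 1) X, where g - 1 lies in M' and M' is closed under products. Thus g M' = M', and
    the condition g - g0 in 2M' describes g0 (1 + 2M'). *)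
Lemma co_mul_int g c : Aut_L A S g -> int c -> int (co (g *m tX c)).
Proof.
move=> hg hc; have -> : g *m tX c = tX c + tX (co (g - 1%:M)) *m tX c.
  by rewrite coK mulmxBl mul1mx addrC subrK.
rewrite coD tXK; apply: integral_mxD => //.
by apply: (tb_mul tb) => //; apply: tb_aut tb _ hg.
Qed.

Lemma psi_image : [set psi l | l in integral_mx A (n := d)] = aut_coset.
Proof.
apply/seteqP; split=> [_ [l hl <-]|g [hg h1]].
  have hc := cf_int hl; split.
    apply/(Aut_LP hA hSu); split; first exact: psi_OV.
    apply: integral_mxM => //; apply: integral_mxD => //; first exact: integral_1.
    by apply: integral_mxZ => //; [apply: dvr_nat | apply: tX_int].
  have -> : psi l - g0 = 2 *: (g0 *m tX (cf l)).
    by rewrite /psi mulmxDr mulmx1 -scalemxAr addrAC subrr add0r.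
  rewrite coZ; apply: (mdv_double hA); apply/(mdv0E hA).
  exact: co_mul_int.
have [c hc ec] := mdvP hA h1.
(* Here g = g0 (1 + 2Y) with Y in M'; orthogonality of 1 + 2Y forces its last coordinates to be the
   implicit function of the first ones. *)
pose Y := invmx g0 *m tX c; pose c2 := co Y.
have hc2 : int c2 by apply: co_mul_int => //; apply: Aut_L_inv.
have eg : g = g0 *m (1%:M + 2 *: tX c2).
  rewrite coK mulmxDr mulmx1 -scalemxAr mulmxA mulmxV // mul1mx -tXZ.
  by rewrite -[2]expr1 -ec coK addrC subrK.
have [Og _] := hg.
have : OV S (1%:M + 2 *: tX c2).
  have -> : 1%:M + 2 *: tX c2 = invmx g0 *m g by rewrite eg mulmxA mulVmx // mul1mx.
  by apply: OV_mul => //; apply: OV_inv.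
move/OV_one_add => e.
have hl : int (lsubmx c2) by move=> i j; rewrite mxE.
exists (lsubmx c2) => //; rewrite /psi /cf.
suff -> : zf (lsubmx c2) = rsubmx c2 by rewrite hsubmxK.
symmetry; apply: zf_unique => //; first by move=> i j; rewrite mxE.
by rewrite hsubmxK scalerN.
Qed.

Definition Jpsi (l : 'rV[F]_d) : 'M[F]_(d, n * n) :=
  row_mx 1%:M (Kz (cf l)) *m Bas *m lin_mx (mulmx (2 *: g0)).

Lemma JpsiE l v : vec_mx (v *m Jpsi l) = 2 *: (g0 *m tX (row_mx v (v *m Kz (cf l)))).
Proof.
rewrite /Jpsi !mulmxA -[X in X *m lin_mx _]vec_mxK mul_vec_lin mxvecK.
by rewrite /= -/(tX _) -scalemxAl mul_mx_row mulmx1.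
Qed.

Lemma psiB y z : psi y - psi z = 2 *: (g0 *m tX (cf y - cf z)).
Proof.
rewrite /psi -mulmxBr scalemxAr; congr (_ *m _).
by rewrite tXB scalerBr opprD addrACA subrr add0r.
Qed.

Lemma psi_inj l l' : psi l = psi l' -> l = l'.
Proof.
have two0 := dvr_two_neq0 hA.
move/eqP; rewrite -subr_eq0 psiB scaler_eq0 (negPf two0) /=.
move=> /eqP/(congr1 (mulmx (invmx g0))); rewrite (mulKmx ug0) mulmx0 => /(congr1 co).
rewrite tXK /co linear0 mul0mx => /eqP; rewrite subr_eq0 => /eqP.
by case/eq_row_mx.
Qed.

(** The increment of the kernel coordinates is reproduced exactly by the differential, so the error
    sits in E = dz - dl Kz. Multiplied by the unimodular matrix [Wz], it becomes -2 times a polar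
    term and a second order term, both divisible by 2^(j + e). *)
Lemma psi_deriv l e : int l -> exists k : nat, forall y z, mdv k (y - l) -> mdv k (z - l) ->
  forall j, mdv j (y - z) -> mdv (j + e) (psi y - psi z - vec_mx ((y - z) *m Jpsi l)).
Proof.
move=> hl; exists e => y z hy hz j hj.
have near_int w : mdv e (w - l) -> int w.
  by move=> h; rewrite -[w](subrK l); apply: integral_mxD => //; apply: mdv_int h.
have iy := near_int _ hy; have iz := near_int _ hz.
set c0 := cf l; set dc := cf y - cf z; set dl := y - z; set dz := zf y - zf z.
have hc0 : int c0 by exact: cf_int.
have edc : dc = row_mx dl dz by rewrite /dc /cf opp_row_mx add_row_mx.
set E := dz - dl *m Kz c0.
have -> : psi y - psi z - vec_mx (dl *m Jpsi l) = 2 *: (g0 *m tX (row_mx 0 E)).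
  rewrite JpsiE -/c0 psiB -scalerBr -mulmxBr -tXB -/dc.
  by rewrite edc opp_row_mx add_row_mx subrr.
suff hE : mdv (j + e) E.
  apply: (@mdv_le _ _ hA _ _ _ (j + e).+1) => //; apply: (mdv_double hA).
  have : mdv (j + e) (row_mx (0 : 'rV_d) E).
    by move=> a b; rewrite mxE; case: fintype.split => // i; rewrite mxE; exact: dv_0.
  move=> /(mdvP hA)[w hw ->]; rewrite tXZ -scalemxAr.
  by apply: (mdv_mul hA); apply: integral_mxM => //; apply: tX_int.
have hdc i : mdv i dl -> mdv i dc by apply: cf_lip.
have hde : mdv e dl.
  have -> : dl = (y - l) - (z - l) by rewrite opprB addrA subrK.
  exact: mdvB.
(* The increment is divisible by 2^j and, both points being near l, by 2^e; its quadratic value is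
   thus divisible by 2^(2 max(j, e)). *)
have hq : mdv (j + e) (qX dc).
  have [ej|je] := leqP e j.
    by apply: (@mdv_le _ _ hA _ _ _ (j + j)); rewrite ?leq_add2l //; apply: qX_dv; apply: hdc.
  apply: (@mdv_le _ _ hA _ _ _ (e + e)); first by rewrite leq_add2r ltnW.
  by apply: qX_dv; apply: hdc.
have hp : mdv (j + e) (pX dc (cf z - c0)).
  by apply: pX_dv; [apply: hdc | apply: cf_lip].
have eE : E *m Wz c0 = - (2 *: (pX dc (cf z - c0) + qX dc)).
  have edz : dz = - (2 *: (dc *m pD c0 + (pX dc (cf z - c0) + qX dc))).
    by rewrite pDE pXBr addrA [pX dc c0 + _]addrC subrK /dz; exact: zfB.
  have es : dc *m pD c0 = dl *m usubmx (pD c0) + dz *m dsubmx (pD c0).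
    by rewrite edc -{1}[pD c0]vsubmxK mul_row_col.
  rewrite mulmxBl -mulmxA KzE // mulmxN opprK {1}/Wz mulmxDr mulmx1 -!scalemxAr.
  rewrite {1}edz es; apply/matrixP => a b; rewrite !mxE; ring.
have -> : E = (E *m Wz c0) *m invmx (Wz c0) by rewrite mulmxK ?Wz_unit.
rewrite -[(j + e)%N]addn0; apply: mdvM => //; last first.
  apply/(mdv0E hA); apply: integral_invmx => //; last exact: Wz_det.
  apply: integral_mxD => //; first exact: integral_1.
  apply: integral_mxZ => //; first exact: dvr_nat.
  by move=> a b; rewrite mxE; apply: pD_int.
rewrite eE; apply: mdvN => //; rewrite -[(j + e)%N]add0n; apply: mdvZ => //.
  by apply/dv0E => //; apply: dvr_nat.
exact: mdvD.
Qed.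

(** Since g0 preserves S, it suffices to treat 1 + 2 tX(cf l), where tangency is the linearized
    equation that defines [Kz]. *)
Lemma Jpsi_tangent l i : int l -> drho S (psi l) (vec_mx (row i (Jpsi l))) = 0.
Proof.
move=> hl; set c0 := cf l; have hc0 : int c0 by exact: cf_int.
have -> : row i (Jpsi l) = delta_mx 0 i *m Jpsi l by rewrite rowE.
rewrite JpsiE -/c0; set v := delta_mx 0 i; set c := row_mx _ _.
set g1 := 1%:M + 2 *: tX c0.
have eO : g0^T *m S *m g0 = S by [].
have dE X : drho S (psi l) (g0 *m X) = drho S g1 X.
  rewrite /drho /psi -/c0 -/g1 !trmx_mul.
  have -> : X^T *m g0^T *m S *m (g0 *m g1) = X^T *m (g0^T *m S *m g0) *m g1 by rewrite !mulmxA.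
  have -> : g1^T *m g0^T *m S *m (g0 *m X) = g1^T *m (g0^T *m S *m g0) *m X by rewrite !mulmxA.
  by rewrite eO.
have -> : 2 *: (g0 *m tX c) = g0 *m tX (2 *: c) by rewrite tXZ scalemxAr.
rewrite dE; apply: Qc_inj.
  rewrite /drho trmxD !trmx_mul !trmxK hSt addrC.
  by rewrite !mulmxA.
rewrite Qc_drho -scalemxAl linearZ /= scalerA mulrC -scalerA -scalerDr.
suff -> : rsubmx c + 2 *: (c *m pD c0) = 0 by rewrite scaler0.
rewrite row_mxKr -{1}[pD c0]vsubmxK mul_row_col.
have e1 : v *m Kz c0 *m Wz c0 = - (2 *: (v *m usubmx (pD c0))).
  by rewrite -mulmxA KzE // mulmxN -scalemxAr.
have e2 : v *m Kz c0 *m Wz c0 = v *m Kz c0 + 2 *: (v *m Kz c0 *m dsubmx (pD c0)).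
  by rewrite /Wz mulmxDr mulmx1 -scalemxAr.
by rewrite scalerDr addrCA -e2 e1 subrr.
Qed.

Lemma Jpsi_free l : int l -> row_free (Jpsi l).
Proof.
have two0 := dvr_two_neq0 hA.
move=> hl; rewrite -kermx_eq0; apply/rowV0P => v /sub_kermxP h.
have := JpsiE l v; rewrite h linear0 => /eqP; rewrite eq_sym scaler_eq0 (negPf two0) /=.
move=> /eqP/(congr1 (mulmx (invmx g0))); rewrite mulKmx // mulmx0 => /(congr1 co).
rewrite tXK /co linear0 mul0mx -(row_mx0 F 1 d u).
by case/eq_row_mx.
Qed.

End Coset.
End Parametrization.

(** * The measure of a coset *)

Lemma det_castmx_mul (F : fieldType) m N (e : m = N) (Y : 'M[F]_m) (B : 'M[F]_(m, N)) (L : 'M[F]_N) :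
  \det (castmx (e, erefl) (Y *m B *m L)) = \det Y * \det (castmx (e, erefl) B) * \det L.
Proof. by case: N / e B L => B L; rewrite !castmx_id !det_mulmx. Qed.

Section LinearOperators.
Variables (F : fieldType) (A : set F) (hA : complete_dvr A).

Lemma lin_mx_int m n m' n' (h : 'M[F]_(m, n) -> 'M[F]_(m', n')) :
  (forall X, integral_mx A X -> integral_mx A (h X)) -> integral_mx A (lin_mx h).
Proof.
move=> hh i j; rewrite !mxE /=; case/mxvec_indexP: j => a b; rewrite mxvecE.
by apply: hh => c e; rewrite mxE; apply: integral_delta.
Qed.

Lemma lin_mulmx_cancel n (g h : 'M[F]_n) : h *m g = 1%:M ->
  lin_mx (mulmx g) *m lin_mx (mulmx h) = 1%:M :> 'M[F]_(n * n).
Proof.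
move=> e; apply/row_matrixP => i; rewrite !rowE mulmxA -[delta_mx _ _]vec_mxK !mul_vec_lin /=.
by rewrite mulmxA e mul1mx mulmx1.
Qed.

Lemma lin_mulmx_det n (g : 'M[F]_n) : integral_mx A g -> A_unit A (\det g) ->
  A_unit A (\det (lin_mx (mulmx g) : 'M[F]_(n * n))).
Proof.
move=> ig dg; have ug := det_unit_unitmx dg.
apply: (integral_mulmx1_det hA (N := lin_mx (mulmx (invmx g)))).
- by apply: lin_mx_int => X iX; apply: integral_mxM.
- by apply: lin_mx_int => X iX; apply: integral_mxM => //; apply: integral_invmx.
- by apply: lin_mulmx_cancel; rewrite mulVmx.
Qed.

End LinearOperators.

(** * Measurability of the sets involved *)

Section BorelSets.
Variables (R : realType) (F : fieldType) (A : set F) (hA : complete_dvr A) (f : nat) (hf : (1 < f)%N).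

Lemma mxopen_measurable m n (U : set 'M[F]_(m, n)) : mxopen R A f U ->
  measurable (U : set (borel R A f m n)).
Proof. by move=> oU; apply: sub_sigma_algebra. Qed.

Lemma mx_denominator m n (M : 'M[F]_(m, n)) : exists k : nat, integral_mx A (2 ^+ k *: M).
Proof.
have two0 := dvr_two_neq0 hA.
have den (x : F) : exists k : nat, A (2 ^+ k * x).
  have [->|x0] := eqVneq x 0; first by exists 0%N; rewrite mulr0; exact: dvr0.
  have [[k|k] [_ hk _]] := dvr_ord hA x0.
    exists 0%N; rewrite mul1r; move: hk; rewrite -exprnN => hk.
    have -> : x = x / 2 ^+ k * 2 ^+ k by rewrite divfK // expf_neq0.
    by apply: (dvrM hA) => //; apply: dvrX => //; apply: dvr_nat.
  by exists k.+1; rewrite mulrC; move: hk; rewrite NegzE opprK -exprnP.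
have /choice[k hk] : forall p : 'I_m * 'I_n, exists k : nat, A (2 ^+ k * M p.1 p.2).
  by move=> p; exact: den.
exists (\max_p k p)%N => i j; rewrite mxE.
have le : (k (i, j) <= \max_p k p)%N by apply: leq_bigmax.
rewrite -(subnK le) exprD -mulrA; apply: (dvrM hA); last exact: hk (i, j).
by apply: dvrX => //; apply: dvr_nat.
Qed.

Lemma integral_measurable m n : measurable (@integral_mx F A m n : set (borel R A f m n)).
Proof.
apply: mxopen_measurable; apply: (mxopen_dv hA R hf) => x hx; exists 0%N => y /(mdv0E hA) h.
by rewrite -[y](subrK x); apply: integral_mxD.
Qed.

Lemma OV_measurable n (S : 'M[F]_n) : measurable (OV S : set (borel R A f n n)).
Proof.
rewrite -[OV S]setCK; apply: measurableC; apply: mxopen_measurable.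
apply: (mxopen_dv hA R hf) => m nm.
have [k1 hk1] : exists k, ~ mdv A k (rho S m - S).
  apply: contrapT => H; apply: nm; rewrite /OV /=; apply/eqP; rewrite -subr_eq0; apply/eqP.
  by apply: (mdv_infty hA) => k; apply: contrapT => nk; apply: H; exists k.
have [k2 hk2] := mx_denominator m; have [k3 hk3] := mx_denominator S.
(* With 2^k2 m and 2^k3 S integral, a perturbation of m by a multiple of 2^(k1 + k2 + k3) changes
   rho(m) by a multiple of 2^k1, too little to reach S. *)
exists (k1 + k2 + k3)%N => y hy oy; apply: hk1.
have two0 := dvr_two_neq0 hA.
have [h ih eh] := mdvP hA hy.
have ey : y = m + 2 ^+ (k1 + k2 + k3) *: h by rewrite -eh addrC subrK.
move: oy; rewrite /OV /= ey => oy.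
have -> : rho S m - S = - (2 ^+ k1 *: (h^T *m (2 ^+ k3 *: S) *m (2 ^+ k2 *: m)
    + (2 ^+ k2 *: m)^T *m (2 ^+ k3 *: S) *m h
    + 2 ^+ (k1 + k2 + k2) *: (h^T *m (2 ^+ k3 *: (2 ^+ k3 *: S)) *m h))); last first.
  apply: (mdvN hA); apply: (mdv_mul hA).
  have iS := integral_tr hk2.
  apply: (integral_mxD hA); first apply: (integral_mxD hA).
  - by do 2?apply: (integral_mxM hA) => //; apply: integral_tr.
  - by do 2?apply: (integral_mxM hA) => //.
  - apply: (integral_mxZ hA); first by apply: dvrX => //; apply: dvr_nat.
    apply: (integral_mxM hA) => //; apply: (integral_mxM hA); first exact: integral_tr.
    by apply: (integral_mxZ hA) => //; apply: dvrX => //; apply: dvr_nat.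
rewrite -{2}oy /rho trmxD !trmxZ !mulmxDr !mulmxDl -!scalemxAl -!scalemxAr -!scalemxAl !exprD.
by apply/matrixP => i j; rewrite !mxE; ring.
Qed.

Lemma mulmxr_continuous m p q (B : 'M[F]_(p, q)) k :
  exists k0 : nat, forall X : 'M[F]_(m, p), mdv A k0 X -> mdv A k (X *m B).
Proof.
have [k1 hk1] := mx_denominator B; have two0 := dvr_two_neq0 hA.
exists (k + k1)%N => X /(mdvP hA)[Y iY ->].
rewrite -scalemxAl exprD -scalerA scalemxAr; apply: (mdv_mul hA).
exact: integral_mxM.
Qed.

End BorelSets.

Section CosetMeasure.
Variables (R : realType) (F : fieldType) (A : set F) (hA : complete_dvr A) (f : nat) (hf : (1 < f)%N).
Variables (n : nat) (S : 'M[F]_n).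
Local Notation d := 'C(n, 2).
Local Notation u := #|upper n|.
Variables (Bas : 'M[F]_(d + u, n * n)) (Bas' : 'M[F]_(n * n, d + u)) (HB HB' : 'M[F]_u).
Hypothesis tb : tangent_basis A S Bas Bas' HB HB'.
Variables (mu : forall d : nat, borel_measure R A f 1 d) (hmu : forall d, is_haar (mu d)).
Variables (cM cQ : F).
Hypotheses (hcM : normalized_form (mu (n * n)%N) cM) (hcQ : normalized_form (mu u) cQ).
Variable omega : 'M[F]_n -> 'M[F]_(d, n * n) -> F.
Hypothesis homega : is_quotient_form S cM cQ omega.
Variable nu : borel_measure R A f n n.
Hypothesis hnu : is_form_measure S (mu d) omega nu.

Local Notation abs := (absF R A f).
Local Notation int := (integral_mx A).

Lemma integral_cst_int k (r : R) : 0 <= r ->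
  (\int[mu k]_(x in (@integral_mx F A 1 k : set (borel R A f 1 k))) r%:E = r%:E)%E.
Proof.
move=> r0; rewrite integral_cst; last exact: integral_measurable.
by case: (hmu k) => _ ->; rewrite mule1.
Qed.

Lemma normalized_form_abs k c : normalized_form (mu k) c -> abs c = 1.
Proof.
rewrite /normalized_form integral_cst_int; last exact: absF_ge0.
by case.
Qed.

(** f^-d is the absolute value of 2^d, coming from the factor 2 in 1 + 2X on d kernel coordinates;
    the quotient compares the covolumes of the tangent lattice and of the target lattice. *)
Definition tb_volume : R :=
  f%:R ^- d * (abs (\det (castmx (dim_fiber_base n, erefl) Bas)) / abs (\det HB)).

Section OneCoset.
Variables (g0 : 'M[F]_n) (hg0 : Aut_L A S g0).

Let ig0 : int g0. Proof. by case/(Aut_LP hA (tb_unit tb)): hg0. Qed.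
Let Og0 : OV S g0. Proof. by case: hg0. Qed.

Local Notation psi := (psi A S Bas HB' g0).
Local Notation Jpsi := (Jpsi A S Bas HB' g0).
Local Notation cf := (cf A S Bas HB').

Lemma psi_drho l X : int l ->
  drho S (psi l) (g0 *m X) = drho S (1%:M + 2 *: tX Bas (cf l)) X.
Proof.
move=> hl; have eO : g0^T *m S *m g0 = S by [].
rewrite /drho /psi !trmx_mul; set g1 := 1%:M + _.
have -> : X^T *m g0^T *m S *m (g0 *m g1) = X^T *m (g0^T *m S *m g0) *m g1 by rewrite !mulmxA.
have -> : g1^T *m g0^T *m S *m (g0 *m X) = g1^T *m (g0^T *m S *m g0) *m X by rewrite !mulmxA.
by rewrite eO.
Qed.

(** The relation defining omega is evaluated on the tangent frame completed by g0 times the last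
    basis vectors, without the factor 2. The frame is then block triangular, with determinant 2^d
    det Bas det LG, and its image under the differential is Wz HB. Since LG and Wz have unit
    determinant, only 2^d, Bas and HB contribute. *)
Lemma abs_omega_psi l : int l -> abs (omega (psi l) (Jpsi l)) = tb_volume.
Proof.
move=> hl; have hc := cf_int hA tb hl; have two0 := dvr_two_neq0 hA.
pose LG : 'M[F]_(n * n) := lin_mx (mulmx g0).
pose W : 'M[F]_(u, d + u) := row_mx 0 1%:M.
pose w : 'M[F]_(u, n * n) := W *m Bas *m LG.
have := homega (psi_OV hA tb hg0 hl) (v := Jpsi l) w (fun i => Jpsi_tangent hA tb hg0 i hl).
have LG2 : lin_mx (mulmx (2 *: g0)) = 2 *: LG.
  apply/row_matrixP => i; rewrite !rowE -[delta_mx _ _]vec_mxK -scalemxAr !mul_vec_lin /=.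
  by rewrite -scalemxAl linearZ.
have -> : col_mx (Jpsi l) w =
    block_mx 2%:M (2 *: Kz S Bas HB' (cf l)) 0 1%:M *m Bas *m LG.
  rewrite /Jpsi LG2 -scalemxAr scalemxAl scalemxAl scale_row_mx scalemx1 /w /W.
  by rewrite -!mul_col_mx.
have -> : \matrix_k symcoord (drho S (psi l) (vec_mx (row k w))) = Wz S Bas HB' (cf l) *m HB.
  apply/row_matrixP => k; rewrite rowK [in RHS]row_mul.
  have -> : vec_mx (row k w) = g0 *m tX Bas (row_mx 0 (delta_mx 0 k)).
    rewrite /w !row_mul -[row k W *m Bas]vec_mxK mul_vec_lin mxvecK /= /tX /W.
    by rewrite row_row_mx row0 row1.
  rewrite psi_drho // -[LHS]mulmx1 -(mulmx1C (tb_Hinv tb)) mulmxA; congr (_ *m _).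
  rewrite -[LHS]/(Qc HB' _) (Qc_drho tb) row_mxKr.
  rewrite -{1}[pD _ _ _ _]vsubmxK mul_row_col mul0mx add0r /Wz.
  by rewrite linearD linearZ /= row1 rowE.
rewrite /top_form det_castmx_mul det_ublock det1 mulr1 det_scalar det_mulmx.
move/(congr1 abs); rewrite !absFM // (normalized_form_abs hcM) (normalized_form_abs hcQ) !mul1r.
have -> : abs (\det LG) = 1.
  apply: absF_unit => //; apply: lin_mulmx_det => //; exact: OV_det_unit (tb_unit tb) _ Og0.
have -> : abs (\det (Wz S Bas HB' (cf l))) = 1 by apply: absF_unit => //; apply: (Wz_det hA tb).
have -> : abs (2 ^+ d) = f%:R ^- d by rewrite exprnN; apply: (absF_pow2 hA _ hf d).
rewrite mul1r mulr1 /tb_volume mulrA => ->; rewrite mulfK // gt_eqF // absF_gt0 //.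
by rewrite -unitfE -unitmxE; case/mulmx1_unit: (tb_Hinv tb).
Qed.

Lemma coset_measure : nu (aut_coset A S Bas' g0) = tb_volume%:E.
Proof.
rewrite -(psi_image hA tb hg0).
rewrite (hnu (U := integral_mx A (n := d)) (J := Jpsi)).
- rewrite (@eq_integral _ _ _ _ _ (cst tb_volume%:E)).
    rewrite integral_cst_int //.
    rewrite /tb_volume mulr_ge0 ?invr_ge0 ?exprn_ge0 ?ler0n // divr_ge0 //; exact: absF_ge0.
  by move=> x; rewrite inE => hx; rewrite abs_omega_psi.
- apply: (mxopen_dv hA R hf) => x hx; exists 0%N => y /(mdv0E hA) h.
  by rewrite -[y](subrK x); apply: integral_mxD.
- by move=> x hx; apply: (psi_OV hA tb hg0).
- by move=> x y _ _; apply: (psi_inj hA tb hg0).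
- move=> x hx; apply: (strict_derivative_dv hA) => // e.
  exact: (psi_deriv hA tb hg0).
- by move=> x hx; apply: (Jpsi_free hA tb hg0).
Qed.

End OneCoset.

Lemma aut_coset_measurable g0 : Aut_L A S g0 ->
  measurable (aut_coset A S Bas' g0 : set (borel R A f n n)).
Proof.
move=> hg0; have hSu := tb_unit tb.
have -> : aut_coset A S Bas' g0 = OV S `&` [set g | int g /\ mdv A 1 (co Bas' (g - g0))].
  apply/seteqP; split=> [g [/(Aut_LP hA hSu)[Og ig] h]|g [Og [ig h]]] //.
  by split=> //; apply/(Aut_LP hA hSu).
apply: measurableI; first exact: OV_measurable.
apply: mxopen_measurable; apply: (mxopen_dv hA R hf) => x [ix hx].
have [k0 hk0] := mulmxr_continuous hA 1 Bas' 1.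
exists k0 => y hy; split.
  by rewrite -[y](subrK x); apply: (integral_mxD hA) => //; apply: (mdv_int hA hy).
have -> : y - g0 = (y - x) + (x - g0) by rewrite addrA subrK.
rewrite coD; apply: (mdvD hA) => //; apply: hk0 => i j.
by case/mxvec_indexP: j => a b; rewrite (ord1 i) mxvecE.
Qed.

End CosetMeasure.

(** * Counting cosets and lifting *)

Lemma ncard_eq (T : Type) (X : set T) m : (X #= `I_m)%card -> ncard X = m.
Proof.
move=> Xm; rewrite /ncard; case: xgetP => [k -> /= Xk|/(_ m)]; last by [].
by apply/card_eq_II; apply: card_eq_trans Xm; rewrite card_eq_sym.
Qed.

Lemma measure_uniform_partition d (T : ringOfSetsType d) (R : realFieldType)
    (mu : {measure set T -> \bar R}) (I : finType) (G : {set I}) (c : I -> set T) (v : R) (Y : set T) :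
  (forall i, i \in G -> measurable (c i)) -> (forall i, i \in G -> mu (c i) = v%:E) ->
  (forall i j x, i \in G -> j \in G -> c i x -> c j x -> i = j) ->
  (forall x, Y x <-> exists2 i, i \in G & c i x) ->
  mu Y = (#|G|%:R * v)%:E.
Proof.
move=> mc vc dc hY.
have -> : Y = \big[setU/set0]_(i < #|G|) c (enum_val i).
  rewrite -bigcup_seq; apply/seteqP; split=> x.
    move/hY => [i iG cx]; exists (enum_rank_in iG i); first by rewrite /= mem_index_enum.
    by rewrite enum_rankK_in.
  by case=> i _ cx; apply/hY; exists (enum_val i) => //; exact: enum_valP.
rewrite (@measure_bigsetU_ord _ _ _ mu _ xpredT (fun i => c (enum_val i))).
- rewrite (eq_bigr (fun=> v%:E)) => [|i _]; last by apply: vc; exact: enum_valP.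
  by rewrite sumEFin sumr_const card_ord mulr_natl.
- by move=> i; apply: mc; exact: enum_valP.
- move=> i j _ _ [x [ci cj]]; apply: enum_val_inj.
  by apply: dc ci cj; exact: enum_valP.
Qed.

Section ResidueClasses.
Variables (F : fieldType) (A : set F) (hA : complete_dvr A).
Variables (kappa : finFieldType) (pi : F -> kappa) (hpi : is_residue_map A pi).

Lemma residue0 : pi 0 = 0.
Proof. by apply/(residue_ker hpi (dvr0 hA)); exists 0; [exact: dvr0 | rewrite mulr0]. Qed.

Lemma residueB x y : A x -> A y -> pi (x - y) = pi x - pi y.
Proof.
move=> Ax Ay; have := residueD hpi (dvrB hA Ax Ay) Ay.
by rewrite subrK => ->; rewrite addrK.
Qed.

Lemma residue_eq0 x : A x -> pi x = 0 <-> pow2A A 1 x.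
Proof.
move=> Ax; rewrite (residue_ker hpi Ax).
by split=> -[a Aa e]; exists a => //; rewrite e ?expr1.
Qed.

Lemma residue_eq x y : A x -> A y -> pi x = pi y <-> pow2A A 1 (x - y).
Proof.
move=> Ax Ay; rewrite -residue_eq0; last exact: (dvrB hA).
rewrite residueB //; split=> [->|/eqP]; first by rewrite subrr.
by rewrite subr_eq0 => /eqP.
Qed.

Lemma residue_unit x : A x -> pi x != 0 <-> A_unit A x.
Proof.
move=> Ax; split=> [/eqP nx|ux].
  by apply: (nonunit_dv hA) => // h; apply: nx; apply/residue_eq0.
by apply/eqP => /(residue_eq0 Ax); exact: (unit_ndv hA ux).
Qed.

Variables (n : nat) (S : 'M[F]_n).
Local Notation d := 'C(n, 2).
Local Notation u := #|upper n|.
Variables (Bas : 'M[F]_(d + u, n * n)) (Bas' : 'M[F]_(n * n, d + u)) (HB HB' : 'M[F]_u).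
Hypothesis tb : tangent_basis A S Bas Bas' HB HB'.
Local Notation int := (integral_mx A).

(** The coordinates of g in M modulo 2. They separate the cosets of 1 + 2M' ([aut_class_eq]) and are
    in bijection with the special points ([card_special_points]). *)
Definition aut_class (g : 'M[F]_n) : {ffun 'I_(d + u) -> kappa} :=
  [ffun k => pi (co Bas' (g - 1%:M) 0 k)].

Definition aut_classes : {set {ffun 'I_(d + u) -> kappa}} :=
  [set c : {ffun 'I_(d + u) -> kappa} | `[< exists2 g, Aut_L A S g & aut_class g = c >]]%SET.

Lemma co1_int g : Aut_L A S g -> int (co Bas' (g - 1%:M)).
Proof. exact: tb_aut tb g. Qed.

Lemma coB M N : co Bas' (M - N) = co Bas' M - co Bas' N.
Proof. by rewrite coD -scaleN1r coZ scaleN1r. Qed.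

Lemma aut_class_eq g g0 : Aut_L A S g -> Aut_L A S g0 ->
  aut_class g = aut_class g0 <-> mdv A 1 (co Bas' (g - g0)).
Proof.
move=> hg hg0; have ig := co1_int hg; have ig0 := co1_int hg0.
have e : co Bas' (g - g0) = co Bas' (g - 1%:M) - co Bas' (g0 - 1%:M).
  by rewrite -coB; congr co; rewrite opprB addrA subrK.
rewrite e /aut_class; move: ig ig0 {e}.
move: (co _ (g - 1%:M)) (co _ (g0 - 1%:M)) => a b ia ib; split=> [/ffunP h i j|h].
  by have := h j; rewrite !ffunE (ord1 i) !mxE => /(residue_eq (ia 0 j) (ib 0 j)).
apply/ffunP => k; rewrite !ffunE; apply/(residue_eq (ia 0 k) (ib 0 k)).
by have := h 0 k; rewrite !mxE.
Qed.

Variables (R : realType) (f : nat) (hf : f = #|kappa|).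
Variables (mu : forall d : nat, borel_measure R A f 1 d) (hmu : forall d, is_haar (mu d)).
Variables (cM cQ : F).
Hypotheses (hcM : normalized_form (mu (n * n)%N) cM) (hcQ : normalized_form (mu u) cQ).
Variable omega : 'M[F]_n -> 'M[F]_(d, n * n) -> F.
Hypothesis homega : is_quotient_form S cM cQ omega.
Variable nu : borel_measure R A f n n.
Hypothesis hnu : is_form_measure S (mu d) omega nu.

Lemma Aut_L_measure : nu (Aut_L A S) = (#|aut_classes|%:R * tb_volume R A f Bas HB)%:E.
Proof.
have f1 : (1 < f)%N by rewrite hf card_finNzRing_gt1.
have rep c : c \in aut_classes -> exists2 g0, Aut_L A S g0 &
    [set g | Aut_L A S g /\ aut_class g = c] = aut_coset A S Bas' g0.
  rewrite inE => /asboolP[g0 hg0 <-]; exists g0 => //.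
  by apply/seteqP; split=> g [hg h]; split=> //; apply/aut_class_eq.
apply: (@measure_uniform_partition _ (borel R A f n n) R nu _ aut_classes
  (fun c => [set g : 'M[F]_n | Aut_L A S g /\ aut_class g = c])).
- by move=> c /rep[g0 hg0 ->]; exact: (aut_coset_measurable hA f1 tb).
- move=> c /rep[g0 hg0 ->].
  exact: (coset_measure hA f1 tb hmu hcM hcQ homega hnu hg0).
- by move=> i j g _ _ [_ <-] [_ <-].
- move=> g; split=> [hg|[c _ [] //]]; exists (aut_class g) => //.
  by rewrite inE; apply/asboolP; exists g.
Qed.

End ResidueClasses.

Lemma trmxB (F : fieldType) m n (M N : 'M[F]_(m, n)) : (M - N)^T = M^T - N^T.
Proof. exact: linearB. Qed.

(** * Lifting solutions modulo 2 to automorphisms *)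

Section Lifting.
Variables (F : fieldType) (A : set F) (hA : complete_dvr A).
Variables (n : nat) (S : 'M[F]_n).
Local Notation d := 'C(n, 2).
Local Notation u := #|upper n|.
Variables (Bas : 'M[F]_(d + u, n * n)) (Bas' : 'M[F]_(n * n, d + u)) (HB HB' : 'M[F]_u).
Hypothesis tb : tangent_basis A S Bas Bas' HB HB'.
Local Notation int := (integral_mx A).
Local Notation tX := (tX Bas).
Local Notation co := (co Bas').
Local Notation Qc := (Qc HB').
Local Notation qX := (qX S Bas HB').
Local Notation pX := (pX S Bas HB').

(** Writing rho(m) = S + 2 dr(Z) with Z in M', a correction g = m (1 + 2X) with X in the
    complementary directions is orthogonal as soon as z = -h - 2 G0(z), which is again a
    contraction. Then g - m = 2 m X lies in 2M'. *)
Lemma lift_to_Aut_L y : int y -> let m := 1%:M + tX y in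
  mdv A 1 (Qc (rho S m - S)) -> exists2 g, Aut_L A S g & mdv A 1 (co (g - m)).
Proof.
move=> iy m; have two0 := dvr_two_neq0 hA; have hSt := tb_sym tb.
move/(mdvP hA)=> [h ih eh]; rewrite expr1 in eh.
(* The differential maps the complementary coordinates bijectively to the target coordinates, so the
   defect 2h is 2 dr(Z) for Z with coordinates (0, h). *)
pose e : 'rV_(d + u) := row_mx 0 h; pose Z := tX e.
have ie : int e by apply: row_mx_int => //; exact: integral_0.
pose L (c : 'rV_(d + u)) := co (Z *m tX c).
have iL c : int c -> int (L c) by move=> ic; apply: (tb_mul tb).
have LB c c' : L (c - c') = L c - L c' by rewrite /L tXB mulmxBr coB.
have LZ a c : L (a *: c) = a *: L c by rewrite /L tXZ -scalemxAr coZ.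
have Ldv k c : mdv A k c -> mdv A k (L c).
  by move=> /(mdvP hA)[c' ic' ->]; rewrite LZ; apply: (mdv_mul hA); apply: iL.
have rm : rho S m = S + 2 *: dr S Z.
  apply/eqP; rewrite addrC -subr_eq -subr_eq0; apply/eqP; apply: (Qc_inj tb).
    rewrite /rho /dr !(trmxB, trmxZ, trmxD, trmx_mul, trmxK) hSt.
    by rewrite [S *m Z + _]addrC !mulmxA.
  rewrite -scaleNr QcD QcZ eh (Qc_dr tb) row_mxKr scaleNr subrr //.
(* The four terms are the coordinates of dr(ZX), of X^T S Z + Z^T S X, of X^T S X, and of the term
   cubic in Z and X, which carries one more 2. *)
pose G0 (z : 'rV_u) := let c := row_mx 0 z in
  rsubmx (L c) + pX c e + qX c + 2 *: pX c (L c).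
have irow (z : 'rV_u) : int z -> int (row_mx (0 : 'rV_d) z).
  by move=> iz; apply: row_mx_int => //; exact: integral_0.
have irs k (c : 'rV_(d + u)) : mdv A k c -> mdv A k (rsubmx c) by move=> ic i j; rewrite mxE.
have G0lip : dv_lipschitz A (fun z : 'rV_u => - G0 z).
  split=> [z iz|k z z' iz iz' hz].
    apply/(mdv0E hA)/(mdvN hA)/(mdv0E hA); have ic := irow _ iz.
    apply: (integral_mxD hA); first apply: (integral_mxD hA); first apply: (integral_mxD hA).
    - by apply/(mdv0E hA)/irs/(mdv0E hA)/iL.
    - exact: (pX_int hA tb).
    - exact: (qX_int tb).
    - by apply: (integral_mxZ hA); [apply: dvr_nat | apply: (pX_int hA tb) => //; apply: iL].
  have ic := irow _ iz; have ic' := irow _ iz'.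
  have hc : mdv A k (row_mx (0 : 'rV_d) z - row_mx 0 z').
    rewrite opp_row_mx add_row_mx subr0 => i j; rewrite mxE; case: fintype.split => a //.
    by rewrite mxE; exact: dv_0.
  rewrite -opprD; apply: (mdvN hA); rewrite /G0.
  set c := row_mx 0 z in ic hc *; set c' := row_mx 0 z' in ic' hc *.
  have -> : rsubmx (L c) + pX c e + qX c + 2 *: pX c (L c)
     - (rsubmx (L c') + pX c' e + qX c' + 2 *: pX c' (L c'))
     = rsubmx (L (c - c')) + pX (c - c') e + (qX c - qX c')
       + 2 *: (pX (c - c') (L c) + pX c' (L (c - c'))).
    rewrite LB pXBr !(pX_sym _ _ _ _ e) !(pX_sym _ _ _ _ (L c)) !pXBr linearB /=.
    rewrite !(pX_sym _ _ _ (L c)).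
    have aux (a a' b b' q1 q2 p p1 p' : 'rV[F]_u) : a + b + q1 + 2 *: p - (a' + b' + q2 + 2 *: p')
        = a - a' + (b - b') + (q1 - q2) + 2 *: (p - p1 + (p1 - p')).
      by apply/rowP => i; rewrite !mxE; ring.
    exact: aux.
  apply: (mdvD hA); first apply: (mdvD hA); first apply: (mdvD hA).
  - by apply: irs; apply: Ldv.
  - by rewrite -[k]addn0; apply: (pX_dv hA tb) => //; apply/(mdv0E hA).
  - exact: (qX_lip hA tb).
  - rewrite -[k]add0n; apply: (mdvZ hA); first by apply/(dv0E hA); apply: dvr_nat.
    apply: (mdvD hA).
      by rewrite -[k]addn0; apply: (pX_dv hA tb) => //; apply/(mdv0E hA); apply: iL.
    rewrite -[k]add0n; apply: (pX_dv hA tb); first by apply/(mdv0E hA).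
    exact: Ldv.
have [|z iz ez] := fixpoint_exists hA (h := - h) G0lip.
  by apply/(mdv0E hA)/(mdvN hA)/(mdv0E hA).
pose c : 'rV_(d + u) := row_mx 0 z; have ic : int c by exact: irow.
pose g := m *m (1%:M + 2 *: tX c).
have im : int m by apply: (integral_mxD hA); [exact: integral_1 | exact: (tX_int hA tb)].
have Og : OV S g.
  have -> : OV S g = (rho (rho S m) (1%:M + 2 *: tX c) = S).
    by rewrite /OV /= /rho /g trmx_mul !mulmxA.
  have -> : rho (rho S m) (1%:M + 2 *: tX c) = S + 2 *: (dr S Z + dr S (tX c)
     + 2 *: (dr S (Z *m tX c) + ((tX c)^T *m S *m Z + Z^T *m S *m tX c) + (tX c)^T *m S *m tX c
     + 2 *: ((tX c)^T *m S *m (Z *m tX c) + (Z *m tX c)^T *m S *m tX c))).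
    rewrite rm /rho /dr trmxD trmxZ trmx1 !trmx_mul.
    move: (tX c) => X; rewrite !mulmxDr !mulmxDl !mulmx1 !mul1mx.
    rewrite -!scalemxAl -!scalemxAr !mulmxDr !mulmxDl !mulmxA.
    rewrite -?scalemxAl ?mulmxDl ?mulmxA.
    by apply/matrixP => i j; rewrite !mxE; ring.
  rewrite -[RHS]addr0; congr (_ + _); apply/eqP; rewrite scaler_eq0 (negPf two0) /=; apply/eqP.
  apply: (Qc_inj tb).
    rewrite /dr !(trmxD, trmxZ, trmx_mul, trmxK) hSt !mulmxA.
    by apply/matrixP => i j; rewrite !mxE; ring.
  have Qaux D1 D2 D3 D4 D5 D6 : Qc (D1 + D2 + 2 *: (D3 + D4 + D5 + 2 *: D6)) =
      Qc D1 + Qc D2 + 2 *: (Qc D3 + Qc D4 + Qc D5 + 2 *: Qc D6) by rewrite !(QcD, QcZ).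
  have e1 : Qc (dr S Z) = h by rewrite (Qc_dr tb) row_mxKr.
  have e2 : Qc (dr S (tX c)) = z by rewrite (Qc_dr tb) row_mxKr.
  have e3 : Qc (dr S (Z *m tX c)) = rsubmx (L c) by rewrite -(Qc_dr tb) (coK tb).
  have e6 : Qc ((tX c)^T *m S *m (Z *m tX c) + (Z *m tX c)^T *m S *m tX c) = pX c (L c).
    by rewrite /pX /L (coK tb).
  rewrite Qaux e1 e2 e3 e6.
  have aux (a b w : 'rV[F]_u) : b = - a + 2 *: - w -> a + b + 2 *: w = 0.
    by move=> ->; apply/rowP => i; rewrite !mxE; ring.
  exact: aux ez.
exists g.
  apply/(Aut_LP hA (tb_unit tb)); split=> //.
  apply: (integral_mxM hA) => //; apply: (integral_mxD hA); first exact: integral_1.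
  by apply: (integral_mxZ hA); [apply: dvr_nat | apply: (tX_int hA tb)].
have -> : g - m = 2 *: (tX c + tX y *m tX c).
  by rewrite /g mulmxDr mulmx1 addrAC subrr add0r -scalemxAr /m mulmxDl mul1mx.
rewrite coZ; apply: (mdv_double hA); apply/(mdv0E hA).
by rewrite coD (tXK tb); apply: (integral_mxD hA) => //; apply: (tb_mul tb).
Qed.

End Lifting.

(** * Points of the special fiber *)

Lemma card_finset (T : finType) (G : {set T}) : ([set` G] #= `I_#|G|)%card.
Proof.
have -> : [set` G] = [set @enum_val _ (mem G) i | i in [set: 'I_#|G|]].
  apply/seteqP; split=> [x xG|_ [i _ <-]]; last exact: enum_valP.
  by exists (enum_rank_in xG x) => //; rewrite enum_rankK_in.
apply: card_eq_trans (inj_card_eq _) _; last by rewrite card_eq_sym card_II.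
by move=> i j _ _; exact: enum_val_inj.
Qed.

Section Evaluation.
Variables (F : fieldType) (n : nat).
Local Notation poly := (mpoly (n * n) F).

Section OneAlgebra.
Variables (E : comAlgType F) (m : 'M[E]_n).

Lemma eval_atD p p' : eval_at m (p + p') = eval_at m p + eval_at m p'.
Proof. by rewrite /eval_at rmorphD. Qed.

Lemma eval_atB p p' : eval_at m (p - p') = eval_at m p - eval_at m p'.
Proof. by rewrite /eval_at rmorphB. Qed.

Lemma eval_atM p p' : eval_at m (p * p') = eval_at m p * eval_at m p'.
Proof. by rewrite /eval_at rmorphM. Qed.

Lemma eval_at1 : eval_at m 1 = 1.
Proof. by rewrite /eval_at rmorph1. Qed.

HB.instance Definition _ := GRing.isZmodMorphism.Build poly E (eval_at m) eval_atB.
HB.instance Definition _ := GRing.isMonoidMorphism.Build poly E (eval_at m) (eval_at1, eval_atM).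

Lemma eval_atC a : eval_at m (in_alg poly a) = in_alg E a.
Proof. by rewrite /eval_at in_algE mmapZ rmorph1 mulr1. Qed.

Lemma eval_atX k : eval_at m (mpolyX F (mnm1 k)) = mxvec m 0 k.
Proof. by rewrite /eval_at mmapX mmap1U. Qed.

Definition generic_mx : 'M[poly]_n := \matrix_(i, j) mpolyX F (mnm1 (mxvec_index i j)).

Lemma map_generic_mx : map_mx (eval_at m) generic_mx = m.
Proof. by apply/matrixP => i j; rewrite !mxE eval_atX mxvecE. Qed.

Lemma map_const_mx a b (B : 'M[F]_(a, b)) :
  map_mx (eval_at m) (map_mx (in_alg poly) B) = map_mx (in_alg E) B.
Proof. by apply/matrixP => i j; rewrite !mxE eval_atC. Qed.

End OneAlgebra.

Lemma eval_at_generic p : eval_at (generic_mx : 'M[poly : comAlgType F]_n) p = p.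
Proof.
rewrite /eval_at /mmap [RHS]mpolyE; apply: eq_bigr => mm _.
rewrite in_algE mulr_algl; congr (_ *: _); rewrite -mmap1_id; apply: mmap1_eq => k.
by case/mxvec_indexP: k => i j; rewrite mxvecE mxE.
Qed.

Lemma eval_at_det (E : comAlgType F) (m : 'M[E]_n) : eval_at m (det_poly F n) = \det m.
Proof.
rewrite /det_poly -[RHS](congr1 determinant (map_generic_mx m)).
by rewrite det_map_mx.
Qed.

End Evaluation.

Lemma subalgebra_subring (F : fieldType) (A : set F) (hA : complete_dvr A) (E : comAlgType F)
  (T : set E) : is_A_subalgebra A T -> subring_set T.
Proof. by case=> TA TB TM; split=> //; rewrite -(rmorph1 (in_alg E)); apply: TA; exact: dvr1. Qed.

Section SpecialPoints.
Variables (F : fieldType) (A : set F) (hA : complete_dvr A).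
Variables (kappa : finFieldType) (pi : F -> kappa) (hpi : is_residue_map A pi).
Variables (n : nat) (q : 'cV[F]_n -> F).
Local Notation S := (gram q).
Local Notation d := 'C(n, 2).
Local Notation u := #|upper n|.
Variables (Bas : 'M[F]_(d + u, n * n)) (Bas' : 'M[F]_(n * n, d + u)) (HB HB' : 'M[F]_u).
Hypothesis tb : tangent_basis A S Bas Bas' HB HB'.
Local Notation poly := (mpoly (n * n) F).
Local Notation int := (integral_mx A).

Definition coE (E : comAlgType F) (m : 'M[E]_n) : 'rV[E]_(d + u) :=
  mxvec (m - 1%:M) *m map_mx (in_alg E) Bas'.

(** M is thereby an affine space over A with the coordinates [coE]; this is established for the
    tangent basis in [uM_coords]. *)
Hypothesis uME : forall (E : comAlgType F) (T : set E), is_A_subalgebra A T ->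
  forall m, uM A q T m <-> forall k, T (coE m 0 k).

Lemma map_coE (E : comAlgType F) (m : 'M[E]_n) :
  map_mx (eval_at m) (coE (generic_mx F n : 'M[poly : comAlgType F]_n)) = coE m.
Proof.
by rewrite /coE map_mxM map_const_mx map_mxvec map_mxB map_generic_mx map_mx1.
Qed.

Definition Ypoly k : poly := coE (generic_mx F n : 'M[poly : comAlgType F]_n) 0 k.

Lemma eval_Ypoly (E : comAlgType F) (m : 'M[E]_n) k : eval_at m (Ypoly k) = coE m 0 k.
Proof. by rewrite -(map_coE m) mxE. Qed.

Lemma coE_regular (m : 'M[F]_n) : coE (m : 'M[F^o]_n) = co Bas' (m - 1%:M).
Proof.
rewrite /coE /co; congr (_ *m _); apply/matrixP => i j.
by rewrite mxE in_algE /GRing.scale /= mulr1.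
Qed.

Lemma coord_alg : is_A_subalgebra (E := poly) A (coord_ring_M A q).
Proof.
split.
- by move=> a Aa E T [hT _ _] m _; rewrite eval_atC; apply: hT.
- move=> p p' hp hp' E T hT m um; rewrite eval_atB; case: (hT) => _ hB _.
  by apply: hB; [apply: hp | apply: hp'].
- move=> p p' hp hp' E T hT m um; rewrite eval_atM; case: (hT) => _ _ hM.
  by apply: hM; [apply: hp | apply: hp'].
Qed.

Lemma Ypoly_coord k : coord_ring_M A q (Ypoly k).
Proof. by move=> E T hT m /(uME hT) h; rewrite eval_Ypoly. Qed.

(* The generic matrix is a point of M over the A-algebra generated by its
   coordinates. *)
Lemma coord_generated (T : set poly) : is_A_subalgebra (E := poly) A T ->
  (forall k, T (Ypoly k)) -> forall p, coord_ring_M A q p -> T p.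
Proof.
move=> hT hY p /(_ _ T hT (generic_mx F n)); rewrite eval_at_generic; apply.
exact/(uME hT).
Qed.

Lemma regular_subalg : is_A_subalgebra (E := F^o : comAlgType F) A A.
Proof.
split; [|exact: (dvrB hA)|exact: (dvrM hA)].
by move=> a Aa; rewrite in_algE /GRing.scale /= mulr1.
Qed.

(** The polynomials satisfying the conclusion form an A-subalgebra containing the coordinates
    [Ypoly], and these generate the coordinate ring. *)
Lemma special_point_eval phi (m : 'M[F]_n) : is_special_point A q pi phi ->
  int (co Bas' (m - 1%:M)) -> (forall k, phi (Ypoly k) = pi (co Bas' (m - 1%:M) 0 k)) ->
  forall p, coord_ring_M A q p -> A (eval_at (m : 'M[F^o]_n) p) /\
    phi p = pi (eval_at (m : 'M[F^o]_n) p).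
Proof.
move=> hphi im hY p hp; have [c1 c2 c3] := coord_alg.
suff [] : [set p | coord_ring_M A q p /\ A (eval_at (m : 'M[F^o]_n) p) /\
    phi p = pi (eval_at (m : 'M[F^o]_n) p)] p by [].
apply: coord_generated hp; last first.
  move=> k; split; first exact: Ypoly_coord.
  by rewrite eval_Ypoly coE_regular.
have phiB p1 p2 : coord_ring_M A q p1 -> coord_ring_M A q p2 -> phi (p1 - p2) = phi p1 - phi p2.
  move=> h1 h2; have := pointD hphi (c2 _ _ h1 h2) h2.
  by rewrite subrK => ->; rewrite addrK.
split.
- move=> a Aa; split; first exact: c1.
  have -> : eval_at (m : 'M[F^o]_n) (in_alg poly a) = a.
    by rewrite eval_atC in_algE /GRing.scale /= mulr1.
  by split=> //; apply: (pointC hphi).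
- move=> p1 p2 [h1 [A1 e1]] [h2 [A2 e2]]; split; first exact: c2.
  rewrite eval_atB; split; first exact: (dvrB hA).
  by rewrite (residueB hA hpi) // phiB // e1 e2.
- move=> p1 p2 [h1 [A1 e1]] [h2 [A2 e2]]; split; first exact: c3.
  rewrite eval_atM; split; first exact: (dvrM hA).
  by rewrite (residueM hpi) // (pointM hphi) // e1 e2.
Qed.

Lemma Aut_L_uM g : Aut_L A S g -> uM A q (A : set F^o) (g : 'M[F^o]_n).
Proof.
move=> hg; apply/(uME regular_subalg) => k; rewrite coE_regular.
exact: (tb_aut tb hg).
Qed.

Lemma map_regular a b (B : 'M[F]_(a, b)) : map_mx (in_alg (F^o : comAlgType F)) B = B.
Proof. by apply/matrixP => i j; rewrite mxE in_algE /GRing.scale /= mulr1. Qed.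

Lemma Aut_L_uG g : Aut_L A S g -> uG A q (A : set F^o) (g : 'M[F^o]_n).
Proof.
move=> hg; split; last by rewrite /= map_regular; case: hg.
split; first exact: Aut_L_uM.
have [Og _] := hg; have [d0 _ hd] := OV_det_unit hA (tb_unit tb) Og.
by exists (\det g)^-1 => //; rewrite mulVf.
Qed.

Definition sp (g : 'M[F]_n) (p : poly) : kappa :=
  if `[< coord_ring_M A q p >] then pi (eval_at (g : 'M[F^o]_n) p) else 0.

Lemma sp_coord g p : coord_ring_M A q p -> sp g p = pi (eval_at (g : 'M[F^o]_n) p).
Proof. by move=> hp; rewrite /sp asboolT. Qed.

Lemma sp_special g : Aut_L A S g -> is_special_point A q pi (sp g).
Proof.
move=> hg; have ug := Aut_L_uM hg; have [c1 c2 c3] := coord_alg.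
have ev p : coord_ring_M A q p -> A (eval_at (g : 'M[F^o]_n) p).
  by move=> hp; apply: (hp (F^o : comAlgType F)) ug; exact: regular_subalg.
have cD p1 p2 : coord_ring_M A q p1 -> coord_ring_M A q p2 -> coord_ring_M A q (p1 + p2).
  exact: (subring_setD (subalgebra_subring hA coord_alg)).
split.
- move=> p p' hp hp'; rewrite !sp_coord //; last exact: cD.
  by rewrite eval_atD (residueD hpi) //; exact: ev.
- move=> p p' hp hp'; rewrite !sp_coord //; last exact: c3.
  by rewrite eval_atM (residueM hpi) //; exact: ev.
- move=> a Aa; rewrite sp_coord; last exact: c1.
  by rewrite eval_atC in_algE /GRing.scale /= mulr1.
- by move=> p np; rewrite /sp asboolF.
- have hd : coord_ring_M A q (det_poly F n).
    move=> E T hT m [hm _]; rewrite eval_at_det; have rT := subalgebra_subring hA hT.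
    apply: (subring_set_sum rT) => s _; have [_ _ TM] := rT; apply: (TM).
      by apply: (subring_setX rT); apply: (subring_setN rT); case: rT.
    exact: (subring_set_prod rT).
  rewrite sp_coord // eval_at_det; have [Og _] := hg.
  have ud := OV_det_unit hA (tb_unit tb) Og.
  by apply/(residue_unit hA hpi) => //; case: ud.
- move=> p [hp hv]; rewrite sp_coord // (hv (F^o : comAlgType F) A regular_subalg g (Aut_L_uG hg)).
  exact: (residue0 hA hpi).
Qed.

(* The matrix of the linear map Qc, which makes sense over any algebra. *)
Definition QM : 'M[F]_(n * n, u) := lin1_mx (fun v => Qc HB' (vec_mx v)).

Fact Qc_vec_linear : linear (fun v : 'rV[F]_(n * n) => Qc HB' (vec_mx v)).
Proof. by move=> a v w; rewrite linearP QcD QcZ. Qed.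

Lemma QME (Y : 'M[F]_n) : mxvec Y *m QM = Qc HB' Y.
Proof.
rewrite mulmx_sum_row.
have -> : Qc HB' Y = Qc HB' (vec_mx (\sum_i mxvec Y 0 i *: delta_mx 0 i)).
  by rewrite -row_sum_delta mxvecK.
rewrite linear_sum /=.
have QS (s : seq 'I_(n * n)) (v : 'I_(n * n) -> 'M[F]_n) :
    Qc HB' (\sum_(i <- s) v i) = \sum_(i <- s) Qc HB' (v i).
  elim/big_rec2: _ => [|i y1 y2 _ <-]; last by rewrite QcD.
  by rewrite -[0 in LHS](scale0r 0) QcZ scale0r.
rewrite QS; apply: eq_bigr => i _; rewrite linearZ /= QcZ; congr (_ *: _).
by apply/rowP => k; rewrite !mxE.
Qed.

Definition QE (E : comAlgType F) (Y : 'M[E]_n) : 'rV[E]_u := mxvec Y *m map_mx (in_alg E) QM.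

Lemma QE_map (E : comAlgType F) (Y : 'M[F]_n) :
  QE (map_mx (in_alg E) Y) = map_mx (in_alg E) (Qc HB' Y).
Proof. by rewrite /QE -map_mxvec -map_mxM QME. Qed.

Lemma QED (E : comAlgType F) (Y Z : 'M[E]_n) : QE (Y + Z) = QE Y + QE Z.
Proof. by rewrite /QE linearD mulmxDl. Qed.

Lemma QEZ (E : comAlgType F) t (Y : 'M[E]_n) : QE (t *: Y) = t *: QE Y.
Proof. by rewrite /QE linearZ /= scalemxAl. Qed.

Lemma QEDk (E : comAlgType F) (Y Z : 'M[E]_n) k : QE (Y + Z) 0 k = QE Y 0 k + QE Z 0 k.
Proof. by rewrite QED; move: (QE Y) (QE Z) => y z; rewrite mxE. Qed.

Lemma QEZk (E : comAlgType F) t (Y : 'M[E]_n) k : QE (t *: Y) 0 k = t * QE Y 0 k.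
Proof. by rewrite QEZ; move: (QE Y) => y; rewrite mxE. Qed.

Definition defect (E : comAlgType F) (m : 'M[E]_n) : 'M[E]_n :=
  m^T *m map_mx (in_alg E) S *m m - map_mx (in_alg E) S.

Definition Ppoly k : poly := QE (defect (generic_mx F n : 'M[poly : comAlgType F]_n)) 0 k.

Lemma eval_Ppoly (E : comAlgType F) (m : 'M[E]_n) k : eval_at m (Ppoly k) = QE (defect m) 0 k.
Proof.
have -> : QE (defect m) =
    map_mx (eval_at m) (QE (defect (generic_mx F n : 'M[poly : comAlgType F]_n))).
  by rewrite /QE /defect map_mxM map_const_mx map_mxvec map_mxB !map_mxM !map_const_mx
    -map_trmx map_generic_mx.
by rewrite mxE.
Qed.

Section Integrality.
Variables (E : comAlgType F) (T : set E) (hT : is_A_subalgebra A T).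
Local Notation io := (in_alg E).
Local Notation SE := (map_mx io S).

Let TC a : A a -> T (io a). Proof. by case: hT => h _ _; apply: h. Qed.
Let TM x y : T x -> T y -> T (x * y). Proof. by case: hT => _ _ h; apply: h. Qed.
Let T0 : T 0. Proof. exact: subring_set0 (subalgebra_subring hA hT). Qed.
Let TD x y : T x -> T y -> T (x + y).
Proof. exact: (subring_setD (subalgebra_subring hA hT)). Qed.

Let lin (X : 'M[E]_n) := X^T *m SE + SE *m X.
Let pol (X Y : 'M[E]_n) := X^T *m SE *m Y + Y^T *m SE *m X.
Let quad (X : 'M[E]_n) := X^T *m SE *m X.
Let tXE c : 'M[E]_n := map_mx io (tX Bas c).

(** The defect at 1 + X is a linear plus a quadratic expression in X. On the basis of M' these and
    the polar form have integral target coordinates, so a combination with coefficients in T has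
    coordinates in T. *)
Lemma defect_integral (c : 'rV[E]_(d + u)) : (forall k, T (c 0 k)) ->
  forall k, T (QE (defect (1%:M + \sum_i c 0 i *: tXE (delta_mx 0 i))) 0 k).
Proof.
move=> hc k.
have id i : int (delta_mx 0 i : 'rV[F]_(d + u)) by exact: integral_delta.
(* The polar form with each basis matrix is carried along, because it enters the quadratic part when
   the next summand is added. *)
pose good X := [/\ T (QE (lin X) 0 k), T (QE (quad X) 0 k) &
  forall i, T (QE (pol X (tXE (delta_mx 0 i))) 0 k)].
have polD X Y Z : pol (X + Y) Z = pol X Z + pol Y Z.
  rewrite /pol trmxD !mulmxDl mulmxDr; exact: addrACA.
have polZ t X Y : pol (t *: X) Y = t *: pol X Y.
  by rewrite /pol trmxZ -!scalemxAl -scalemxAr scalerDr.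
have polC X Y : pol X Y = pol Y X by rewrite /pol addrC.
have quadD X Y : quad (X + Y) = quad X + pol X Y + quad Y.
  rewrite /quad /pol trmxD !mulmxDl !mulmxDr.
  by rewrite !addrA.
have quadZ t X : quad (t *: X) = t ^+ 2 *: quad X.
  by rewrite /quad trmxZ -!scalemxAl -scalemxAr scalerA expr2.
have linD X Y : lin (X + Y) = lin X + lin Y.
  rewrite /lin trmxD mulmxDl mulmxDr; exact: addrACA.
have linZ t X : lin (t *: X) = t *: lin X.
  by rewrite /lin trmxZ -scalemxAl -scalemxAr scalerDr.
have mE (v : 'rV[F]_u) : int v -> T (map_mx io v 0 k) by move=> iv; rewrite mxE; apply: TC.
have basis i : good (tXE (delta_mx 0 i)).
  split.
  - rewrite /lin /tXE map_trmx -!map_mxM -map_mxD QE_map; apply: mE.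
    by rewrite (Qc_dr tb) => a b; rewrite mxE; apply: id.
  - by rewrite /quad /tXE map_trmx -!map_mxM QE_map; apply: mE; apply: (qX_int tb).
  - move=> j; rewrite /pol /tXE !map_trmx -!map_mxM -map_mxD QE_map; apply: mE.
    exact: (pX_int hA tb).
have goodP : good (\sum_i c 0 i *: tXE (delta_mx 0 i)).
  elim/big_rec: _ => [|i X _ [h1 h2 h3]].
    have z0 Y : Y = 0 *: Y -> T (QE Y 0 k) by move=> ->; rewrite QEZk mul0r.
    split=> [||j]; apply: z0; rewrite scale0r.
    - by rewrite -[0 in LHS](scale0r 0) linZ scale0r.
    - by rewrite -[0 in LHS](scale0r 0) quadZ expr0n scale0r.
    - by rewrite -[X in pol X _](scale0r 0) polZ scale0r.
  have [b1 b2 b3] := basis i; split.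
  - by rewrite linD linZ QEDk QEZk; apply: TD => //; exact: TM.
  - rewrite quadD quadZ polZ polC QEDk QEDk QEZk QEZk; apply: TD => //; apply: TD.
      by apply: TM => //; rewrite expr2; apply: TM.
    by apply: TM.
  - by move=> j; rewrite polD polZ QEDk QEZk; apply: TD => //; apply: TM.
have [g1 g2 _] := goodP; set X := \sum_i _ in g1 g2 *.
have -> : defect (1%:M + X) = lin X + quad X.
  rewrite /defect /lin /quad trmxD trmx1 !mulmxDl !mulmxDr !mul1mx !mulmx1 -!addrA.
  have aux (s b a e : 'M[E]_n) : s + (b + (a + (e - s))) = a + (b + e).
    by rewrite addrC !addrA subrK [b + a]addrC.
  exact: aux.
by rewrite QEDk; apply: TD.
Qed.

End Integrality.

Lemma coE_expand (E : comAlgType F) (m : 'M[E]_n) :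
  m = 1%:M + \sum_i coE m 0 i *: map_mx (in_alg E) (tX Bas (delta_mx 0 i)).
Proof.
apply/eqP; rewrite addrC -subr_eq; apply/eqP; apply: (can_inj mxvecK).
have -> : mxvec (m - 1%:M) = coE m *m map_mx (in_alg E) Bas.
  by rewrite /coE -mulmxA -map_mxM (tb_inv' tb) map_mx1 mulmx1.
rewrite mulmx_sum_row linear_sum /=; apply: eq_bigr => i _; rewrite linearZ /=; congr (_ *: _).
by rewrite -map_mxvec /tX vec_mxK -map_row rowE.
Qed.

(** These are equations of G divided by the powers of 2 of the target lattice. They are still
    regular on M, so a special point kills them, which is sharper than killing the entries of m^T S
    m - S. *)
Lemma Ppoly_ideal k : ideal_G A q (Ppoly k).
Proof.
split=> E T hT m hm; rewrite eval_Ppoly.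
  rewrite (coE_expand m); apply: (defect_integral hT) => i; exact: (proj1 (uME hT m) hm).
have [_ /= e] := hm; rewrite /defect e subrr /QE linear0 mul0mx mxE //.
Qed.

(** Arbitrary lifts of the coordinate values give m in 1 + M' at which evaluation reduces to phi.
    Since phi kills [Ppoly], the defect of m is even in the target lattice, and m can be corrected
    to an automorphism without changing its class. *)
Lemma special_point_Aut phi : is_special_point A q pi phi ->
  exists2 g, Aut_L A S g & forall k, phi (Ypoly k) = pi (co Bas' (g - 1%:M) 0 k).
Proof.
move=> hphi.
have /choice[y hy] : forall k, exists y, A y /\ pi y = phi (Ypoly k).
  by move=> k; have [y Ay ey] := residue_onto hpi (phi (Ypoly k)); exists y.
pose yv : 'rV_(d + u) := \row_k y k.
have iy : int yv by move=> i k; rewrite mxE; case: (hy k).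
pose m := 1%:M + tX Bas yv.
have com : co Bas' (m - 1%:M) = yv by rewrite /m [1%:M + _]addrC addrK (tXK tb).
have hm : forall p, coord_ring_M A q p -> A (eval_at (m : 'M[F^o]_n) p) /\
    phi p = pi (eval_at (m : 'M[F^o]_n) p).
  apply: special_point_eval => //; first by rewrite com.
  by move=> k; rewrite com mxE; case: (hy k).
have [|g hg hgm] := lift_to_Aut_L hA tb iy.
  move=> i k; rewrite (ord1 i); have [hP1 hP2] := Ppoly_ideal k.
  have [Ae ee] := hm _ hP1; move: ee; rewrite (point_ideal hphi (conj hP1 hP2)).
  move/esym/(residue_eq0 hpi Ae); rewrite eval_Ppoly /QE /defect !map_regular QME.
  by [].
exists g => // k; have [Ay <-] := hy k.
apply/(residue_eq hA hpi) => //; first by apply: (tb_aut tb hg).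
have -> : co Bas' (g - 1%:M) 0 k = co Bas' (g - m) 0 k + y k.
  have -> : g - 1%:M = (g - m) + (m - 1%:M) by rewrite addrA subrK.
  by rewrite coD com mxE [yv _ _]mxE.
rewrite opprD addrCA subrr addr0; apply: (dvN hA); exact: hgm.
Qed.

Lemma card_special_points :
  ncard (special_points A q pi) = #|aut_classes A pi (gram q) Bas'|.
Proof.
apply: ncard_eq.
pose ev (phi : poly -> kappa) : {ffun 'I_(d + u) -> kappa} := [ffun k => phi (Ypoly k)].
have inj : {in special_points A q pi &, injective ev}.
  move=> phi phi'; rewrite !inE => h h' /ffunP e; apply: funext => p.
  have [hp|np] := pselect (coord_ring_M A q p); last by rewrite (point_out h) ?(point_out h').
  have [g hg eg] := special_point_Aut h.
  have ig := tb_aut tb hg.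
  have [_ ->] := special_point_eval h ig eg hp.
  have eg' k : phi' (Ypoly k) = pi (co Bas' (g - 1%:M) 0 k).
    by have := e k; rewrite !ffunE => <-.
  by have [_ ->] := special_point_eval h' ig eg' hp.
rewrite card_eq_sym; apply: card_eq_trans (inj_card_eq inj); rewrite card_eq_sym.
have -> : [set ev phi | phi in special_points A q pi] =
    [set` aut_classes A pi (gram q) Bas'].
  apply/seteqP; split=> [_ [phi hphi <-]|c].
    have [g hg eg] := special_point_Aut hphi.
    rewrite /= inE; apply/asboolP; exists g => //.
    by apply/ffunP => k; rewrite !ffunE eg.
  rewrite /= inE => /asboolP[g hg <-]; exists (sp g); first exact: sp_special.
  apply/ffunP => k; rewrite !ffunE sp_coord ?eval_Ypoly ?coE_regular //.
  exact: Ypoly_coord.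
exact: card_finset.
Qed.

End SpecialPoints.

(** * Jordan frames *)

Section QuadraticForms.
Variables (F : fieldType) (two0 : (2 : F) != 0) (n : nat) (q : 'cV[F]_n -> F).
Hypothesis hq : is_quadratic_form q.

Lemma bil_sym x y : bil q x y = bil q y x.
Proof. by rewrite /bil [x + y]addrC addrAC. Qed.

Lemma bilDl x y z : bil q (x + y) z = bil q x z + bil q y z.
Proof. by have := proj2 hq 1 x y z; rewrite scale1r mul1r. Qed.

Lemma bil0l z : bil q 0 z = 0.
Proof. by apply/eqP; rewrite -(inj_eq (addrI (bil q 0 z))) -bilDl !addr0. Qed.

Lemma bilZl a x z : bil q (a *: x) z = a * bil q x z.
Proof. by have := proj2 hq a x 0 z; rewrite addr0 bil0l addr0. Qed.

Lemma bilDr x y z : bil q z (x + y) = bil q z x + bil q z y.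
Proof. by rewrite !(bil_sym z) bilDl. Qed.

Lemma bilZr a x z : bil q z (a *: x) = a * bil q z x.
Proof. by rewrite !(bil_sym z) bilZl. Qed.

Lemma bil0r z : bil q z 0 = 0.
Proof. by rewrite bil_sym bil0l. Qed.

Lemma bilBl x y z : bil q (x - y) z = bil q x z - bil q y z.
Proof. by rewrite bilDl -scaleN1r bilZl mulN1r. Qed.

Lemma bilBr x y z : bil q z (x - y) = bil q z x - bil q z y.
Proof. by rewrite !(bil_sym z) bilBl. Qed.

Lemma bil_suml I (s : seq I) (P : pred I) (v : I -> 'cV[F]_n) z :
  bil q (\sum_(i <- s | P i) v i) z = \sum_(i <- s | P i) bil q (v i) z.
Proof. by elim/big_rec2: _ => [|i a b _ <-]; rewrite ?bil0l ?bilDl. Qed.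

Lemma bil_sumr I (s : seq I) (P : pred I) (v : I -> 'cV[F]_n) z :
  bil q z (\sum_(i <- s | P i) v i) = \sum_(i <- s | P i) bil q z (v i).
Proof. by rewrite bil_sym bil_suml; apply: eq_bigr => i _; rewrite bil_sym. Qed.

Lemma qZ a x : q (a *: x) = a ^+ 2 * q x. Proof. exact: (proj1 hq). Qed.

Lemma bil_xx x : bil q x x = q x.
Proof.
have -> : bil q x x = 2^-1 * (q (2 *: x) - q x - q x).
  by rewrite /bil (_ : 2 *: x = x + x) // -[2]natr1 scalerDl !scale1r.
by rewrite qZ; field.
Qed.

Lemma qD x y : q (x + y) = q x + q y + 2 * bil q x y.
Proof. by rewrite -!bil_xx bilDl !bilDr (bil_sym y x); ring. Qed.

Lemma qB x y : q (x - y) = q x + q y - 2 * bil q x y.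
Proof. by rewrite -!bil_xx bilBl !bilBr (bil_sym y x); ring. Qed.

Lemma bilE x y : bil q x y = (x^T *m gram q *m y) 0 0.
Proof.
have xE (w : 'cV[F]_n) : w = \sum_i w i 0 *: delta_mx i 0.
  rewrite {1}[w]matrix_sum_delta; apply: eq_bigr => i _.
  by rewrite big_ord1.
rewrite {1}[x]xE {1}[y]xE bil_suml mxE; under [RHS]eq_bigr do rewrite mxE mulr_suml.
rewrite exchange_big /=; apply: eq_bigr => i _; rewrite bilZl bil_sumr mulr_sumr.
by apply: eq_bigr => j _; rewrite bilZr !mxE; ring.
Qed.

Lemma gram_sym : (gram q)^T = gram q.
Proof. by apply/matrixP => i j; rewrite !mxE bil_sym. Qed.

Lemma gram_unit : nondegenerate_quad q -> gram q \in unitmx.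
Proof.
move=> hnd; rewrite -row_free_unit -kermx_eq0; apply/rowV0P => v /sub_kermxP h.
apply: trmx_inj; rewrite trmx0; apply: hnd => y.
by rewrite bilE trmxK h mul0mx mxE.
Qed.

Lemma gram_mulmx m p (X : 'M[F]_(n, m)) (Y : 'M[F]_(n, p)) i j :
  (X^T *m gram q *m Y) i j = bil q (col i X) (col j Y).
Proof.
rewrite bilE tr_col -row_mul.
have -> : row i (X^T *m gram q) *m col j Y = col j (row i (X^T *m gram q *m Y)).
  by rewrite !row_mul !colE !mulmxA.
by rewrite !mxE.
Qed.

End QuadraticForms.

(* The columns v_a of P form a basis of L adapted to a Jordan splitting, v_a
   lying in the constituent of index [lev a]; [s] marks one vector for each type I
   constituent, which represents the characteristic vector. *)
Record jordan_frame (F : fieldType) (A : set F) (n : nat) (q : 'cV[F]_n -> F)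
    (P G : 'M[F]_n) (lev : 'I_n -> nat) (s : 'I_n -> bool) : Prop := {
  fr_P : integral_mx A P;
  fr_Pdet : A_unit A (\det P);
  fr_G : integral_mx A G;
  fr_Gdet : A_unit A (\det G);
  fr_block : forall a b, lev a != lev b -> G a b = 0;
  fr_gram : forall a b, bil q (col a P) (col b P) = 2 ^+ lev a * G a b;
  fr_uniq : forall a b, s a -> s b -> lev a = lev b -> a = b;
  fr_char : forall a b, s a -> lev a = lev b -> pow2A A 1 (G b b - G a b ^+ 2);
  fr_even : forall b, (forall a, s a -> lev a != lev b) -> pow2A A 1 (G b b) }.

Section EvenForms.
Variables (F : fieldType) (A : set F) (hA : complete_dvr A).
Local Notation dv := (pow2A A).

(* A function that is additive mod 2 and semilinear for the Frobenius is even
   as soon as it is even on generators. *)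
Lemma even_on_generators (V : lmodType F) (M : set V) (g : V -> F) (I : Type) (t : seq I)
    (v : I -> V) (a : I -> F) :
  M 0 -> (forall x y, M x -> M y -> M (x + y)) -> (forall c x, A c -> M x -> M (c *: x)) ->
  (forall x y, M x -> M y -> dv 1 (g (x + y) - g x - g y)) ->
  (forall c x, g (c *: x) = c ^+ 2 * g x) ->
  (forall i, A (a i)) -> (forall i, M (v i)) -> (forall i, dv 1 (g (v i))) ->
  dv 1 (g (\sum_(i <- t) a i *: v i)).
Proof.
move=> M0 MD MZ gD gZ ha hv hg.
suff [] : M (\sum_(i <- t) a i *: v i) /\ dv 1 (g (\sum_(i <- t) a i *: v i)) by [].
elim: t => [|i t [IH1 IH2]]; first by rewrite big_nil -[X in g X](scale0r 0) gZ expr0n mul0r; split=> //; exact: dv_0.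
have Mi : M (a i *: v i) by apply: MZ.
rewrite big_cons; split; first exact: MD.
set x := a i *: v i in Mi *; set y := \sum_(j <- t) _ in IH1 IH2 *.
have -> : g (x + y) = (g (x + y) - g x - g y) + g x + g y by ring.
apply: (dvD hA) => //; apply: (dvD hA); first exact: gD.
by rewrite /x gZ; apply: (dvMl hA) => //; apply: dvrX.
Qed.

Lemma col_sum_delta n (w : 'cV[F]_n) : w = \sum_i w i 0 *: delta_mx i 0.
Proof. by rewrite {1}[w]matrix_sum_delta; apply: eq_bigr => i _; rewrite big_ord1. Qed.

(** The cross terms of a quadratic form and of the square of a linear form are both even, so the two
    can be compared modulo 2 on unit vectors. *)
Lemma even_quadratic n (G : 'M[F]_n) (c : 'rV[F]_n) (w : 'cV[F]_n) : G^T = G ->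
  integral_mx A G -> integral_mx A c -> integral_mx A w ->
  (forall i, dv 1 (G i i - c 0 i ^+ 2)) ->
  dv 1 ((w^T *m G *m w) 0 0 - (c *m w) 0 0 ^+ 2).
Proof.
move=> sG iG ic iw hd; rewrite [w]col_sum_delta.
pose g (x : 'cV[F]_n) := (x^T *m G *m x) 0 0 - (c *m x) 0 0 ^+ 2.
apply: (even_on_generators (M := integral_mx A (n := 1)) (g := g)).
- exact: integral_0.
- by move=> x y; apply: integral_mxD.
- by move=> a x; apply: integral_mxZ.
- move=> x y ix iy.
  have -> : g (x + y) - g x - g y = 2 * ((x^T *m G *m y) 0 0 - (c *m x) 0 0 * (c *m y) 0 0).
    have e : (y^T *m G *m x) 0 0 = (x^T *m G *m y) 0 0.
      have t (M1 : 'M[F]_1) : M1 0 0 = M1^T 0 0 by rewrite mxE.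
      by rewrite [LHS]t !trmx_mul trmxK sG mulmxA.
    have e1 (M1 M2 : 'M[F]_1) : (M1 + M2) 0 0 = M1 0 0 + M2 0 0 by rewrite mxE.
    by rewrite /g trmxD !mulmxDl !mulmxDr !e1 e; ring.
  rewrite -[2]expr1; apply: (dv_mul); apply: (dvrB hA).
    by apply: (integral_mxM hA) => //; apply: (integral_mxM hA) => //; apply: integral_tr.
  by apply: (dvrM hA); apply: (integral_mxM hA).
- move=> a x; rewrite /g trmxZ -!scalemxAl -!scalemxAr scalerA.
  have e1 b (M1 : 'M[F]_1) : (b *: M1) 0 0 = b * M1 0 0 by rewrite mxE.
  by rewrite !e1; ring.
- by move=> i.
- by move=> i; exact: integral_delta.
- move=> i; rewrite /g trmx_delta -rowE -!colE.
  by have := hd i; rewrite !mxE.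
Qed.

End EvenForms.

Section AdaptedBasis.
Variables (F : fieldType) (A : set F) (hA : complete_dvr A).
Variables (kappa : finFieldType) (pi : F -> kappa) (hpi : is_residue_map A pi).
Local Notation dv := (pow2A A).

(** Frobenius is injective on the field kappa of characteristic 2, hence bijective because kappa is
    finite. *)
Lemma sqrt_mod2 x : A x -> exists2 y, A y & dv 1 (x - y ^+ 2).
Proof.
move=> Ax.
have char2 : 2 = 0 :> kappa.
  have A1 := dvr1 hA; have A2 : A 2 := dvr_nat hA 2.
  have <- : pi 2 = 2 by rewrite -[2]natr1 (residueD hpi) // (residue1 hpi).
  by apply/(residue_ker hpi A2); exists 1; rewrite ?mulr1.
have inj : injective (fun z : kappa => z ^+ 2).
  move=> z w e; apply/eqP; rewrite -subr_eq0 -sqrf_eq0; apply/eqP.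
  have -> : (z - w) ^+ 2 = z ^+ 2 - w ^+ 2 + 2 * (w ^+ 2 - z * w) by ring.
  by rewrite e char2 mul0r subrr addr0.
have [g _ hg] := injF_bij inj; have [y Ay ey] := residue_onto hpi (g (pi x)).
exists y => //; apply/(residue_eq hA hpi) => //; first exact: dvrX.
by rewrite expr2 (residueM hpi) // -expr2 ey hg.
Qed.

Variables (n : nat) (q : 'cV[F]_n -> F).
Hypothesis hq : is_quadratic_form q.

Let two0 := dvr_two_neq0 hA.

(* Replacing one vector of each type I block by the characteristic vector of
   the block. *)
Lemma adapt_basis (P G : 'M[F]_n) (lev : 'I_n -> nat) :
  integral_mx A P -> A_unit A (\det P) -> integral_mx A G -> A_unit A (\det G) ->
  (forall a b, lev a != lev b -> G a b = 0) ->
  (forall a b, bil q (col a P) (col b P) = 2 ^+ lev a * G a b) ->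
  exists P' G' s, jordan_frame A q P' G' lev s /\
    (forall k, (exists2 a, s a & lev a = k) <-> (exists2 b, lev b = k & A_unit A (G b b))).
Proof.
move=> iP dP iG dG bG gP.
have sG : G^T = G.
  apply/matrixP => a b; rewrite mxE.
  have [e|ne] := eqVneq (lev a) (lev b); last by rewrite !bG // eq_sym.
  have := gP b a; rewrite bil_sym gP e.
  by move/(mulfI (expf_neq0 _ two0)).
have /choice[sq hsq] : forall b, exists y, A y /\ dv 1 (G b b - y ^+ 2).
  by move=> b; have [y Ay hy] := sqrt_mod2 (iG b b); exists y.
pose sv : 'cV[F]_n := \col_b sq b.
have isv : integral_mx A sv by move=> i j; rewrite mxE; case: (hsq i).
(* Since [sv] squares to the diagonal of G modulo 2, x^T G x is congruent to (sv^T x)^2 = (c^T G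
   x)^2 for integral x: the parts of c in the blocks represent all their characteristic vectors at
   once. *)
have [c ic Gc] : exists2 c : 'cV[F]_n, integral_mx A c & G *m c = sv.
  exists (invmx G *m sv).
    by apply: (integral_mxM hA) => //; exact: (integral_invmx hA iG dG).
  by rewrite mulmxA mulmxV ?mul1mx //; exact: (det_unit_unitmx dG).
pose odd k := `[< exists2 b, lev b = k & A_unit A (G b b) >].
(* A unit coordinate of c is chosen, so that exchanging this frame vector for the characteristic
   vector keeps a basis. *)
pose cho k := if odd k then [pick a | (lev a == k) && `[< A_unit A (c a 0) >]] else None.
pose s a := cho (lev a) == Some a.
have sP a : s a -> odd (lev a) /\ A_unit A (c a 0).
  rewrite /s /cho; case: ifP => // ho; case: pickP => // x /andP[_ /asboolP ux] /eqP[<-].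
  by split.
have oddP k : odd k -> exists2 a, s a & lev a = k.
  move=> ho; have [b eb ub] := asboolP _ ho.
  case ec : (cho k) => [x|].
    have lx : lev x = k by move: ec; rewrite /cho ho; case: pickP => // y /andP[/eqP ly _] [<-].
    by exists x; rewrite // /s lx ec.
  (* If c had no unit coordinate at this level, then sv_b = (G c)_b would be even and so would G_bb,
     which is congruent to its square. *)
  have nx x : lev x = k -> ~ A_unit A (c x 0).
    move=> ex ux; move: ec; rewrite /cho ho; case: pickP => // /(_ x).
    by rewrite ex eqxx /= asboolT.
  have [Ay hy] := hsq b; exfalso; apply: (unit_ndv hA ub).
  rewrite -[G b b](subrK (sq b ^+ 2)); apply: (dvD hA) => //.
  rewrite expr2; apply: (dvMl hA) => //.
  have := congr1 (fun M : 'cV_n => M b 0) Gc; rewrite !mxE => <-.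
  apply: (dv_sum hA) => x _; have [e|ne] := eqVneq (lev b) (lev x); last first.
    by rewrite bG // mul0r; exact: dv_0.
  apply: (dvMl hA) => //; apply: contrapT => nd; apply: (nx x); first by rewrite -e.
  exact: (nonunit_dv hA).
have uniq a b : s a -> s b -> lev a = lev b -> a = b.
  by rewrite /s => /eqP ea /eqP eb e; move: eb; rewrite -e ea => -[].
(* 1 + N replaces each chosen column by the part of c at its level. Column b of N is c_b times that
   of E, and each level has only one nonzero column of N; this makes 1 - E the inverse of 1 + N. *)
pose N : 'M[F]_n := \matrix_(a, b) (if s b then (lev a == lev b)%:R * c a 0 - (a == b)%:R else 0).
pose E : 'M[F]_n := \matrix_(a, b) (if s b then N a b / c b 0 else 0).
have iN : integral_mx A N.
  move=> a b; rewrite mxE; case: ifP => _; last exact: dvr0.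
  apply: (dvrB hA); last exact: dvr_nat.
  by apply: (dvrM hA) => //; exact: dvr_nat.
have iE : integral_mx A E.
  move=> a b; rewrite mxE; case: ifP => sb; last exact: dvr0.
  by apply: (dvrM hA); [exact: iN | have [_ []] := sP _ sb].
pose C := 1%:M + N; have iC : integral_mx A C by apply: (integral_mxD hA) => //; exact: integral_1.
have CE : C *m (1%:M - E) = 1%:M.
  have NE : N *m E = N - E.
    apply/matrixP => a b; rewrite !mxE.
    case: (boolP (s b)) => sb; last first.
      rewrite subrr big1 // => x _; by rewrite [E x b]mxE (negPf sb) mulr0.
    have [_ [cb0 _ _]] := sP _ sb.
    rewrite (bigD1 b) //= big1 ?addr0 => [|x xb].
      have key (x y : F) : y != 0 -> x * ((y - 1) / y) = x - x / y by move=> y0; field.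
      by rewrite [E b b]mxE sb [N b b]mxE sb !eqxx /= mulr1n mul1r [N a b]mxE sb key.
    rewrite [E x b]mxE sb [N x b]mxE sb (negPf xb) subr0.
    case: (boolP (s x)) => sx; last by rewrite [N a x]mxE (negPf sx) mul0r.
    have [e|ne] := eqVneq (lev x) (lev b); last by rewrite !(mul0r, mulr0).
    by move: xb; rewrite (uniq _ _ sx sb e) eqxx.
  rewrite /C mulmxBr mulmx1 mulmxDl mul1mx NE.
  by apply/matrixP => a b; rewrite !mxE; ring.
have dC : A_unit A (\det C).
  apply: (integral_mulmx1_det hA iC _ CE); apply: (integral_mxB hA) => //; exact: integral_1.
have colC b : s b -> col b C = \col_a ((lev a == lev b)%:R * c a 0).
  by move=> sb; apply/colP => a; rewrite !mxE sb; ring.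
have Csupp a b : lev a != lev b -> C a b = 0.
  move=> ne; rewrite !mxE (negPf ne) mul0r.
  have -> : (a == b) = false by apply: contraNF ne => /eqP ->.
  by rewrite subr0; case: ifP; rewrite addr0.
pose G' := C^T *m G *m C.
have iG' : integral_mx A G'.
  by apply: (integral_mxM hA) => //; apply: (integral_mxM hA) => //; apply: integral_tr.
have G'E a b : G' a b = ((col a C)^T *m G *m col b C) 0 0.
  rewrite /G' tr_col -row_mul.
  have -> : row a (C^T *m G) *m col b C = col b (row a (C^T *m G *m C)).
    by rewrite !row_mul !colE !mulmxA.
  by rewrite !mxE.
have parity b : dv 1 (G' b b - (sv^T *m col b C) 0 0 ^+ 2).
  rewrite G'E; apply: (even_quadratic hA) => //.
  - exact: integral_tr.
  - by move=> i j; rewrite mxE; apply: iC.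
  - by move=> i; rewrite !mxE; case: (hsq i).
have G'block a b : lev a != lev b -> G' a b = 0.
  move=> ne; rewrite mxE big1 // => y _; rewrite mxE mulr_suml big1 // => x _.
  rewrite mxE; have [ex|nx] := eqVneq (lev x) (lev a); last by rewrite Csupp // !mul0r.
  have [ey|ny] := eqVneq (lev y) (lev b); last by rewrite (Csupp y) // mulr0.
  by rewrite bG ?mulr0 ?mul0r // ex ey.
exists (P *m C), G', s; split.
- split=> //.
  + exact: (integral_mxM hA).
  + exact: (det_unit_mul hA dP dC).
  + by rewrite !det_mulmx det_tr; apply: (unitM hA) => //; apply: (unitM hA).
  + move=> a b; rewrite -gram_mulmx // trmx_mul.
    have -> : C^T *m P^T *m gram q *m (P *m C) = C^T *m (P^T *m gram q *m P) *m C by rewrite !mulmxA.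
    rewrite mxE [X in _ = _ * X]mxE mulr_sumr; apply: eq_bigr => y _.
    rewrite mulrA; congr (_ * _); rewrite mxE [X in _ = _ * X]mxE mulr_sumr.
    apply: eq_bigr => x _; rewrite [C^T a x]mxE gram_mulmx // gP.
    have [ex|nx] := eqVneq (lev x) (lev a); first by rewrite ex; ring.
    by rewrite Csupp // !(mul0r, mulr0).
  + move=> a b sa e.
    (* Column a of C is the part of c at this level, and G c = sv. *)
    suff -> : G' a b = (sv^T *m col b C) 0 0 by exact: parity.
    rewrite G'E colC // -Gc trmx_mul sG [LHS]mxE [RHS]mxE; apply: eq_bigr => y _.
    have [ey|ny] := eqVneq (lev y) (lev b); last by rewrite [col b C y 0]mxE Csupp // !mulr0.
    congr (_ * _); rewrite [LHS]mxE [RHS]mxE; apply: eq_bigr => x _; rewrite !mxE.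
    have [ex|nx] := eqVneq (lev x) (lev a); first by rewrite mul1r.
    by rewrite bG ?mulr0 // ey -e.
  + move=> b hb; rewrite -[G' b b](subrK ((sv^T *m col b C) 0 0 ^+ 2)).
    apply: (dvD hA); first exact: parity.
    suff h : dv 1 ((sv^T *m col b C) 0 0).
      by rewrite expr2; apply: (dvMl hA) => //; exact: (dv_int hA h).
    rewrite mxE; apply: (dv_sum hA) => x _; rewrite [col b C x 0]mxE.
    have [ex|nx] := eqVneq (lev x) (lev b); last by rewrite Csupp // mulr0; exact: dv_0.
    apply: (dvMr hA); first exact: iC.
    rewrite !mxE; have [Ay hy] := hsq x; apply: (dv1_sqr hA) => //.
    have -> : sq x ^+ 2 = G x x - (G x x - sq x ^+ 2) by ring.
    apply: (dvB hA) => //; apply: contrapT => nd.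
    have ho : odd (lev b) by apply/asboolP; exists x => //; exact: (nonunit_dv hA).
    by have [a sa ea] := oddP _ ho; have := hb a sa; rewrite ea eqxx.
- move=> k; split=> [[a sa <-]|h]; last by apply: oddP; exact/asboolP.
  by have [/asboolP] := sP _ sa.
Qed.

End AdaptedBasis.

Section JordanBasis.
Import tagnat.

(** The bases of the constituents are concatenated in a block matrix, whose size is the sum n' of
    the ranks; that n' = n has to be proved before the columns can be indexed by ['I_n]. *)
Lemma jordan_basis (F : fieldType) (A : set F) (hA : complete_dvr A) (n : nat)
    (q : 'cV[F]_n -> F) (hq : is_quadratic_form q)
    (r : nat) (ni : nat -> nat) (J : forall i, 'M[F]_(n, ni i))
    (hJ : is_jordan_splitting A q r J) :
  exists P G : 'M[F]_n, exists lev : 'I_n -> nat,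
  [/\ integral_mx A P, A_unit A (\det P), integral_mx A G & A_unit A (\det G)] /\
  [/\ forall a b, lev a != lev b -> G a b = 0,
      forall a b, bil q (col a P) (col b P) = 2 ^+ lev a * G a b,
      forall k, #|[pred a | lev a == k]| = ni k,
      forall a, (lev a < r)%N
    & forall k, type_I A q J k <-> exists2 b, lev b = k & A_unit A (G b b)].
Proof.
have two0 := dvr_two_neq0 hA.
have [G_ G_P] : exists G_ : forall i, 'M[F]_(ni i), forall i,
    [/\ integral_mx A (G_ i), A_unit A (\det (G_ i))
      & forall k l, bil q (col k (J i)) (col l (J i)) = 2 ^+ i * G_ i k l].
  exists (fun i => projT1 (cid (jordan_modular hJ i))) => i.
  exact: (projT2 (cid (jordan_modular hJ i))).
pose n' := (\sum_(k < r) ni k)%N.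
pose Pm : 'M[F]_(n, n') := \mxrow_(k < r) J k.
pose Gm : 'M[F]_n' := \mxdiag_(k < r) G_ k.
pose Hm : 'M[F]_n' := \mxdiag_(k < r) invmx (G_ k).
have conJ i (x : 'I_(ni i)) : constituent A J i (col x (J i)).
  by exists (delta_mx x 0); [exact: integral_delta | rewrite colE].
have con0 i : constituent A J i 0.
  by exists 0; [exact: integral_0 | rewrite mulmx0].
have gP a b : bil q (col a Pm) (col b Pm) = 2 ^+ sig1 a * Gm a b.
  rewrite !col_mxrow mxE.
  move: (sig1 a) (sig2 a) (sig1 b) (sig2 b) => k x l y.
  case: eqVneq => [e|ne]; last first.
    rewrite mxE mulr0; apply: (jordan_orthogonal hJ) (conJ _ _) (conJ _ _).
    by move/val_inj/eqP; rewrite (negPf ne).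
  by case: l / e y => y; rewrite conform_mx_id; case: (G_P k).
have bG a b : sig1 a != sig1 b -> Gm a b = 0.
  by rewrite mxE => /negPf ->; rewrite mxE.
have diag_int (B : forall k : 'I_r, 'M[F]_(ni k)) :
    (forall k, integral_mx A (B k)) -> integral_mx A (\mxdiag_(k < r) B k).
  move=> iB a b; rewrite mxE; move: (sig1 a) (sig2 a) (sig1 b) (sig2 b) => k x l y.
  case: eqVneq => [e|ne]; last by rewrite mxE; exact: dvr0.
  by case: l / e y => y; rewrite conform_mx_id; exact: (iB k).
have iG : integral_mx A Gm by apply: diag_int => k; case: (G_P k).
have iH : integral_mx A Hm.
  by apply: diag_int => k; case: (G_P k) => i1 i2 _; exact: (integral_invmx hA).
have GH : Gm *m Hm = 1%:M.
  rewrite /Hm {1}/mxdiag /Gm mul_mxdiag_mxblock -mxdiagZ /mxdiag.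
  apply: eq_mxblock => k l; case: eqVneq => [e|ne]; last by rewrite mulmx0.
  case: l / e; rewrite !conform_mx_id mulmxV //.
  by apply: (det_unit_unitmx (A := A)); case: (G_P k).
have iP : integral_mx A Pm.
  move=> i a; have -> : Pm i a = col a Pm i 0 by rewrite [RHS]mxE.
  have : lattice_L A (col a Pm).
    apply/(jordan_sum hJ).
    exists (fun k => if k == sig1 a :> nat then col a Pm else 0).
      move=> k; case: eqP => [->|_]; last exact: con0.
      by rewrite col_mxrow; exact: conJ.
    rewrite (bigD1 (sig1 a)) //= eqxx big1 ?addr0 // => k /negPf ne.
    by rewrite val_eqE ne.
  by move=> /(_ i 0).
have [C iC PC] : exists2 C : 'M[F]_(n', n), integral_mx A C & Pm *m C = 1%:M.
  have /choice[c hc] : forall j : 'I_n, exists c : forall k : 'I_r, 'cV[F]_(ni k),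
      (forall k, integral_mx A (c k)) /\ delta_mx j 0 = \sum_(k < r) J k *m c k :> 'cV_n.
    move=> j; have [y hy ey] := proj1 (jordan_sum hJ (delta_mx j 0)) (integral_delta hA _ _).
    pose w (k : 'I_r) := cid2 (hy k).
    exists (fun k => s2val (w k)); split=> [k|]; first exact: (s2valP (w k)).
    by rewrite ey; apply: eq_bigr => k _; exact: esym (s2valP' (w k)).
  exists (\mxcol_(k < r) (\matrix_(x, j) c j k x 0)).
    by move=> a j; rewrite !mxE; case: (hc j) => + _; apply.
  rewrite mul_mxrow_mxcol; apply/matrixP => i j; rewrite summxE.
  have [_ /(congr1 (fun v : 'cV_n => v i 0))] := hc j.
  rewrite summxE !mxE eqxx andbT => ->; apply: eq_bigr => k _.
  by rewrite !mxE; apply: eq_bigr => x _; rewrite mxE.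
(* The matrix has a right inverse because the constituents span L, and a left inverse because its
   Gram matrix is invertible. *)
have en : n' = n.
  apply/eqP; rewrite eqn_leq (mulmx1_min PC) andbT.
  pose D : 'M[F]_n' := diag_mx (\row_a (2 ^+ sig1 a)^-1).
  apply: (@mulmx1_min _ _ _ (Hm *m D *m (Pm^T *m gram q)) Pm).
  have -> : Hm *m D *m (Pm^T *m gram q) *m Pm = Hm *m (D *m (Pm^T *m gram q *m Pm)).
    by rewrite !mulmxA.
  have -> : D *m (Pm^T *m gram q *m Pm) = Gm.
    apply/matrixP => a b; rewrite mul_diag_mx mxE gram_mulmx // gP mxE mulrA mulVf ?mul1r //.
    exact: expf_neq0.
  exact: mulmx1C GH.
pose Rk (k : 'I_r) (x : 'I_(ni k)) : 'I_n' := @Rank r (fun k => ni k) k x.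
have colR (k : 'I_r) (x : 'I_(ni k)) : col (Rk k x) Pm = col x (J k).
  by apply/colP => i; have /matrixP/(_ i x) := mxrowK (fun k : 'I_r => J k) k; rewrite !mxE.
have count k : #|[pred a : 'I_n' | sig1 a == k :> nat]| = ni k.
  case: (ltnP k r) => [kr|rk]; last first.
    rewrite (jordan_bound hJ rk); apply: eq_card0 => a.
    by rewrite !inE; apply/negP => /eqP e; have := ltn_ord (sig1 a); rewrite e ltnNge rk.
  rewrite -[RHS]card_ord -(card_imset (f := Rk (Ordinal kr))); last first.
    by move=> x y /(can_inj rankK)/eqP; rewrite eq_Tagged => /eqP.
  apply: eq_card => a; rewrite !inE; apply/eqP/imsetP => [e|[x _ ->]]; last by rewrite Rank1K.
  have e' : sig1 a = Ordinal kr by apply: val_inj.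
  by have := sig2K a; move: (sig2 a); rewrite e' => x <-; exists x.
have typ k : type_I A q J k <-> exists2 b : 'I_n', sig1 b = k :> nat & A_unit A (Gm b b).
  split=> [/asboolP[x [c ic <-] ux]|[b <- ub]]; last first.
    apply/asboolP; exists (col b Pm); first by rewrite col_mxrow; exact: conJ.
    by rewrite /qi -bil_xx // gP mulKf // expf_neq0.
  have [iGk _ gk] := G_P k.
  (* With all diagonal entries of G_k even, 2^-k q would take only even values on L_k. *)
  have [x0 ux0] : exists x0, A_unit A (G_ k x0 x0).
    apply: contrapT => nex; apply: (unit_ndv hA ux).
    have sGk : (G_ k)^T = G_ k.
      apply/matrixP => a b; rewrite mxE; apply: (mulfI (expf_neq0 k two0)).
      by rewrite -!gk bil_sym.
    have -> : qi q k (J k *m c) = (c^T *m G_ k *m c) 0 0 - ((0 : 'rV_(ni k)) *m c) 0 0 ^+ 2.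
      rewrite mul0mx [X in _ - X ^+ 2]mxE expr0n subr0 /qi -bil_xx // bilE // trmx_mul.
      have -> : c^T *m (J k)^T *m gram q *m (J k *m c) = c^T *m ((J k)^T *m gram q *m J k) *m c.
        by rewrite !mulmxA.
      have -> : (J k)^T *m gram q *m J k = 2 ^+ k *: G_ k.
        by apply/matrixP => a b; rewrite gram_mulmx // gk mxE.
      by rewrite -scalemxAr -scalemxAl mxE mulKf // expf_neq0.
    apply: (even_quadratic hA) => //; first exact: integral_0.
    move=> i; rewrite mxE expr0n subr0; apply: contrapT => nd.
    by apply: nex; exists i; exact: (nonunit_dv hA).
  have kr : (k < r)%N.
    rewrite ltnNge; apply/negP => /(jordan_bound hJ) e.
    by case: x0 {ux0} => x0; rewrite e.
  exists (Rk (Ordinal kr) x0); first by rewrite Rank1K.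
  suff -> : Gm (Rk (Ordinal kr) x0) (Rk (Ordinal kr) x0) = G_ k x0 x0 by [].
  apply: (mulfI (expf_neq0 k two0)); rewrite -gk -(colR (Ordinal kr) x0).
  by rewrite gP Rank1K.
have dG : A_unit A (\det Gm) by exact: (integral_mulmx1_det hA iG iH GH).
(* Stated for a variable size m, so that the equation n' = n can be eliminated by substitution. *)
have final m (e : m = n) (P : 'M[F]_(n, m)) (G : 'M[F]_m) (lev : 'I_m -> nat) (D : 'M[F]_(m, n)) :
    integral_mx A P -> integral_mx A G -> A_unit A (\det G) -> integral_mx A D -> P *m D = 1%:M ->
    (forall a b, lev a != lev b -> G a b = 0) ->
    (forall a b, bil q (col a P) (col b P) = 2 ^+ lev a * G a b) ->
    (forall k, #|[pred a | lev a == k]| = ni k) -> (forall a, (lev a < r)%N) ->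
    (forall k, type_I A q J k <-> exists2 b, lev b = k & A_unit A (G b b)) ->
    exists P G : 'M[F]_n, exists lev : 'I_n -> nat,
  [/\ integral_mx A P, A_unit A (\det P), integral_mx A G & A_unit A (\det G)] /\
  [/\ forall a b, lev a != lev b -> G a b = 0,
      forall a b, bil q (col a P) (col b P) = 2 ^+ lev a * G a b,
      forall k, #|[pred a | lev a == k]| = ni k,
      forall a, (lev a < r)%N
    & forall k, type_I A q J k <-> exists2 b, lev b = k & A_unit A (G b b)].
  subst m => iP' iG' dG' iD PD *; exists P, G, lev; split; split=> //.
  exact: (integral_mulmx1_det hA iP' iD).
by apply: (final n' en Pm Gm (fun a => sig1 a) C) => // a.
Qed.

End JordanBasis.

(** * The lattices A, B, W, X, Y, Z in a frame *)

Section FrameLattices.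
Variables (F : fieldType) (A : set F) (hA : complete_dvr A) (n : nat) (q : 'cV[F]_n -> F).
Hypothesis hq : is_quadratic_form q.
Variables (P G : 'M[F]_n) (lev : 'I_n -> nat) (s : 'I_n -> bool).
Hypothesis fr : jordan_frame A q P G lev s.
Local Notation dv := (pow2A A).
Let two0 := dvr_two_neq0 hA.
Let twoX0 k : (2 : F) ^+ k != 0. Proof. exact: expf_neq0. Qed.
Let Pu : P \in unitmx. Proof. exact: det_unit_unitmx (fr_Pdet fr). Qed.
Let Gu : G \in unitmx. Proof. exact: det_unit_unitmx (fr_Gdet fr). Qed.

(** These are G times the coordinates in the frame ([dual_coordE]). As G is unimodular and block
    diagonal along the levels, divisibility by powers of 2 depending only on the level means the
    same for both. *)
Definition dual_coord (b : 'I_n) (x : 'cV[F]_n) : F :=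
  (2 ^+ lev b)^-1 * bil q (col b P) x.
Local Notation yc := dual_coord.

Lemma dual_coordD b x y : yc b (x + y) = yc b x + yc b y.
Proof. by rewrite /yc bilDr // mulrDr. Qed.

Lemma dual_coordZ b a x : yc b (a *: x) = a * yc b x.
Proof. by rewrite /yc bilZr // mulrCA. Qed.

Lemma dual_coord0 b : yc b 0 = 0.
Proof. by rewrite /yc bil0r // mulr0. Qed.

Lemma dual_coord_sum b I (t : seq I) (Q : pred I) (v : I -> 'cV[F]_n) :
  yc b (\sum_(i <- t | Q i) v i) = \sum_(i <- t | Q i) yc b (v i).
Proof. by rewrite /yc bil_sumr // mulr_sumr. Qed.

Lemma bil_frame b x : bil q (col b P) x = 2 ^+ lev b * yc b x.
Proof. by rewrite /yc mulVKf. Qed.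

Lemma dual_coord_frame b a : yc b (col a P) = G b a.
Proof. by rewrite /yc (fr_gram fr) mulKf. Qed.

Lemma frame_expansion x : x = \sum_a (invmx P *m x) a 0 *: col a P.
Proof.
rewrite -[LHS](mulKVmx Pu); apply/colP => i; rewrite mxE summxE.
by apply: eq_bigr => a _; rewrite [RHS]mxE [col a P i 0]mxE mulrC.
Qed.

Lemma dual_coordE x : \col_b yc b x = G *m invmx P *m x.
Proof.
apply/colP => b; rewrite mxE {1}[x]frame_expansion dual_coord_sum -mulmxA mxE.
by apply: eq_bigr => a _; rewrite dual_coordZ dual_coord_frame mulrC.
Qed.

(** G commutes with the projector D onto one level, hence so does its inverse. *)
Lemma invmx_block a b : lev a != lev b -> invmx G a b = 0.
Proof.
move=> ne; pose D : 'M[F]_n := diag_mx (\row_i (lev i == lev a)%:R).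
have GD : G *m D = D *m G.
  apply/matrixP => i j; rewrite mul_mx_diag mul_diag_mx !mxE.
  have [->|ne'] := eqVneq (lev i) (lev j); first by rewrite mulrC.
  by rewrite (fr_block fr) // mul0r mulr0.
have /matrixP/(_ a b) : invmx G *m D = D *m invmx G.
  by rewrite -[RHS](mulKmx Gu) (mulmxA G) GD -!mulmxA mulmxV ?mulmx1.
by rewrite mul_mx_diag mul_diag_mx !mxE eqxx mul1r eq_sym (negPf ne) mulr0.
Qed.

(* The lattice spanned by the vectors [2 ^+ kf (lev a) *: col a P]. *)
Definition frame_lat (kf : nat -> nat) : set 'cV[F]_n :=
  [set x | forall b, dv (kf (lev b)) (yc b x)].

Lemma frame_latD kf x y : frame_lat kf x -> frame_lat kf y -> frame_lat kf (x + y).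
Proof. by move=> hx hy b; rewrite dual_coordD; apply: (dvD hA). Qed.

Lemma frame_lat0 kf : frame_lat kf 0.
Proof. by move=> b; rewrite dual_coord0; apply: dv_0. Qed.

Lemma frame_latZ kf a x : A a -> frame_lat kf x -> frame_lat kf (a *: x).
Proof. by move=> Aa hx b; rewrite dual_coordZ; apply: (dvMl hA). Qed.

Lemma frame_lat_gen kf a : frame_lat kf (2 ^+ kf (lev a) *: col a P).
Proof.
move=> b; rewrite dual_coordZ dual_coord_frame.
have [e|ne] := eqVneq (lev b) (lev a); last by rewrite (fr_block fr) // mulr0; apply: dv_0.
by rewrite e; apply: dv_mul; exact: (fr_G fr).
Qed.

Lemma frame_lat_coord kf x a : frame_lat kf x -> dv (kf (lev a)) ((invmx P *m x) a 0).
Proof.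
move=> hx; have -> : invmx P *m x = invmx G *m (\col_b yc b x).
  by rewrite dual_coordE -[G *m _ *m _]mulmxA mulKmx.
rewrite mxE; apply: (dv_sum hA) => b _; rewrite mxE.
have [e|ne] := eqVneq (lev a) (lev b); last by rewrite invmx_block // mul0r; apply: dv_0.
rewrite e; apply: (dvMl hA) => //.
exact: (integral_invmx hA (fr_G fr) (fr_Gdet fr)).
Qed.

Lemma frame_lat_span kf x : frame_lat kf x -> exists2 c : 'I_n -> F,
  (forall a, A (c a)) & x = \sum_a c a *: (2 ^+ kf (lev a) *: col a P).
Proof.
move=> hx; exists (fun a => (invmx P *m x) a 0 / 2 ^+ kf (lev a)).
  by move=> a; apply/(dvE hA); exact: frame_lat_coord.
by rewrite {1}[x]frame_expansion; apply: eq_bigr => a _; rewrite scalerA divfK.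
Qed.

Lemma frame_latL x : lattice_L A x <-> frame_lat (fun=> 0%N) x.
Proof.
split=> [hx b|hx].
  apply/(dv0E hA); have -> : yc b x = (G *m invmx P *m x) b 0 by rewrite -dual_coordE [RHS]mxE.
  apply: (integral_mxM hA) => //.
  by apply: (integral_mxM hA); [exact: fr_G fr | exact: (integral_invmx hA (fr_P fr) (fr_Pdet fr))].
move=> i j; have [c hc ->] := frame_lat_span hx; rewrite summxE; apply: (dvr_sum hA) => a _.
rewrite expr0 scale1r !mxE; apply: (dvrM hA) => //; exact: (fr_P fr).
Qed.

(** The subtraction is truncated: levels l >= i impose integrality only. *)
Lemma latAE i : latA A q i = frame_lat (fun l => i - l)%N.
Proof.
apply/seteqP; split=> x.
  case=> /frame_latL hx hd b; have [lb|lb] := leqP i (lev b).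
    by rewrite (eqP lb); exact: hx.
  apply/(dv_shift hA (lev b)); rewrite subnKC ?(ltnW lb) // -bil_frame bil_sym.
  by apply: hd => k j; rewrite mxE; apply: fr_P fr _ _.
move=> hx; split; first by apply/frame_latL => b; exact: (dv_le hA (leq0n _) (hx b)).
move=> y /frame_latL/frame_lat_span[c hc ->].
rewrite bil_sumr //; apply: (dv_sum hA) => a _.
rewrite expr0 scale1r bilZr // bil_sym bil_frame; apply: (dvMl hA) => //.
apply: (@dv_le _ _ hA _ (lev a + (i - lev a))); first by rewrite -leq_subLR.
exact/(dv_shift hA).
Qed.

Lemma latA_gen i a : latA A q i (2 ^+ (i - lev a) *: col a P).
Proof. by rewrite latAE; exact: (frame_lat_gen (fun l => i - l)%N). Qed.

Lemma latA_frame a : latA A q (lev a) (col a P).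
Proof. by have := latA_gen (lev a) a; rewrite subnn scale1r. Qed.

Lemma bili_int i x y : latA A q i x -> latA A q i y -> A (bili q i x y).
Proof.
move=> [_ hx] [Ly _]; have := hx y Ly.
by move=> /(dvE hA); rewrite mulrC.
Qed.

Lemma bili_gen i a x : (i <= lev a)%N -> bili q i x (col a P) = 2 ^+ (lev a - i) * yc a x.
Proof.
move=> ia; rewrite /bili bil_sym bil_frame mulrA; congr (_ * _).
by apply: (mulfI (twoX0 i)); rewrite mulVKf // -exprD subnKC.
Qed.

(** Modulo 2, b_i sees only level i: the generators 2^(i - l) v_a of lower levels and v_a of higher
    levels pair evenly with A_i, while at level i the Gram matrix is unimodular. *)
Lemma latXE i : latX A q i = frame_lat (fun l => i - l + (l == i))%N.
Proof.
apply/seteqP; split=> x.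
  case=> Ax hd b; have [e|ne] := eqVneq (lev b) i; last first.
    by rewrite addn0; move: Ax; rewrite latAE.
  have := hd (col b P); rewrite -{1}e => /(_ (latA_frame b)).
  by rewrite bili_gen ?e // subnn mul1r.
move=> hx; split; first by rewrite latAE => b; apply: (dv_le hA _ (hx b)); exact: leq_addr.
move=> y; rewrite latAE => /frame_lat_span[c hc ->].
rewrite /bili bil_sumr // mulr_sumr; apply: (dv_sum hA) => a _.
rewrite bilZr // mulrCA; apply: (dvMl hA) => //.
have /(dv_shift hA (lev a)) := hx a; rewrite -bil_frame bil_sym.
have := hx a; case: ltngtP => la; rewrite ?addn0 => h _; rewrite bilZr // bil_sym bil_frame.
- apply: (@dv_le _ _ hA _ (i - lev a)); first by rewrite subn_gt0.
  suff -> : (2 ^+ i)^-1 * (2 ^+ (i - lev a) * (2 ^+ lev a * yc a x)) = yc a x by [].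
  by rewrite (mulrA (_ ^+ (_ - _))) -exprD subnK ?(ltnW la) // mulKf.
- rewrite (eqP (ltnW la)) expr0 mul1r -{1}(subnKC (ltnW la)) exprD -mulrA mulKf //.
  apply: (@dv_le _ _ hA _ (lev a - i)); first by rewrite subn_gt0.
  by apply: dv_mul; exact: (dv_int hA h).
- by move: h; rewrite -la subnn expr0 mul1r mulKf.
Qed.

Lemma latX_latA i x : latX A q i x -> latA A q i x.
Proof. by case. Qed.

Lemma special_sum (Q : pred nat) (g : 'I_n -> F) : (forall l l', Q l -> Q l' -> l = l') ->
  (exists b, [/\ s b, Q (lev b) & \sum_(b | s b && Q (lev b)) g b = g b]) \/
  ((forall b, s b -> ~~ Q (lev b)) /\ \sum_(b | s b && Q (lev b)) g b = 0).
Proof.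
move=> Qu; case: (pickP (fun b => s b && Q (lev b))) => [b /andP[sb Qb]|no]; last first.
  right; split=> [b sb|]; last by rewrite big_pred0.
  by have := no b; rewrite sb /= => ->.
left; exists b; split=> //; rewrite (big_pred1 b) // => c.
apply/andP/eqP => [[sc Qc]|-> //]; apply: (fr_uniq fr) => //; exact: Qu.
Qed.

(** For Q selecting one level i this is 2^-i times the pairing with the characteristic vector. As a
    sum it is linear, and it vanishes without case distinction when the level has no special
    vector. *)
Definition special_coord (Q : pred nat) (x : 'cV[F]_n) : F :=
  \sum_(b | s b && Q (lev b)) yc b x.
Local Notation sc := special_coord.

Lemma special_coordD Q x y : sc Q (x + y) = sc Q x + sc Q y.
Proof. by rewrite -big_split; apply: eq_bigr => b _; rewrite dual_coordD. Qed.

Lemma special_coordZ Q a x : sc Q (a *: x) = a * sc Q x.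
Proof. by rewrite mulr_sumr; apply: eq_bigr => b _; rewrite dual_coordZ. Qed.

Lemma frame_quadratic kf i (lam : 'cV[F]_n -> F) :
  (forall x y, lam (x + y) = lam x + lam y) -> (forall c x, lam (c *: x) = c * lam x) ->
  (forall x, frame_lat kf x -> A (lam x)) ->
  (forall x y, frame_lat kf x -> frame_lat kf y -> A (bili q i x y)) ->
  (forall a, dv 1 (qi q i (2 ^+ kf (lev a) *: col a P) - lam (2 ^+ kf (lev a) *: col a P) ^+ 2)) ->
  forall x, frame_lat kf x -> dv 1 (qi q i x - lam x ^+ 2).
Proof.
move=> lD lZ ilam ib hg x /frame_lat_span[c hc ->].
apply: (even_on_generators hA (M := frame_lat kf) (g := fun x => qi q i x - lam x ^+ 2)) => //.
- exact: frame_lat0.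
- exact: frame_latD.
- by move=> a y; exact: frame_latZ.
- move=> y z hy hz; rewrite lD /qi qD //.
  have -> : 2 ^- i * (q y + q z + 2 * bil q y z) - (lam y + lam z) ^+ 2 -
      (2 ^- i * q y - lam y ^+ 2) - (2 ^- i * q z - lam z ^+ 2) =
      2 * (bili q i y z - lam y * lam z) by rewrite /bili; ring.
  rewrite -[2]expr1; apply: dv_mul; apply: (dvrB hA); first exact: ib.
  by apply: (dvrM hA); exact: ilam.
- by move=> a y; rewrite lZ /qi qZ //; ring.
- by move=> a; exact: frame_lat_gen.
Qed.

Lemma qi_gen i k a : (i <= 2 * k + lev a)%N ->
  qi q i (2 ^+ k *: col a P) = 2 ^+ (2 * k + lev a - i) * G a a.
Proof.
move=> h; rewrite /qi qZ // -bil_xx // (fr_gram fr); apply: (mulfI (twoX0 i)).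
by rewrite mulVKf // !mulrA -exprD subnKC // exprD -exprM mulnC.
Qed.

Lemma special_coord_int i (Q : pred nat) kf x : (forall l, Q l -> (i <= kf l)%N) ->
  frame_lat kf x -> dv i (sc Q x).
Proof. by move=> h hx; apply: (dv_sum hA) => b /andP[_ Qb]; exact: (dv_le hA (h _ Qb) (hx b)). Qed.

Lemma special_coord_gen (Q : pred nat) k a : (forall l l', Q l -> Q l' -> l = l') ->
  (exists b, [/\ s b, lev b = lev a & sc Q (2 ^+ k *: col a P) = 2 ^+ k * G b a]) /\ Q (lev a) \/
  (Q (lev a) -> forall b, s b -> lev b != lev a) /\ sc Q (2 ^+ k *: col a P) = 0.
Proof.
move=> Qu; rewrite special_coordZ.
have [[b [sb Qb e]]|[no e]] := special_sum (fun b => yc b (col a P)) Qu; last first.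
  right; rewrite /sc e mulr0; split=> // Qa b sb.
  by apply: contraNneq (no b sb) => ->.
rewrite /sc e dual_coord_frame.
have [eb|ne] := eqVneq (lev b) (lev a).
  by left; split; [exists b | rewrite -eb].
right; rewrite (fr_block fr) // mulr0; split=> // Qa.
by move: ne; rewrite (Qu _ _ Qb Qa) eqxx.
Qed.

Lemma pred1_uniq (T : eqType) (k x y : T) : x == k -> y == k -> x = y.
Proof. by move=> /eqP-> /eqP->. Qed.

Lemma qi_char i x : latA A q i x -> dv 1 (qi q i x - sc (pred1 i) x ^+ 2).
Proof.
have lA y z : frame_lat (fun l => i - l)%N y -> frame_lat (fun l => i - l)%N z -> A (bili q i y z).
  by rewrite -latAE; exact: bili_int.
rewrite latAE; apply: frame_quadratic => //.
- exact: special_coordD.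
- exact: special_coordZ.
- by move=> y hy; apply/(dv0E hA); exact: (special_coord_int _ hy).
move=> a; rewrite qi_gen; last by lia.
have [[[b [sb eb ->]] /eqP ea]|[no ->]] := special_coord_gen (i - lev a) a (@pred1_uniq _ i).
  rewrite ea subnn muln0 add0n subnn !expr0 !mul1r; exact: (fr_char fr).
rewrite expr0n subr0; have [ea|ne] := eqVneq (lev a) i; last first.
  apply: (dvMr hA); [exact: (fr_G fr) | apply: (dv_pow2 hA); lia].
rewrite ea subnn muln0 add0n subnn expr0 mul1r; apply: (fr_even fr) => b sb.
by apply: no => //=; apply/eqP.
Qed.

(* On X_i, 2^-(i+1) q is the square of this linear form mod 2. *)
Definition zeta i x := 2^-1 * sc (fun l => l.+1 == i) x + sc (pred1 i.+1) x.

Lemma pred_uniq i l l' : l.+1 == i -> l'.+1 == i -> l = l'.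
Proof. by move=> /eqP <-; rewrite eqSS => /eqP ->. Qed.

Lemma zetaD i x y : zeta i (x + y) = zeta i x + zeta i y.
Proof. by rewrite /zeta !special_coordD; ring. Qed.

Lemma zetaZ i a x : zeta i (a *: x) = a * zeta i x.
Proof. by rewrite /zeta !special_coordZ; ring. Qed.

Lemma dv_halve k x : dv k.+1 x <-> dv k (2^-1 * x).
Proof. by rewrite -(dv_shift hA 1 k) expr1 mulVKf. Qed.

Lemma zeta_int i x : latA A q i x -> A (zeta i x).
Proof.
rewrite latAE => hx; apply: (dvrD hA).
  apply/(dv0E hA)/dv_halve; apply: (special_coord_int _ hx) => l /eqP <-; lia.
by apply/(dv0E hA); apply: (special_coord_int _ hx).
Qed.

(** Among the generators of X_i only 2 v_a at level i-1 and v_a at level i+1 can have an odd value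
    of 2^-(i+1) q; the factor 1/2 in [zeta] undoes the 2 of the former. *)
Lemma qi_zeta i x : latX A q i x -> dv 1 (qi q i.+1 x - zeta i x ^+ 2).
Proof.
have lA y : frame_lat (fun l => i - l + (l == i))%N y -> latA A q i y.
  by rewrite -latXE; exact: latX_latA.
rewrite latXE; apply: frame_quadratic => //.
- exact: zetaD.
- exact: zetaZ.
- by move=> y hy; apply: zeta_int; exact: lA.
- move=> y z; rewrite -latXE => hy hz; have [_ /(_ _ (latX_latA hz))] := hy.
  move=> /(dvE hA); congr A; rewrite expr1 /bili exprS; field.
  by rewrite two0 twoX0.
move=> a; rewrite qi_gen; last by case: eqVneq; lia.
rewrite /zeta.
have [[[b [sb eb ->]] /eqP ea]|[no ->]] :=
    special_coord_gen (i - lev a + (lev a == i)) a (@pred_uniq i).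
  have [[[c [_ _ _]] /eqP ea']|[_ ->]] :=
    special_coord_gen (i - lev a + (lev a == i)) a (@pred1_uniq _ i.+1); first by lia.
  have -> : (i - lev a + (lev a == i) = 1)%N by rewrite -ea; case: eqVneq; lia.
  rewrite addr0 expr1 mulKf // -[X in (_ + X - _)%N]/(lev a) -ea.
  have -> : (2 * 1 + lev a - (lev a).+2 = 0)%N by lia.
  rewrite expr0 mul1r; exact: (fr_char fr).
have [[[b [sb eb ->]] /eqP ea]|[no' ->]] :=
    special_coord_gen (i - lev a + (lev a == i)) a (@pred1_uniq _ i.+1).
  have -> : (i - lev a + (lev a == i) = 0)%N by rewrite ea; case: eqVneq; lia.
  rewrite mulr0 add0r expr0 mul1r ea.
  have -> : (2 * 0 + i.+1 - i.+1 = 0)%N by lia.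
  rewrite expr0 mul1r; exact: (fr_char fr).
rewrite mulr0 addr0 expr0n subr0.
have [ea|ne] := eqVneq (lev a).+1 i.
  apply: (dvMl hA); first by apply: dvrX => //; apply: dvr_nat.
  by apply: (fr_even fr) => b sb; apply: no => //; apply/eqP.
have [ea|ne'] := eqVneq (lev a) i.+1.
  apply: (dvMl hA); first by apply: dvrX => //; apply: dvr_nat.
  by apply: (fr_even fr) => b sb; apply: no' => //; apply/eqP.
apply: (dvMr hA); first exact: (fr_G fr).
by apply: (dv_pow2 hA); case: eqVneq; lia.
Qed.


Lemma latAD i x y : latA A q i x -> latA A q i y -> latA A q i (x + y).
Proof. by rewrite latAE; exact: frame_latD. Qed.

Lemma latAZ i a x : A a -> latA A q i x -> latA A q i (a *: x).
Proof. by rewrite latAE; exact: frame_latZ. Qed.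

Lemma latAB i x y : latA A q i x -> latA A q i y -> latA A q i (x - y).
Proof. by move=> hx hy; rewrite -scaleN1r; apply: latAD => //; apply: latAZ => //; apply: dvrN (dvr1 hA). Qed.

Lemma latXD i x y : latX A q i x -> latX A q i y -> latX A q i (x + y).
Proof. by rewrite latXE; exact: frame_latD. Qed.

Lemma latXZ i a x : A a -> latX A q i x -> latX A q i (a *: x).
Proof. by rewrite latXE; exact: frame_latZ. Qed.

Lemma latXB i x y : latX A q i x -> latX A q i y -> latX A q i (x - y).
Proof. by move=> hx hy; rewrite -scaleN1r; apply: latXD => //; apply: latXZ => //; apply: dvrN (dvr1 hA). Qed.

Definition special_vec i : 'cV[F]_n := \sum_(b | s b && (pred1 i (lev b))) col b P.
Local Notation e_ := special_vec.

Lemma special_vec_frame a : s a -> e_ (lev a) = col a P.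
Proof.
move=> sa; rewrite /e_ (big_pred1 a) // => b; apply/andP/eqP => [[sb /eqP eb]|->].
  exact: (fr_uniq fr).
by split=> //=.
Qed.

Lemma bil_special i x : bil q (e_ i) x = 2 ^+ i * sc (pred1 i) x.
Proof.
rewrite /e_ bil_suml // mulr_sumr; apply: eq_bigr => b /andP[_ /eqP <-].
exact: bil_frame.
Qed.

Lemma bili_special i x : bili q i x (e_ i) = sc (pred1 i) x.
Proof. by rewrite /bili bil_sym bil_special mulKf. Qed.

Lemma latA_special i : latA A q i (e_ i).
Proof.
rewrite /e_; elim/big_ind: _ => [||b /andP[_ /eqP <-]]; last exact: latA_frame.
- by rewrite latAE; exact: frame_lat0.
- exact: latAD.
Qed.

Lemma char_special i : char_vector A q i (e_ i).
Proof.
split; first exact: latA_special.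
by move=> v /qi_char/(dvN hA); rewrite opprB bili_special.
Qed.

(** Both pairings with y have squares congruent to 2^-i q(y), and modulo 2 a square determines its
    root. *)
Lemma char_uniq i e e' : char_vector A q i e -> char_vector A q i e' -> latX A q i (e - e').
Proof.
move=> [Ae he] [Ae' he']; split; first exact: latAB.
move=> y Ay; apply: (dv1_sqr hA); first by apply: bili_int => //; exact: latAB.
have bB u v w : bili q i (u - v) w = bili q i w u - bili q i w v.
  by rewrite /bili bilBl // mulrBr !(bil_sym q w).
rewrite bB; set a := bili _ _ _ _; set b := bili _ _ _ _.
have -> : (a - b) ^+ 2 = (a ^+ 2 - qi q i y) - (b ^+ 2 - qi q i y) + 2 * (b * (b - a)) by ring.
apply: (dvD hA); first by apply: (dvB hA); [exact: he | exact: he'].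
rewrite -{1}[2]expr1; apply: dv_mul; have [ia ib] : A a /\ A b by split; exact: bili_int.
by apply: (dvrM hA) => //; apply: (dvrB hA).
Qed.

Lemma latWP i x : latW A q i x <-> exists2 a, A a & latX A q i (x - a *: e_ i).
Proof.
split=> [[_ [e [a [ce Aa hx]]]]|[a Aa hx]].
  exists a => //.
  have -> : x - a *: e_ i = x - a *: e + a *: (e - e_ i).
    by rewrite scalerBr addrA subrK.
  apply: latXD => //; apply: latXZ => //; apply: char_uniq => //; exact: char_special.
split; last by exists (e_ i), a; split=> //; exact: char_special.
rewrite -[x](subrK (a *: e_ i)); apply: latAD; first exact: latX_latA.
by apply: latAZ => //; exact: latA_special.
Qed.

Lemma latBP i x : latB A q i x <-> latA A q i x /\ dv 1 (sc (pred1 i) x).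
Proof.
split=> -[hx h]; split=> //.
  apply: (dv1_sqr hA); first by rewrite -bili_special; apply: bili_int => //; exact: latA_special.
  rewrite -[_ ^+ 2](subKr (qi q i x)); apply: (dvB hA) => //; exact: qi_char.
change (dv 1 (qi q i x)); rewrite -[qi q i x](subrK (sc (pred1 i) x ^+ 2)); apply: (dvD hA).
  exact: qi_char.
by rewrite expr2; apply: (dvMl hA) => //; exact: (dv_int hA h).
Qed.

Lemma latX_special i x : latX A q i x -> dv 1 (sc (pred1 i) x).
Proof. by move=> [_ /(_ _ (latA_special i))]; rewrite bili_special. Qed.

Lemma latX_latY i x : latX A q i x -> latY A q i x.
Proof.
move=> hx; split; first by apply/latBP; split; [exact: latX_latA | exact: latX_special].
by move=> y [Ay _]; case: hx => _; apply.
Qed.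

Lemma latXZP i x : (latX A q i `&` latZ A q i) x <-> latX A q i x /\ dv 1 (zeta i x).
Proof.
split=> [[hx [_ hz]]|[hx hz]].
  split=> //; apply: (dv1_sqr hA); first by apply: zeta_int; exact: latX_latA.
  rewrite -[_ ^+ 2](subKr (qi q i.+1 x)); apply: (dvB hA) => //; exact: qi_zeta.
split=> //; split; first exact: latX_latY.
change (dv 1 (qi q i.+1 x)); rewrite -[qi q i.+1 x](subrK (zeta i x ^+ 2)); apply: (dvD hA).
  exact: qi_zeta.
by rewrite expr2; apply: (dvMl hA) => //; exact: (dv_int hA hz).
Qed.

Lemma latX_latW i x : latX A q i x -> latW A q i x.
Proof. by move=> hx; apply/latWP; exists 0; [exact: dvr0 | rewrite scale0r subr0]. Qed.

(** B_i is the kernel modulo 2 of the pairing with e_i. A vector pairing evenly with B_i therefore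
    gives a linear form proportional to that of e_i modulo 2, and differs from a multiple of e_i by
    an element of X_i. *)
Lemma latY_latW i x : latY A q i x -> latW A q i x.
Proof.
move=> [[Ax _] hx]; apply/latWP.
have biliZ a u v : bili q i (a *: u) v = a * bili q i u v by rewrite /bili bilZl // mulrCA.
have biliB u v w : bili q i (u - v) w = bili q i u w - bili q i v w.
  by rewrite /bili bilBl // mulrBr.
have biliC u v : bili q i u v = bili q i v u by rewrite /bili bil_sym.
have [[z0 Az0 nz0]|all0] := pselect (exists2 z, latA A q i z & ~ dv 1 (sc (pred1 i) z)); last first.
  exists 0; [exact: dvr0 | rewrite scale0r subr0; split=> // y Ay; apply: hx].
  by apply/latBP; split=> //; apply: contrapT => ny; apply: all0; exists y.
have iz z : latA A q i z -> A (sc (pred1 i) z).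
  by move=> Az; rewrite -bili_special; apply: bili_int => //; exact: latA_special.
have [u0 Au Au'] := nonunit_dv hA (iz _ Az0) nz0; set u := sc _ _ in u0 Au Au'.
exists (bili q i x z0 / u); first by apply: (dvrM hA) => //; exact: bili_int.
split.
  apply: latAB => //; apply: latAZ (latA_special i); apply: (dvrM hA) => //; exact: bili_int.
move=> z Az; have /hx : latB A q i (z - (sc (pred1 i) z / u) *: z0).
  apply/latBP; split.
    by apply: latAB => //; apply: latAZ => //; apply: (dvrM hA) => //; exact: iz.
  rewrite -scaleN1r special_coordD !special_coordZ -/u divfK // mulN1r subrr; exact: dv_0.
rewrite biliC biliB biliZ biliB biliZ !(biliC _ x) (biliC (e_ i)) bili_special.
by congr (dv 1 (_ - _)); field.
Qed.

Lemma latW_latA i x : latW A q i x -> latA A q i x.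
Proof. by case. Qed.


(* The tangent lattice of M at 1 consists of the X such that 2 ^+ weight a b
   divides <v_a, X v_b> for all a and b. *)
Definition weight a b : nat :=
  maxn (lev a) (lev b) + ((lev a == lev b) && (s a || s b)) +
  (s a && s b && (((lev a).+1 == lev b) || ((lev b).+1 == lev a))).

Lemma weightC a b : weight a b = weight b a.
Proof. by rewrite /weight maxnC eq_sym (orbC (s a)) (andbC (s a)) (orbC (_ == lev b)). Qed.

Lemma weight_max a b : (maxn (lev a) (lev b) <= weight a b)%N.
Proof. by rewrite /weight -addnA leq_addr. Qed.

Lemma weight_special a b : lev a = lev b -> s a || s b -> (lev a < weight a b)%N.
Proof. by rewrite /weight => -> ->; rewrite eqxx; lia. Qed.

Lemma weight_adjacent a b : s a -> s b -> (lev a).+1 = lev b -> (lev b < weight a b)%N.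
Proof. by rewrite /weight => -> -> ->; rewrite eqxx; lia. Qed.

Definition tangent (X : 'M[F]_n) : Prop :=
  forall a b, dv (weight a b - lev a) (yc a (X *m col b P)).

(** What [uM] asks of m - 1; the stability of the six lattices under m is a consequence
    ([uM_preserves]). *)
Definition preserves (X : 'M[F]_n) : Prop := forall i,
  [/\ forall x, latA A q i x -> latB A q i (X *m x),
      forall x, latW A q i x -> (latX A q i `&` latZ A q i) (X *m x)
    & forall x, dual_lat A q (latX A q i `&` latZ A q i) x ->
        dual_lat A q (latW A q i) (X *m x)].

Lemma tangent_bound X kf k b x : tangent X -> frame_lat kf x ->
  (forall a, (k <= weight b a - lev b + kf (lev a))%N) -> dv k (yc b (X *m x)).
Proof.
move=> tX hx hk; rewrite [x]frame_expansion mulmx_sumr dual_coord_sum.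
apply: (dv_sum hA) => a _; rewrite -scalemxAr dual_coordZ mulrC.
apply: (dv_le hA (hk a)); apply: (dvM hA); first exact: tX.
exact: frame_lat_coord.
Qed.

Lemma tangent_AB X i x : tangent X -> latA A q i x -> latB A q i (X *m x).
Proof.
move=> tX; rewrite latAE => hx; apply/latBP; split.
  rewrite latAE => b; apply: (tangent_bound tX hx) => a /=.
  by have := weight_max b a; lia.
apply: (dv_sum hA) => b /andP[sb /= /eqP eb]; apply: (tangent_bound tX hx) => a /=.
have := weight_max b a; have [e|ne] := eqVneq (lev b) (lev a); last by lia.
by have := weight_special e; rewrite sb => /(_ isT); lia.
Qed.

Lemma tangent_WXZ X i x : tangent X -> latW A q i x ->
  (latX A q i `&` latZ A q i) (X *m x).
Proof.
move=> tX hW; have hXA : latA A q i (X *m x).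
  by have [] := tangent_AB tX (latW_latA hW).
move/latWP: hW => [a Aa hx0]; set x' := x - a *: e_ i in hx0 *.
have ex : x = a *: e_ i + x' by rewrite /x' addrC subrK.
have hx' : frame_lat (fun l => i - l + (l == i))%N x' by rewrite -latXE.
have he b k : (forall c, s c -> lev c = i -> (k <= weight b c - lev b)%N) ->
    dv k (yc b (X *m e_ i)).
  move=> h; rewrite /e_ mulmx_sumr dual_coord_sum; apply: (dv_sum hA) => c /andP[sc' /= /eqP ec].
  exact: (dv_le hA (h c sc' ec) (tX b c)).
have hb b k : (forall c, s c -> lev c = i -> (k <= weight b c - lev b)%N) ->
    (forall c, (k <= weight b c - lev b + (i - lev c + (lev c == i)))%N) ->
    dv k (yc b (X *m x)).
  move=> h1 h2; rewrite ex mulmxDr dual_coordD -scalemxAr dual_coordZ; apply: (dvD hA).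
    by apply: (dvMl hA) => //; exact: he.
  exact: (tangent_bound tX hx').
apply/latXZP; split.
  rewrite latXE => b; move: hXA; rewrite latAE => /(_ b).
  have [eb _|ne] := eqVneq (lev b) i; last by rewrite addn0.
  rewrite eb subnn; apply: hb => c.
    by move=> sc' ec; have := @weight_special b c; rewrite eb ec sc' orbT => /(_ erefl isT); lia.
  have := weight_max b c; case: eqVneq; lia.
(* The two halves of [zeta] read the entries from level i to the levels i-1 and i+1; the adjacency
   term of the weight is what makes them even on e_i. *)
rewrite /zeta; apply: (dvD hA); [apply: (proj1 (dv_halve _ _))|]; apply: (dv_sum hA) => b /andP[sb /= /eqP eb]; apply: hb => c.
- by move=> sc' ec; have := weight_adjacent sb sc'; rewrite eb ec => /(_ erefl); lia.
- have := weight_max b c; have [e|ne] := eqVneq (lev b) (lev c).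
    have := weight_special e; rewrite sb => /(_ isT); case: eqVneq; lia.
  case: eqVneq; lia.
- by move=> sc' ec; have := weight_adjacent sc' sb; rewrite eb ec weightC => /(_ erefl); lia.
- have := weight_max b c; have [e|ne] := eqVneq (lev b) (lev c).
    have := weight_special e; rewrite sb => /(_ isT); case: eqVneq; lia.
  case: eqVneq; lia.
Qed.

Hypothesis Su : gram q \in unitmx.

Definition adjoint (X : 'M[F]_n) : 'M[F]_n := invmx (gram q) *m X^T *m gram q.

Lemma bil_adjoint X x y : bil q (X *m x) y = bil q x (adjoint X *m y).
Proof.
rewrite !bilE // /adjoint trmx_mul !mulmxA; congr ((_ *m y) 0 0); rewrite -!mulmxA.
by rewrite (mulmxA (gram q)) mulmxV // mul1mx.
Qed.

(** The condition bounds <v_a, X v_b> by a weight symmetric in a and b. *)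
Lemma tangent_adjoint X : tangent X -> tangent (adjoint X).
Proof.
move=> tX b a; apply/(dv_shift hA (lev b)); rewrite -bil_frame -bil_adjoint bil_sym bil_frame.
have := tX a b; move/(dv_shift hA (lev a)); rewrite weightC.
by have := weight_max b a => h; rewrite !subnKC //; lia.
Qed.

(** Moving X to the other side of the form, the dual condition is the one from W_i to X_i and Z_i
    for the adjoint. *)
Lemma tangent_dual X i x : tangent X -> dual_lat A q (latX A q i `&` latZ A q i) x ->
  dual_lat A q (latW A q i) (X *m x).
Proof.
move=> tX hx y hy; rewrite bil_adjoint; apply: hx.
by apply: tangent_WXZ => //; exact: tangent_adjoint.
Qed.

Lemma tangent_preserves X : tangent X -> preserves X.
Proof.
move=> tX i; split=> x; [exact: tangent_AB | exact: tangent_WXZ | exact: tangent_dual].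
Qed.

(** Each target lattice lies in the corresponding source: B_i in A_i, the intersection of X_i and
    Z_i in W_i, and dually the dual of W_i in the dual of that intersection. *)
Lemma preserves_mul X X' : preserves X -> preserves X' -> preserves (X *m X').
Proof.
move=> hX hX' i; have [XA XW XD] := hX i; have [XA' XW' XD'] := hX' i.
split=> x h; rewrite -mulmxA.
- by apply: XA; have [] := XA' _ h.
- by apply: XW; apply: latX_latW; have [] := XW' _ h.
- by apply: XD => y [hy _]; apply: (XD' _ h); exact: latX_latW.
Qed.

Lemma Aut_L_lattice g x : Aut_L A (gram q) g -> lattice_L A x -> lattice_L A (g *m x).
Proof. by move=> [_ e] hx; rewrite -e; exists x. Qed.

Lemma Aut_L_bil g x y : Aut_L A (gram q) g -> bil q (g *m x) (g *m y) = bil q x y.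
Proof.
move=> [e _]; rewrite !bilE // trmx_mul -[in RHS]e /rho !mulmxA.
by [].
Qed.

Lemma Aut_L_q g x : Aut_L A (gram q) g -> q (g *m x) = q x.
Proof. by move=> hg; rewrite -[LHS]bil_xx // Aut_L_bil // bil_xx. Qed.

Lemma Aut_L_latA g i x : Aut_L A (gram q) g -> latA A q i x -> latA A q i (g *m x).
Proof.
move=> hg [Lx hx]; split; first exact: Aut_L_lattice.
move=> y Ly; move: (Ly); case: (hg) => _ {1}<- [z Lz <-].
by rewrite Aut_L_bil //; exact: hx.
Qed.

Lemma Aut_L_latX g i x : Aut_L A (gram q) g -> latX A q i x -> latX A q i (g *m x).
Proof.
move=> hg [Ax hx]; split; first exact: Aut_L_latA.
move=> y Ay; have hg' := Aut_L_inv hA Su hg.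
have gu : g \in unitmx by exact: (OV_unitmx Su (proj1 hg)).
by rewrite -(mulKVmx gu y) /bili Aut_L_bil //; apply: hx; exact: Aut_L_latA.
Qed.


Lemma Aut_L_char g i e : Aut_L A (gram q) g -> char_vector A q i e ->
  char_vector A q i (g *m e).
Proof.
move=> hg [Ae he]; split; first exact: Aut_L_latA.
move=> y Ay; have gu : g \in unitmx by exact: (OV_unitmx Su (proj1 hg)).
have := he _ (Aut_L_latA (Aut_L_inv hA Su hg) Ay).
set z := invmx g *m y; have -> : y = g *m z by rewrite mulKVmx.
by rewrite /bili Aut_L_bil // /qi Aut_L_q.
Qed.

(** An isometry satisfies q(gx - x) = -2 <gx - x, x>, which gives B_i at once. It permutes
    characteristic vectors, which agree modulo X_i, so gx - x is in X_i for x in W_i; the same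
    identity then gives Z_i. The dual condition is that of the inverse of g. *)
Lemma Aut_L_preserves g : Aut_L A (gram q) g -> preserves (g - 1%:M).
Proof.
move=> hg i; have gE (h : 'M[F]_n) (x : 'cV[F]_n) : (h - 1%:M) *m x = h *m x - x by rewrite mulmxBl mul1mx.
have hW h x : Aut_L A (gram q) h -> latW A q i x -> latX A q i (h *m x - x).
  move=> hh /latWP[a Aa hx].
  have -> : h *m x - x = a *: (h *m e_ i - e_ i) + h *m (x - a *: e_ i) - (x - a *: e_ i).
    rewrite mulmxBr scalerBr -scalemxAr; apply/matrixP => k l; rewrite !mxE; ring.
  apply: latXB => //; apply: latXD; last exact: Aut_L_latX.
  by apply: latXZ => //; apply: char_uniq; [apply: Aut_L_char => // |]; exact: char_special.
have hXZ h x : Aut_L A (gram q) h -> latW A q i x ->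
    (latX A q i `&` latZ A q i) (h *m x - x).
  move=> hh hx; have hX := hW h x hh hx; split=> //; split; first exact: latX_latY.
  have [_ /(_ x (latW_latA hx)) h1] := hX.
  have -> : qi q i.+1 (h *m x - x) = - bili q i (h *m x - x) x.
    rewrite /qi qB // Aut_L_q // /bili bilBl // -(bil_xx _ hq x) // exprS; field.
    by rewrite two0 twoX0.
  exact: (dvN hA).
split=> x hx; rewrite gE.
- split; first by apply: latAB => //; exact: Aut_L_latA.
  have -> : qi q i (g *m x - x) = 2 * (bili q i x x - bili q i (g *m x) x).
    by rewrite /qi qB // Aut_L_q // /bili bil_xx //; ring.
  rewrite -[2]expr1; apply: dv_mul.
  by apply: (dvrB hA); apply: bili_int => //; exact: Aut_L_latA.
- exact: hXZ.
- move=> y hy; have gu : g \in unitmx by exact: (OV_unitmx Su (proj1 hg)).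
  have -> : bil q (g *m x - x) y = bil q x (invmx g *m y - y).
    by rewrite bilBl // bilBr // -{1}(mulKVmx gu y) Aut_L_bil.
  by apply: hx; apply: hXZ => //; exact: (Aut_L_inv hA Su hg).
Qed.

End FrameLattices.

(** * The points of M *)

Section ExtendedLattices.
Variables (F : fieldType) (A : set F) (hA : complete_dvr A) (n : nat) (q : 'cV[F]_n -> F).
Hypothesis hq : is_quadratic_form q.
Variables (P G : 'M[F]_n) (lev : 'I_n -> nat) (s : 'I_n -> bool).
Hypothesis fr : jordan_frame A q P G lev s.
Variables (E : comAlgType F) (T : set E) (hT : is_A_subalgebra A T).
Local Notation dv := (pow2A A).
Local Notation io := (in_alg E).
Local Notation yc := (dual_coord q P lev).
Local Notation sc := (special_coord q P lev s).
Local Notation e_ := (special_vec P lev s).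
Local Notation w := (weight lev s).
Let two0 := dvr_two_neq0 hA.
Let twoX0 k : (2 : F) ^+ k != 0. Proof. exact: expf_neq0. Qed.

Let TA a : A a -> T (io a). Proof. by case: hT => h _ _; apply: h. Qed.
Let rT : subring_set T. Proof. exact: subalgebra_subring hT. Qed.
Let TB x y : T x -> T y -> T (x - y). Proof. by case: hT => _ h _; apply: h. Qed.
Let TM x y : T x -> T y -> T (x * y). Proof. by case: hT => _ _ h; apply: h. Qed.

Definition ext_dv k (z : E) : Prop := T (io (2 ^- k) * z).
Local Notation dvT := ext_dv.

Lemma ext_dvB k y z : dvT k y -> dvT k z -> dvT k (y - z).
Proof. by rewrite /dvT mulrBr; apply: TB. Qed.

Lemma ext_dv_shift j k z : dvT (j + k) (io (2 ^+ j) * z) <-> dvT k z.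
Proof.
rewrite /dvT mulrA -rmorphM; suff -> : 2 ^- (j + k) * 2 ^+ j = 2 ^- k :> F by [].
by rewrite exprD invfM mulrAC mulVf // mul1r.
Qed.

Lemma ext_dv_le j k z : (j <= k)%N -> dvT k z -> dvT j z.
Proof.
move=> jk h; have -> : z = io (2 ^+ (k - j)) * (io (2 ^- (k - j)) * z).
  by rewrite mulrA -rmorphM mulfV // rmorph1 mul1r.
rewrite /dvT mulrCA; apply: TM; first by apply: TA; apply: (dvrX hA); exact: dvr_nat.
move: h; rewrite /dvT mulrA -rmorphM; congr (T (io _ * _)).
by rewrite -invfM -exprD subnKC.
Qed.

Lemma lat_ext_dv (N : set 'cV[F]_n) (l : 'rV[F]_n) k y :
  (forall x, N x -> dv k ((l *m x) 0 0)) -> lat_ext T N y ->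
  dvT k ((map_mx io l *m y) 0 0).
Proof.
move=> h [m [t [x [hx ->]]]]; rewrite mulmx_sumr summxE /dvT mulr_sumr.
apply: (subring_set_sum rT) => i _; have [Ti Ni] := hx i.
rewrite -scalemxAr -map_mxM mxE [X in _ * (_ * X)]mxE mulrCA -rmorphM; apply: TM => //; apply: TA.
by rewrite mulrC; apply/(dvE hA); exact: h.
Qed.

Lemma lat_ext_base (N : set 'cV[F]_n) x : N x -> lat_ext T N (map_mx io x).
Proof.
move=> Nx; exists 1%N, (fun=> 1), (fun=> x); split; last by rewrite big_ord1 scale1r.
by move=> _; split=> //; rewrite -(rmorph1 io); apply: TA; exact: dvr1.
Qed.

Lemma maps_into_map (N N' : set 'cV[F]_n) (g : 'M[F]_n) :
  (forall x, N x -> N' (g *m x)) -> maps_into T (map_mx io g) N N'.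
Proof.
move=> h _ [m [t [x [hx ->]]]]; exists m, t, (fun i => g *m x i); split.
  by move=> i; have [? ?] := hx i; split=> //; apply: h.
by rewrite mulmx_sumr; apply: eq_bigr => i _; rewrite -scalemxAr map_mxM.
Qed.

Lemma lat_ext0 (N : set 'cV[F]_n) : lat_ext T N 0.
Proof. by exists 0%N, (fun=> 0), (fun=> 0); split; [case | rewrite big_ord0]. Qed.

Lemma lat_extD (N : set 'cV[F]_n) y z : lat_ext T N y -> lat_ext T N z -> lat_ext T N (y + z).
Proof.
move=> [m [t [x [hx ->]]]] [m' [t' [x' [hx' ->]]]].
exists (m + m')%N, (fun i => match fintype.split i with inl j => t j | inr j => t' j end),
  (fun i => match fintype.split i with inl j => x j | inr j => x' j end); split.
  by move=> i; case: (fintype.split i).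
rewrite big_split_ord; congr (_ + _); apply: eq_bigr => i _.
  by have -> : fintype.split (lshift m' i) = inl i by exact: (unsplitK (inl i)).
by have -> : fintype.split (rshift m i) = inr i by exact: (unsplitK (inr i)).
Qed.

Lemma lat_extZ (N : set 'cV[F]_n) t y : T t -> lat_ext T N y -> lat_ext T N (t *: y).
Proof.
move=> Tt [m [t' [x [hx ->]]]]; exists m, (fun i => t * t' i), x; split.
  by move=> i; have [? ?] := hx i; split=> //; apply: TM.
by rewrite scaler_sumr; apply: eq_bigr => i _; rewrite scalerA.
Qed.

Lemma maps_into_sum (N N' : set 'cV[F]_n) I (t : seq I) (c : I -> E) (g : I -> 'M[E]_n) :
  (forall i, T (c i)) -> (forall i, maps_into T (g i) N N') ->
  maps_into T (\sum_(i <- t) c i *: g i) N N'.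
Proof.
move=> hc hg x hx; rewrite mulmx_suml; elim/big_ind: _ => [||i _].
- exact: lat_ext0.
- exact: lat_extD.
- by rewrite -scalemxAl; apply: lat_extZ => //; exact: hg.
Qed.

Lemma lat_ext_sub (N N' : set 'cV[F]_n) y : (forall x, N x -> N' x) ->
  lat_ext T N y -> lat_ext T N' y.
Proof.
move=> h [m [t [x [hx ->]]]]; exists m, t, x; split=> // i.
by have [? ?] := hx i; split=> //; apply: h.
Qed.

Definition ext_preserves (X : 'M[E]_n) : Prop := forall i,
  [/\ maps_into T X (latA A q i) (latB A q i),
      maps_into T X (latW A q i) (latX A q i `&` latZ A q i)
    & maps_into T X (dual_lat A q (latX A q i `&` latZ A q i)) (dual_lat A q (latW A q i))].

(** Stability of N follows from (m - 1) N in N, and this from the three mapping conditions with Z_i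
    in Y_i in W_i, X_i in W_i and B_i in A_i. *)
Lemma uM_preserves m : uM A q T m <-> (forall i j, T (m i j)) /\ ext_preserves (m - 1%:M).
Proof.
split=> [[iT h]|[iT h]]; split=> // i; have [] := h i; first by move=> _ *; split.
move=> hAB hW hD; split=> // N hN x hx.
have -> : m *m x = (m - 1%:M) *m x + x by rewrite mulmxBl mul1mx subrK.
apply: lat_extD => //.
have sW y : latX A q i y -> latW A q i y by exact: (latX_latW hA hq fr).
have sZ y : latZ A q i y -> latY A q i y by case.
have sY y : latY A q i y -> latW A q i y by exact: (latY_latW hA hq fr).
have sA y : latB A q i y -> latA A q i y by case.
have sXZ1 y : (latX A q i `&` latZ A q i) y -> latX A q i y by case.
have sXZ2 y : (latX A q i `&` latZ A q i) y -> latZ A q i y by case.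
move: hx; case: hN => [[[[[->|->]|->]|->]|->]|->] hx.
- by apply: (lat_ext_sub sA); exact: hAB.
- by apply: hAB; exact: lat_ext_sub hx.
- by apply: (lat_ext_sub sW); apply: (lat_ext_sub sXZ1); exact: hW.
- by apply: (lat_ext_sub sXZ1); apply: hW; exact: lat_ext_sub hx.
- by apply: (lat_ext_sub sZ); apply: (lat_ext_sub sXZ2); apply: hW; exact: lat_ext_sub hx.
- apply: (lat_ext_sub sXZ2); apply: hW; apply: (lat_ext_sub sY); exact: (lat_ext_sub sZ).
Qed.

Variable X : 'M[E]_n.

Definition ext_pair (l : 'rV[F]_n) (x : 'cV[F]_n) : E :=
  (map_mx io l *m (X *m map_mx io x)) 0 0.
Local Notation Bl := ext_pair.

Lemma ext_pairDl l l' x : Bl (l + l') x = Bl l x + Bl l' x.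
Proof. by rewrite /Bl map_mxD mulmxDl mxE. Qed.

Lemma ext_pairZl a l x : Bl (a *: l) x = io a * Bl l x.
Proof. by rewrite /Bl map_mxZ -scalemxAl mxE. Qed.

Lemma ext_pairDr l x x' : Bl l (x + x') = Bl l x + Bl l x'.
Proof. by rewrite /Bl map_mxD mulmxDr mulmxDr mxE. Qed.

Lemma ext_pairZr a l x : Bl l (a *: x) = io a * Bl l x.
Proof. by rewrite /Bl map_mxZ -scalemxAr -scalemxAr mxE. Qed.

Lemma ext_pair_dv (N N' : set 'cV[F]_n) l k x : maps_into T X N N' -> N x ->
  (forall y, N' y -> dv k ((l *m y) 0 0)) -> dvT k (Bl l x).
Proof. by move=> hX Nx h; apply: lat_ext_dv h _; apply: hX; exact: lat_ext_base. Qed.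

Definition dual_row (b : 'I_n) : 'rV[F]_n := row b (G *m invmx P).

Lemma dual_rowE b x : (dual_row b *m x) 0 0 = yc b x.
Proof. by rewrite /dual_row -row_mul -(dual_coordE hA hq fr) !mxE. Qed.

Definition special_row (Q : pred nat) : 'rV[F]_n := \sum_(b | s b && Q (lev b)) dual_row b.
Local Notation sr := special_row.

Lemma special_rowE Q x : (sr Q *m x) 0 0 = sc Q x.
Proof. by rewrite mulmx_suml summxE; apply: eq_bigr => b _; rewrite dual_rowE. Qed.

Lemma special_row_frame b : s b -> sr (pred1 (lev b)) = dual_row b.
Proof.
move=> sb; rewrite /sr (big_pred1 b) // => c; apply/andP/eqP => [[sc' /eqP ec]|->].
  exact: (fr_uniq fr).
by split=> //=.
Qed.

(** The value 0 at i = 0 stands for the absent level -1; the predecessor on naturals would give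
    level 0 instead. *)
Definition prev_vec i : 'cV[F]_n := if i is j.+1 then e_ j else 0.
Definition prev_row i : 'rV[F]_n := if i is j.+1 then sr (pred1 j) else 0.

Lemma prev_rowE i : prev_row i = sr (fun l => l.+1 == i).
Proof. by case: i => [|i]; rewrite /prev_row /sr // big_pred0 // => b; rewrite andbF. Qed.

Lemma bil_prev i x : bil q (prev_vec i) x = 2 ^+ i.-1 * sc (fun l => l.+1 == i) x.
Proof.
case: i => [|i]; last by rewrite /= (bil_special hA hq).
by rewrite /= (bil0l hq) /special_coord big_pred0 ?mulr0 // => b; rewrite andbF.
Qed.

Hypothesis hX : ext_preserves X.

Lemma ext_pair_W i : dvT 1 (io 2^-1 * Bl (prev_row i) (e_ i) + Bl (sr (pred1 i.+1)) (e_ i)).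
Proof.
rewrite -ext_pairZl -ext_pairDl; have [_ hW _] := hX i; apply: (ext_pair_dv hW).
  apply/(latWP hA hq fr); exists 1; first exact: dvr1.
  rewrite scale1r subrr; rewrite (latXE hA hq fr); exact: frame_lat0.
move=> y /(latXZP hA hq fr)[_]; rewrite /zeta -!special_rowE -prev_rowE.
by rewrite mulmxDl -scalemxAl !mxE.
Qed.

Lemma ext_pair_dual i :
  dvT 1 (Bl (sr (pred1 i)) (prev_vec i) + io 2^-1 * Bl (sr (pred1 i)) (e_ i.+1)).
Proof.
(* Chosen so that <d, x> = zeta(x) / 2, which is integral exactly where [zeta] is even; hence d is
   in the dual of the intersection of X_i and Z_i. *)
pose d := 2 ^- i.+1 *: prev_vec i + 2 ^- i.+2 *: e_ i.+1.
have [_ _ hD] := hX i.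
have hd : dual_lat A q (latX A q i `&` latZ A q i) d.
  move=> x /(latXZP hA hq fr)[_]; rewrite /zeta.
  have -> : bil q d x = 2^-1 * (2^-1 * sc (fun l => l.+1 == i) x + sc (pred1 i.+1) x).
    rewrite (bilDl hq) !(bilZl hq) bil_prev (bil_special hA hq) !exprS.
    case: (i) => [|j] /=; last by rewrite !exprS; field; rewrite two0 twoX0.
    rewrite [sc (fun l => l.+1 == 0) _]big_pred0; last by move=> b; rewrite andbF.
    by rewrite expr0 !mulr1 !mulr0 !add0r invfM -mulrA mulKf.
  by move/(dv_halve hA)/(dv0E hA).
have : dvT 0 (Bl (2 ^+ i *: sr (pred1 i)) d).
  apply: (ext_pair_dv hD hd) => y hy; apply/(dv0E hA).
  rewrite -scalemxAl mxE special_rowE -(bil_special hA hq) bil_sym; apply: hy.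
  apply/(latWP hA hq fr); exists 1; first exact: dvr1.
  rewrite scale1r subrr; rewrite (latXE hA hq fr); exact: frame_lat0.
rewrite ext_pairZl ext_pairDr !ext_pairZr /dvT expr0 invr1 rmorph1 mul1r.
rewrite !mulrDr !mulrA -!rmorphM expr1; congr (T (io _ * _ + io _ * _)).
  by rewrite exprS invfM mulrCA mulfV // mulr1.
by rewrite -(addn2 i) exprD invfM mulrA mulfV // mul1r expr2 invfM.
Qed.


(* For alpha_i = Y_(i,i+1) / 2 and beta_i = Y_(i+1,i), where Y_(i,j) is the entry
   of X between the characteristic vectors of levels i and j, [ext_pair_W] and
   [ext_pair_dual] say that alpha_(i-1) + beta_i and alpha_i + beta_(i-1) are even. *)
Lemma ext_adjacent i : dvT 2 (Bl (sr (pred1 i)) (e_ i.+1)) /\ dvT 1 (Bl (sr (pred1 i.+1)) (e_ i)).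
Proof.
have half z : dvT 1 (io 2^-1 * z) <-> dvT 2 z.
  by rewrite -(ext_dv_shift 1 1) mulrA -rmorphM expr1 mulfV // rmorph1 mul1r.
have l0 x : Bl 0 x = 0 by rewrite /Bl map_mx0 mul0mx mxE.
have r0 l : Bl l 0 = 0 by rewrite /Bl map_mx0 !mulmx0 mxE.
(* At i = 0 the terms of level -1 vanish. Then the dual condition at i+1 removes the entry from
   level i to i+1, and the W condition at i+1 the entry in the opposite direction. *)
elim: i => [|i [IH1 IH2]]; have hW := ext_pair_W; have hD := ext_pair_dual.
  split; first by have := hD 0%N; rewrite r0 add0r => /half.
  by have := hW 0%N; rewrite l0 mulr0 add0r.
split; first by have /ext_dvB/(_ IH2) := hD i.+1; rewrite addrC addKr => /half.
by have /ext_dvB/(_ (proj2 (half _) IH1)) := hW i.+1; rewrite addrC addKr.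
Qed.

(** The parts of the weight have separate sources: the maximum comes from A_i, the additional 2 at
    equal levels from B_i if v_b is special and from W_i and X_i if v_a is, the one at adjacent
    levels from [ext_adjacent]. *)
Lemma ext_tangent b a : dvT (w b a - lev b) (Bl (dual_row b) (col a P)).
Proof.
have hB y : latB A q (lev a) y -> dv (lev a - lev b) (yc b y).
  by case; rewrite (latAE hA hq fr) => /(_ b).
have h1 : dvT (lev a - lev b) (Bl (dual_row b) (col a P)).
  have [hAB _ _] := hX (lev a); apply: (ext_pair_dv hAB).
    exact: (latA_frame hA hq fr).
  by move=> y hy; rewrite dual_rowE; exact: hB.
have h2 : lev b = lev a -> s b || s a -> dvT 1 (Bl (dual_row b) (col a P)).
  move=> e /orP[sb|sa]; have [hAB hW _] := hX (lev a).
    apply: (ext_pair_dv hAB); first exact: (latA_frame hA hq fr).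
    by move=> y /(latBP hA hq fr)[_]; rewrite -special_rowE -e special_row_frame.
  apply: (ext_pair_dv hW).
    apply/(latWP hA hq fr); exists 1; first exact: dvr1.
    rewrite (special_vec_frame fr sa) scale1r subrr (latXE hA hq fr); exact: frame_lat0.
  move=> y [+ _]; rewrite (latXE hA hq fr) dual_rowE => /(_ b).
  by rewrite e subnn eqxx.
have h3 : s b -> s a -> (lev b).+1 = lev a -> dvT 2 (Bl (dual_row b) (col a P)).
  by move=> sb sa e; rewrite -(special_row_frame sb) -(special_vec_frame fr sa) -e; case: (ext_adjacent (lev b)).
have h4 : s b -> s a -> (lev a).+1 = lev b -> dvT 1 (Bl (dual_row b) (col a P)).
  by move=> sb sa e; rewrite -(special_row_frame sb) -(special_vec_frame fr sa) -e; case: (ext_adjacent (lev a)).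
rewrite /weight; case: (boolP (s b && s a && _)) => [/andP[/andP[sb sa] /orP[/eqP e|/eqP e]]|_].
- by rewrite sb sa; apply: (ext_dv_le _ (h3 sb sa e)); lia.
- by rewrite sb sa; apply: (ext_dv_le _ (h4 sb sa e)); lia.
rewrite addn0; have [e|ne] := eqVneq (lev b) (lev a) => /=; last first.
  by apply: (ext_dv_le _ h1); lia.
case: (boolP (s b || s a)) => [sba|_] /=.
  by apply: (ext_dv_le _ (h2 e sba)); lia.
by apply: (ext_dv_le _ h1); lia.
Qed.

Lemma ext_pair_mx b a : Bl (dual_row b) (col a P) =
  (map_mx io (G *m invmx P) *m X *m map_mx io P) b a.
Proof.
rewrite /Bl /dual_row map_row map_col mulmxA -row_mul.
have -> (Z : 'M[E]_n) : row b Z *m col a (map_mx io P) = col a (row b (Z *m map_mx io P)).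
  by rewrite row_mul !colE mulmxA.
by rewrite !mxE.
Qed.

End ExtendedLattices.

(** The case E = F, T = A of [ext_tangent]. *)
Lemma preserves_tangent (F : fieldType) (A : set F) (hA : complete_dvr A) (n : nat)
    (q : 'cV[F]_n -> F) (hq : is_quadratic_form q) (P G : 'M[F]_n) (lev : 'I_n -> nat)
    (s : 'I_n -> bool) (fr : jordan_frame A q P G lev s) (X : 'M[F]_n) :
  preserves A q X -> tangent A q P lev s X.
Proof.
move=> hX b a; set E : comAlgType F := F^o.
have sub := regular_subalg hA.
have eX : @ext_preserves F A n q E A (map_mx (in_alg E) X).
  by move=> i; have [h1 h2 h3] := hX i; split; exact: maps_into_map.
have := ext_tangent hA hq fr sub eX b a.
rewrite /ext_dv /ext_pair !map_regular => /= h.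
apply/(dvE hA); rewrite mulrC -(dual_rowE hA hq fr).
by move: h; rewrite {1}/GRing.scale /= mulr1.
Qed.

(** * A basis of the tangent lattice *)

Section PairIndexing.
Variable n : nat.
Local Notation d := 'C(n, 2).
Local Notation u := #|upper n|.

Lemma card_lower : #|~: upper n| = d.
Proof.
apply: (@addIn u); rewrite dim_fiber_base addnC cardsC.
by rewrite card_prod !card_ord.
Qed.

(** Pairs a > b come first, as they will index the kernel of the differential; pairs a <= b index
    the symmetric matrices. *)
Definition pair_of (k : 'I_(d + u)) : 'I_n * 'I_n :=
  match fintype.split k with
  | inl j => enum_val (cast_ord (esym card_lower) j)
  | inr j => enum_val j
  end.

Lemma pair_of_rshift j : pair_of (rshift d j) = enum_val j.
Proof.
by rewrite /pair_of; have -> : fintype.split (rshift d j) = inr j by exact: (unsplitK (inr j)).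
Qed.

Lemma pair_of_inj : injective pair_of.
Proof.
move=> k l; rewrite -[k]splitK -[l]splitK /pair_of !unsplitK.
case: (fintype.split k) (fintype.split l) => [j|j] [j'|j'] /= e.
- by rewrite (cast_ord_inj (enum_val_inj e)).
- have := enum_valP (cast_ord (esym card_lower) j); rewrite e inE.
  by rewrite enum_valP.
- have := enum_valP (cast_ord (esym card_lower) j'); rewrite -e inE.
  by rewrite enum_valP.
- by rewrite (enum_val_inj e).
Qed.

Lemma pair_of_onto p : p \in codom pair_of.
Proof.
apply: (inj_card_onto pair_of_inj).
by rewrite card_prod !card_ord dim_fiber_base.
Qed.

Definition index_of p : 'I_(d + u) := iinv (pair_of_onto p).

Lemma index_ofK p : pair_of (index_of p) = p.
Proof. exact: f_iinv. Qed.

Lemma pair_ofK k : index_of (pair_of k) = k.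
Proof. by apply: pair_of_inj; rewrite index_ofK. Qed.

Definition swap (p : 'I_n * 'I_n) := (p.2, p.1).

Variables (F : fieldType) (A : set F) (hA : complete_dvr A).

(* In these coordinates a matrix Y is determined by the entries Y_ab, a > b,
   and Y_ab + Y_ba, a < b. *)
Definition fold_mx (e : F) : 'M[F]_(d + u) :=
  \matrix_(k, l) ((k == l)%:R + e * (((pair_of l).1 < (pair_of l).2)%N &&
     (k == index_of (swap (pair_of l))))%:R).

Lemma fold_mxE e (c : 'rV[F]_(d + u)) l : (c *m fold_mx e) 0 l =
  c 0 l + e * (if ((pair_of l).1 < (pair_of l).2)%N then c 0 (index_of (swap (pair_of l))) else 0).
Proof.
rewrite mxE; under eq_bigr do rewrite mxE mulrDr mulrCA.
rewrite big_split /= -mulr_sumr (bigD1 l) //= eqxx mulr1 big1 ?addr0; last first.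
  by move=> k /negPf ->; rewrite mulr0.
congr (_ + _ * _); case: ifP => _; last by rewrite big1 // => k _; rewrite mulr0.
rewrite (bigD1 (index_of (swap (pair_of l)))) //= eqxx mulr1 big1 ?addr0 //.
by move=> k /negPf ->; rewrite mulr0.
Qed.

(** Entries a < b receive multiples of entries a > b, which stay unchanged, so the parameters of
    successive foldings add up. *)
Lemma fold_mxK e : fold_mx e *m fold_mx (- e) = 1%:M.
Proof.
apply/row_matrixP => i; rewrite !rowE mulmxA mulmx1; apply/rowP => l.
rewrite !fold_mxE index_ofK; case: ltnP => // h; last by ring.
by rewrite ltnNge (ltnW h) /=; ring.
Qed.

Lemma fold_mx_int e : A e -> integral_mx A (fold_mx e).
Proof.
move=> Ae i j; rewrite mxE; apply: (dvrD hA); first exact: dvr_nat.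
by apply: (dvrM hA) => //; exact: dvr_nat.
Qed.

Definition index_mx : 'M[F]_(d + u, n * n) :=
  \matrix_(k, j) (mxvec_index (pair_of k).1 (pair_of k).2 == j)%:R.

Lemma index_mxE (c : 'rV[F]_(d + u)) a b : vec_mx (c *m index_mx) a b = c 0 (index_of (a, b)).
Proof.
rewrite mxE mxE (bigD1 (index_of (a, b))) //= big1 ?addr0.
  by rewrite mxE index_ofK eqxx mulr1.
move=> k ne; rewrite mxE; case: eqP => [e|_]; last by rewrite mulr0.
have [g gK _] := @curry_mxvec_bij n n.
have /(congr1 g) : uncurry (@mxvec_index n n) (pair_of k) = uncurry (@mxvec_index n n) (a, b).
  by rewrite /= -e; case: (pair_of k).
by rewrite !gK // => e'; rewrite -e' pair_ofK eqxx in ne.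
Qed.

Lemma index_mx_tr (Y : 'M[F]_n) k :
  (mxvec Y *m index_mx^T) 0 k = Y (pair_of k).1 (pair_of k).2.
Proof.
rewrite mxE (bigD1 (mxvec_index (pair_of k).1 (pair_of k).2)) //= !mxE eqxx mulr1.
rewrite big1 ?addr0 ?mxvecE // => j /negPf ne.
by rewrite !mxE eq_sym ne mulr0.
Qed.

Lemma index_mxK : index_mx *m index_mx^T = 1%:M.
Proof.
apply/row_matrixP => i; rewrite !rowE mulmxA mulmx1; apply/rowP => l.
rewrite -[_ *m index_mx]vec_mxK index_mx_tr index_mxE -[RHS](congr1 _ (pair_ofK l)).
by congr (_ _ (index_of _)); case: (pair_of l).
Qed.

Lemma index_mxK' : index_mx^T *m index_mx = 1%:M.
Proof.
apply/row_matrixP => i; rewrite !rowE mulmxA mulmx1; apply: (can_inj vec_mxK).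
apply/matrixP => a b; rewrite index_mxE -[delta_mx _ _]vec_mxK index_mx_tr index_ofK.
by rewrite vec_mxK.
Qed.

Lemma index_mx_int : integral_mx A index_mx.
Proof. by move=> i j; rewrite mxE; apply: dvr_nat. Qed.

End PairIndexing.

Section SymmetricCongruence.
Variables (F : fieldType) (A : set F) (hA : complete_dvr A) (n : nat).
Local Notation u := #|upper n|.

Definition sym_delta (k : 'I_u) : 'M[F]_n :=
  \matrix_(i, j) ((enum_val k == (i, j)) || (enum_val k == (j, i)))%:R.

Lemma sym_delta_tr k : (sym_delta k)^T = sym_delta k.
Proof. by apply/matrixP => i j; rewrite !mxE orbC. Qed.

Lemma upperP (k : 'I_u) : ((enum_val k).1 <= (enum_val k).2)%N.
Proof. by have := enum_valP k; rewrite inE. Qed.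

Lemma symcoord_delta k : symcoord (sym_delta k) = delta_mx 0 k.
Proof.
apply/rowP => l; rewrite !mxE eqxx /=.
have [<-|ne] := eqVneq k l; first by rewrite -surjective_pairing eqxx.
have ne' : enum_val k != enum_val l by apply: contraNneq ne => /enum_val_inj ->.
rewrite -surjective_pairing (negPf ne') /=.
case: eqP => // e; have := upperP k; have := upperP l; rewrite e /= => h1 h2.
have e12 : (enum_val l).1 = (enum_val l).2 by apply: val_inj; apply/eqP; rewrite eqn_leq h1 h2.
by move: ne'; rewrite e [enum_val l]surjective_pairing /= e12 eqxx.
Qed.

Lemma sym_expand (Y : 'M[F]_n) : Y^T = Y -> Y = \sum_k symcoord Y 0 k *: sym_delta k.
Proof.
move=> sY; apply/eqP; rewrite -subr_eq0; apply/eqP; apply: symcoord_inj.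
  rewrite trmxB sY; congr (_ - _); apply/matrixP => i j; rewrite mxE !summxE.
  by apply: eq_bigr => k _; rewrite !mxE orbC.
apply/rowP => l; rewrite !mxE summxE (bigD1 l) //= big1 ?addr0.
  have := congr1 (fun v : 'rV_u => v 0 l) (symcoord_delta l).
  by rewrite !mxE !eqxx => ->; rewrite mulr1 subrr.
move=> k ne; have : symcoord (sym_delta k) 0 l = 0.
  by rewrite symcoord_delta mxE eqxx eq_sym (negPf ne).
by rewrite mxE => h; rewrite mxE h mulr0.
Qed.

(** The change of frame Y |-> Q^T Y Q on symmetric matrices in upper coordinates. Being
    multiplicative in Q, it has unit determinant for Q invertible over A and does not affect
    covolumes. *)
Definition congruence_mx (Q : 'M[F]_n) : 'M[F]_u :=
  \matrix_k symcoord (Q^T *m sym_delta k *m Q).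

Lemma congruence_mxE Q (Y : 'M[F]_n) : Y^T = Y ->
  symcoord Y *m congruence_mx Q = symcoord (Q^T *m Y *m Q).
Proof.
move=> sY; rewrite {2}(sym_expand sY) mulmx_sumr mulmx_suml mulmx_sum_row.
apply/rowP => l; rewrite summxE [RHS]mxE summxE; apply: eq_bigr => k _.
by rewrite rowK -scalemxAr -scalemxAl !mxE.
Qed.

Lemma congruence_mxM Q Q' : congruence_mx Q *m congruence_mx Q' = congruence_mx (Q *m Q').
Proof.
apply/row_matrixP => k; rewrite row_mul !rowK congruence_mxE.
  by rewrite trmx_mul !mulmxA.
by rewrite !trmx_mul trmxK sym_delta_tr mulmxA.
Qed.

Lemma congruence_mx1 : congruence_mx 1%:M = 1%:M.
Proof. by apply/row_matrixP => k; rewrite rowK trmx1 mul1mx mulmx1 symcoord_delta row1. Qed.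

Lemma congruence_mx_int Q : integral_mx A Q -> integral_mx A (congruence_mx Q).
Proof.
move=> iQ k l; rewrite mxE [symcoord _ 0 l]mxE; apply: (integral_mxM hA) => //; apply: (integral_mxM hA).
  exact: integral_tr.
by move=> i j; rewrite mxE; apply: dvr_nat.
Qed.

End SymmetricCongruence.

Lemma diag_mulmx_eq1 (F : fieldType) n (v v' : 'rV[F]_n) :
  (forall i, v 0 i * v' 0 i = 1) -> diag_mx v *m diag_mx v' = 1%:M.
Proof.
move=> h; apply/matrixP => i j; rewrite mul_diag_mx !mxE.
by case: eqP => [->|_]; rewrite ?mulr1n ?mulr0n ?mulr0.
Qed.

Section TangentBasis.
Variables (F : fieldType) (A : set F) (hA : complete_dvr A) (n : nat) (q : 'cV[F]_n -> F).
Hypothesis hq : is_quadratic_form q.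
Variables (P G : 'M[F]_n) (lev : 'I_n -> nat) (s : 'I_n -> bool).
Hypothesis fr : jordan_frame A q P G lev s.
Hypothesis Su : gram q \in unitmx.
Local Notation d := 'C(n, 2).
Local Notation u := #|upper n|.
Local Notation int := (integral_mx A).
Local Notation w := (weight lev s).
Local Notation S := (gram q).
Let two0 := dvr_two_neq0 hA.
Let twoX0 k : (2 : F) ^+ k != 0. Proof. exact: expf_neq0. Qed.
Let Pu : P \in unitmx. Proof. exact: det_unit_unitmx (fr_Pdet fr). Qed.
Let Gu : G \in unitmx. Proof. exact: det_unit_unitmx (fr_Gdet fr). Qed.
Let iP : int P. Proof. exact: fr_P fr. Qed.
Let iG : int G. Proof. exact: fr_G fr. Qed.
Let iP' : int (invmx P). Proof. exact: integral_invmx (fr_Pdet fr). Qed.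
Let iG' : int (invmx G). Proof. exact: integral_invmx (fr_Gdet fr). Qed.

Definition frame_scale (p : 'I_n * 'I_n) : F := 2 ^+ (w p.1 p.2 - lev p.1).
Local Notation fs := frame_scale.
Definition scale_row : 'rV[F]_(d + u) := \row_k fs (pair_of k).
Definition scale_row' : 'rV[F]_(d + u) := \row_k (fs (pair_of k))^-1.

(** Y = G P^-1 X P has the entries [dual_coord] a of X v_b ([frame_mxE]); [frame_lin] passes from Y
    to X. *)
Definition frame_lin : 'M[F]_(n * n) :=
  lin_mx (mulmx (P *m invmx G)) *m lin_mx (mulmxr (invmx P)).
Definition frame_lin' : 'M[F]_(n * n) :=
  lin_mx (mulmx (G *m invmx P)) *m lin_mx (mulmxr P).

(** The folding recovers the two scaled entries from one of them and their sum. The weight being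
    symmetric, for a < b the number <v_a, X v_b> + <v_b, X v_a> is 2^w(a,b) times the coordinate of
    index (a, b), so the coordinates with a > b span the kernel of the differential. *)
Definition tan_basis : 'M[F]_(d + u, n * n) :=
  fold_mx n (- 1) *m diag_mx scale_row *m index_mx n F *m frame_lin.
Definition tan_basis' : 'M[F]_(n * n, d + u) :=
  frame_lin' *m ((index_mx n F)^T *m diag_mx scale_row' *m fold_mx n 1).

(** The additional 2 at a = b is that of 2 <v_a, X v_a>, the diagonal entry of the differential. *)
Definition target_scale : 'rV[F]_u :=
  \row_k 2 ^+ (w (enum_val k).1 (enum_val k).2 + ((enum_val k).1 == (enum_val k).2)).
Definition target_scale' : 'rV[F]_u :=
  \row_k 2 ^- (w (enum_val k).1 (enum_val k).2 + ((enum_val k).1 == (enum_val k).2)).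
Definition target_basis : 'M[F]_u := diag_mx target_scale *m congruence_mx (invmx P).
Definition target_basis' : 'M[F]_u := congruence_mx P *m diag_mx target_scale'.

Lemma frame_linE (Y : 'M[F]_n) : mxvec Y *m frame_lin = mxvec (P *m invmx G *m Y *m invmx P).
Proof. by rewrite /frame_lin mulmxA !mul_vec_lin. Qed.

Lemma frame_linE' (E : comAlgType F) (X : 'M[E]_n) :
  mxvec X *m map_mx (in_alg E) frame_lin' =
  mxvec (map_mx (in_alg E) (G *m invmx P) *m X *m map_mx (in_alg E) P).
Proof.
rewrite map_mxM mulmxA (map_lin_mx (gf := mulmx (map_mx (in_alg E) (G *m invmx P)))); last first.
  by move=> Y; rewrite map_mxM.
rewrite (map_lin_mx (gf := mulmxr (map_mx (in_alg E) P))); last by move=> Y; rewrite /= map_mxM.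
by rewrite !mul_vec_lin.
Qed.

Lemma frame_linF' (X : 'M[F]_n) : mxvec X *m frame_lin' = mxvec (G *m invmx P *m X *m P).
Proof. by rewrite /frame_lin' mulmxA !mul_vec_lin. Qed.

Lemma frame_linK : frame_lin *m frame_lin' = 1%:M.
Proof.
apply/row_matrixP => i; rewrite !rowE mulmxA mulmx1 -[delta_mx _ _]vec_mxK frame_linE frame_linF'.
by rewrite !mulmxA mulmxKV // mulmxKV // mulmxV // mul1mx.
Qed.

Lemma frame_lin_int : int frame_lin /\ int frame_lin'.
Proof.
have h1 (g : 'M[F]_n) : int g -> int (lin_mx (mulmx g)).
  by move=> ig; apply: (lin_mx_int hA) => X; exact: integral_mxM.
have h2 (g : 'M[F]_n) : int g -> int (lin_mx (mulmxr g : 'M[F]_n -> 'M[F]_n)).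
  by move=> ig; apply: (lin_mx_int hA) => X iX; exact: integral_mxM.
split; apply: (integral_mxM hA); rewrite ?h1 ?h2 //; [apply: h1 | exact: h2 | apply: h1 | exact: h2];
  exact: integral_mxM.
Qed.

Lemma scale_rowK : diag_mx scale_row *m diag_mx scale_row' = 1%:M.
Proof.
by apply: diag_mulmx_eq1 => k; rewrite !mxE mulfV // twoX0.
Qed.

Lemma tan_basisK : tan_basis *m tan_basis' = 1%:M.
Proof.
rewrite /tan_basis /tan_basis'.
have -> : fold_mx n (-1) *m diag_mx scale_row *m index_mx n F *m frame_lin *m
    (frame_lin' *m ((index_mx n F)^T *m diag_mx scale_row' *m fold_mx n 1)) =
    fold_mx n (-1) *m (diag_mx scale_row *m ((index_mx n F *m (frame_lin *m frame_lin'
      *m (index_mx n F)^T)) *m diag_mx scale_row')) *m fold_mx n 1 by rewrite !mulmxA.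
rewrite frame_linK mul1mx index_mxK mul1mx scale_rowK mulmx1.
by rewrite -{2}[1]opprK fold_mxK.
Qed.

Lemma tan_basisK' : tan_basis' *m tan_basis = 1%:M.
Proof.
rewrite /tan_basis /tan_basis'.
have -> : frame_lin' *m ((index_mx n F)^T *m diag_mx scale_row' *m fold_mx n 1) *m
    (fold_mx n (-1) *m diag_mx scale_row *m index_mx n F *m frame_lin) =
    frame_lin' *m ((index_mx n F)^T *m (diag_mx scale_row' *m (fold_mx n 1 *m fold_mx n (-1))
      *m diag_mx scale_row) *m index_mx n F) *m frame_lin by rewrite !mulmxA.
rewrite fold_mxK mulmx1 (mulmx1C scale_rowK) mulmx1 index_mxK' mulmx1.
exact: mulmx1C frame_linK.
Qed.

Lemma scale_row_int : int (diag_mx scale_row).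
Proof.
move=> i j; rewrite !mxE; apply: (dv_int hA (k := 0)); apply/(dv0E hA).
by case: eqP => _; rewrite ?mulr1n ?mulr0n; [apply: (dvrX hA); apply: dvr_nat | apply: dvr0].
Qed.

Let A1 : A 1. Proof. exact: dvr1. Qed.
Let AN1 : A (-1). Proof. exact: dvrN. Qed.

Lemma tan_basis_int : int tan_basis.
Proof.
have [iL _] := frame_lin_int.
apply: (integral_mxM hA) => //; apply: (integral_mxM hA); last exact: index_mx_int.
apply: (integral_mxM hA); last exact: scale_row_int.
exact: fold_mx_int.
Qed.

Lemma tan_basisE (c : 'rV[F]_(d + u)) a b :
  (G *m invmx P *m vec_mx (c *m tan_basis) *m P) a b =
  fs (a, b) * (c 0 (index_of (a, b)) - (if (a < b)%N then c 0 (index_of (b, a)) else 0)).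
Proof.
have -> : G *m invmx P *m vec_mx (c *m tan_basis) *m P =
    vec_mx (c *m (fold_mx n (- 1) *m diag_mx scale_row *m index_mx n F)).
  apply: (can_inj mxvecK); rewrite -frame_linF' !vec_mxK /tan_basis -[LHS]mulmxA.
  by congr (c *m _); rewrite -[LHS]mulmxA frame_linK mulmx1.
rewrite !mulmxA index_mxE mul_mx_diag [LHS]mxE fold_mxE mxE index_ofK /swap /= mulN1r mulrC.
by [].
Qed.

Lemma frame_mxE (X : 'M[F]_n) a b :
  (G *m invmx P *m X *m P) a b = dual_coord q P lev a (X *m col b P).
Proof.
rewrite -(dual_rowE hA hq fr) /dual_row -row_mul.
have -> : row a (G *m invmx P *m (X *m col b P)) = row a (col b (G *m invmx P *m X *m P)).
  by rewrite !colE !mulmxA.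
by rewrite !mxE.
Qed.

Lemma tangentP (X : 'M[F]_n) : tangent A q P lev s X <-> int (mxvec X *m tan_basis').
Proof.
split=> [tX|iX a b].
  rewrite /tan_basis' mulmxA frame_linF' mulmxA mulmxA; apply: (integral_mxM hA); last exact: fold_mx_int.
  move=> i k; rewrite ord1 mul_mx_diag mxE index_mx_tr frame_mxE [scale_row' _ _]mxE.
  exact/(dvE hA)/tX.
rewrite -frame_mxE -[X]mxvecK -[mxvec X]mulmx1 -tan_basisK' mulmxA tan_basisE.
apply: dv_mul; apply: (dvrB hA) => //; case: ifP => _ //; exact: dvr0.
Qed.

Lemma tan_basis_tangent (c : 'rV[F]_(d + u)) : int c ->
  tangent A q P lev s (vec_mx (c *m tan_basis)).
Proof. by move=> ic; apply/tangentP; rewrite vec_mxK -mulmxA tan_basisK mulmx1. Qed.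

Lemma congruence_bil (X : 'M[F]_n) a b :
  (P^T *m (X^T *m S *m X) *m P) a b = bil q (X *m col a P) (X *m col b P).
Proof.
have -> : P^T *m (X^T *m S *m X) *m P = (X *m P)^T *m S *m (X *m P) by rewrite trmx_mul !mulmxA.
by rewrite gram_mulmx // !colE !mulmxA.
Qed.

Lemma target_basisE (Y : 'M[F]_n) k : Y^T = Y -> (symcoord Y *m target_basis') 0 k =
  (P^T *m Y *m P) (enum_val k).1 (enum_val k).2 /
  2 ^+ (w (enum_val k).1 (enum_val k).2 + ((enum_val k).1 == (enum_val k).2)).
Proof. by move=> sY; rewrite mulmxA congruence_mxE // mul_mx_diag !mxE. Qed.

Lemma target_basisK : target_basis *m target_basis' = 1%:M.
Proof.
rewrite /target_basis /target_basis' mulmxA -(mulmxA (diag_mx _)) congruence_mxM mulVmx //.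
by rewrite congruence_mx1 mulmx1; apply: diag_mulmx_eq1 => k; rewrite !mxE mulfV // twoX0.
Qed.

Lemma tan_basis_dr (c : 'rV[F]_(d + u)) : let X := vec_mx (c *m tan_basis) in
  symcoord (X^T *m S + S *m X) *m target_basis' = rsubmx c.
Proof.
move=> X; apply/rowP => k; have St := gram_sym q.
rewrite target_basisE; last by rewrite trmxD !trmx_mul trmxK St addrC.
set a := (enum_val k).1; set b := (enum_val k).2.
have e1 x y : (P^T *m (S *m X) *m P) x y = 2 ^+ lev x * (G *m invmx P *m X *m P) x y.
  have -> : P^T *m (S *m X) *m P = P^T *m S *m (X *m P) by rewrite !mulmxA.
  by rewrite gram_mulmx // frame_mxE -(bil_frame hA) !colE !mulmxA.
have e2 x y : (P^T *m (X^T *m S) *m P) x y = (P^T *m (S *m X) *m P) y x.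
  have -> : P^T *m (X^T *m S) *m P = (P^T *m (S *m X) *m P)^T by rewrite !trmx_mul trmxK St !mulmxA.
  by rewrite [LHS]mxE.
have e3 x y : 2 ^+ lev x * fs (x, y) = 2 ^+ w x y :> F.
  by rewrite /fs -exprD subnKC //=; have := weight_max lev s x y; lia.
rewrite mulmxDr mulmxDl mxE e2 !e1 !tan_basisE !mulrA !e3 (weightC lev s b a).
have -> : rsubmx c 0 k = c 0 (rshift d k) by rewrite mxE.
have -> : rshift d k = index_of (a, b).
  by apply: pair_of_inj; rewrite index_ofK pair_of_rshift -surjective_pairing.
have ab : (a <= b)%N := upperP k.
have [e|ne] := eqVneq a b.
  rewrite e ltnn !subr0 -mulrDl.
  have -> : 2 ^+ w b b + 2 ^+ w b b = 2 ^+ (w b b + 1) :> F by rewrite addn1 exprS mulr_natl mulr2n.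
  by rewrite mulrAC mulfV ?mul1r.
have lt : (a < b)%N by rewrite ltn_neqAle ne.
by rewrite lt ltnNge ab /= addn0 subr0 -mulrDr addrC subrK mulrAC mulfV ?mul1r.
Qed.

Lemma adjoint_mul_bil (X Y : 'M[F]_n) a b :
  bil q (X *m col a P) (Y *m col b P) =
  2 ^+ lev a * dual_coord q P lev a (adjoint q X *m Y *m col b P).
Proof. by rewrite bil_adjoint // -(bil_frame hA) mulmxA. Qed.

(** Proved through the mapping conditions, which compose, whereas the weight inequalities alone are
    awkward to multiply. *)
Lemma tangent_mul X Y : tangent A q P lev s X -> tangent A q P lev s Y ->
  tangent A q P lev s (X *m Y).
Proof.
move=> /(tangent_preserves hA hq fr Su) hX /(tangent_preserves hA hq fr Su) hY.
by apply: (preserves_tangent hA hq fr); exact: (preserves_mul hA hq fr).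
Qed.

(** Off the diagonal, <X v_a, X v_b> is <v_a, X' X v_b> with X' the adjoint, and X' X is tangent. On
    the diagonal q(X v_a) needs one more 2 than w(a,a): it comes from B_i in general, and from Z_i
    when v_a is special. *)
Lemma tan_basis_quad (c : 'rV[F]_(d + u)) : int c -> let X := vec_mx (c *m tan_basis) in
  int (symcoord (X^T *m S *m X) *m target_basis').
Proof.
move=> /tan_basis_tangent; set X := vec_mx _ => tX /= i k; rewrite ord1.
rewrite target_basisE; last by rewrite !trmx_mul trmxK gram_sym mulmxA.
set a := (enum_val k).1; set b := (enum_val k).2; rewrite congruence_bil.
apply/(dvE hA); have [e|ne] := eqVneq a b; last first.
  rewrite addn0 adjoint_mul_bil; have := weight_max lev s a b => h.
  rewrite -(@subnKC (lev a) (w a b)); last by lia.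
  apply/(dv_shift hA); apply: tangent_mul => //; exact: (tangent_adjoint hA hq fr).
have [hAB hW _] := tangent_preserves hA hq fr Su tX (lev a).
rewrite -e bil_xx // /weight eqxx maxnn orbb andTb.
have -> : (((lev a).+1 == lev a) || ((lev a).+1 == lev a)) = false by lia.
rewrite andbF addn0 -addnA.
have half k' x : pow2A A 1 (qi q k' x) -> pow2A A (k' + 1) (q x).
  by move=> h; have -> : q x = 2 ^+ k' * qi q k' x; [rewrite /qi mulVKf | apply/(dv_shift hA)].
have [_ hB] := hAB _ (latA_frame hA hq fr a).
case: (boolP (s a)) => sa; last by rewrite add0n; exact: half.
have [_ [_ hZ]] : (latX A q (lev a) `&` latZ A q (lev a)) (X *m col a P).
  apply: hW; apply/(latWP hA hq fr); exists 1; first exact: dvr1.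
  rewrite (special_vec_frame fr sa) scale1r subrr (latXE hA hq fr); exact: frame_lat0.
have -> : (lev a + (true + true) = (lev a).+1 + 1)%N by rewrite addnA !addn1.
exact: half.
Qed.

Lemma tan_basis_tangent_basis : tangent_basis A S tan_basis tan_basis' target_basis target_basis'.
Proof.
split.
- exact: gram_sym.
- exact: Su.
- exact: tan_basisK.
- exact: tan_basisK'.
- exact: tan_basis_int.
- exact: target_basisK.
- exact: tan_basis_dr.
- exact: tan_basis_quad.
- by move=> c c' /tan_basis_tangent h /tan_basis_tangent h'; apply/tangentP; exact: tangent_mul.
- move=> g hg; apply/tangentP; apply: (preserves_tangent hA hq fr).
  exact: (Aut_L_preserves hA hq fr).
Qed.

(** Points of M satisfy the weight inequalities over T by [ext_tangent]; conversely m - 1 is a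
    T-combination of basis matrices, each satisfying the mapping conditions over A. *)
Lemma uM_coords (E : comAlgType F) (T : set E) : is_A_subalgebra A T ->
  forall m, uM A q T m <-> forall k, T (coE tan_basis' m 0 k).
Proof.
move=> hT m; have [TA _ TM] := hT.
have rT := subalgebra_subring hA hT.
rewrite (uM_preserves hA hq fr); split=> [[_ hX] k|hc].
  rewrite /coE /tan_basis' map_mxM mulmxA frame_linE'.
  rewrite [map_mx _ (_ *m fold_mx _ _)]map_mxM mulmxA mxE; apply: (subring_set_sum rT) => l _.
  apply: TM; last by rewrite mxE; apply: TA; exact: fold_mx_int.
  rewrite map_mxM mulmxA map_diag_mx mul_mx_diag [X in T X]mxE.
  have -> (Y : 'M[E]_n) : (mxvec Y *m map_mx (in_alg E) (index_mx n F)^T) 0 l =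
      Y (pair_of l).1 (pair_of l).2.
    rewrite mxE (bigD1 (mxvec_index (pair_of l).1 (pair_of l).2)) //= !mxE eqxx.
    rewrite rmorph1 mulr1 big1 ?addr0 ?mxvecE // => j /negPf ne.
    by rewrite !mxE eq_sym ne rmorph0 mulr0.
  have := ext_tangent hA hq fr hT hX (pair_of l).1 (pair_of l).2.
  by rewrite ext_pair_mx /ext_dv mulrC !mxE.
have tg i : tangent A q P lev s (tX tan_basis (delta_mx 0 i)).
  by apply: tan_basis_tangent; exact: integral_delta.
have em := coE_expand tan_basis_tangent_basis m.
have em1 : m - 1%:M = \sum_i coE tan_basis' m 0 i *:
    map_mx (in_alg E) (tX tan_basis (delta_mx 0 i)) by rewrite {1}em addrC addKr.
split=> [i j|i].
  rewrite em !mxE summxE; apply: (subring_setD rT); first exact: subring_set_nat.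
  apply: (subring_set_sum rT) => k _; rewrite [X in T X]mxE; apply: (TM) => //; rewrite [X in T X]mxE; apply: (TA).
  by rewrite mxE -rowE mxE; exact: tan_basis_int.
rewrite em1; split; apply: (maps_into_sum hT) => // k; apply: maps_into_map;
  by have [] := tangent_preserves hA hq fr Su (tg k) i.
Qed.

Variables (R : realType) (f : nat) (hf : (1 < f)%N).

Lemma absF_expn k : absF R A f (2 ^+ k) = f%:R ^- k.
Proof.
have -> : 2 ^+ k = 2 ^ k%:Z :> F by [].
by rewrite (absF_pow2 hA R hf) exprnN.
Qed.

Lemma castmx_det_unit m N (e : m = N) (B : 'M[F]_(m, N)) (B' : 'M[F]_(N, m)) :
  int B -> int B' -> B *m B' = 1%:M -> A_unit A (\det (castmx (e, erefl) B)).
Proof. by case: N / e B B' => B B' iB iB' e; rewrite castmx_id; exact: (integral_mulmx1_det hA iB iB'). Qed.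

Lemma tan_basis_volume : absF R A f (\det (castmx (dim_fiber_base n, erefl) tan_basis)) =
  f%:R ^- (\sum_(p : 'I_n * 'I_n) (w p.1 p.2 - lev p.1)).
Proof.
rewrite /tan_basis det_castmx_mul det_mulmx !(absFM hA R hf).
rewrite (absF_unit hA R hf (integral_mulmx1_det hA _ _ (fold_mxK _ _))); last first.
- by rewrite opprK; exact: fold_mx_int.
- exact: fold_mx_int.
rewrite (absF_unit hA R hf (castmx_det_unit _ _ _ (index_mxK n F))); last first.
- by apply: integral_tr; exact: index_mx_int.
- exact: index_mx_int.
have [i1 i2] := frame_lin_int.
rewrite (absF_unit hA R hf (integral_mulmx1_det hA i1 i2 frame_linK)).
rewrite mul1r !mulr1 det_diag; under eq_bigr do rewrite mxE.
rewrite prodrXr absF_expn; congr (_ ^- _); rewrite [RHS](reindex (@pair_of n)) //=.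
by exists (@index_of n) => k _; rewrite ?index_ofK ?pair_ofK.
Qed.

Lemma target_basis_volume : absF R A f (\det target_basis) =
  f%:R ^- (\sum_(p in upper n) (w p.1 p.2 + (p.1 == p.2))).
Proof.
rewrite /target_basis det_mulmx (absFM hA R hf).
have e : congruence_mx (invmx P) *m congruence_mx P = 1%:M.
  by rewrite congruence_mxM mulVmx // congruence_mx1.
rewrite (absF_unit hA R hf (integral_mulmx1_det hA _ _ e)); try exact: congruence_mx_int.
rewrite mulr1 det_diag; under eq_bigr do rewrite mxE.
rewrite prodrXr absF_expn; congr (_ ^- _); rewrite [RHS]big_enum_val.
by apply: eq_bigr => k _.
Qed.

End TangentBasis.

(** * The exponent *)

Section Exponent.
Variables (n r : nat) (ni : nat -> nat) (ty : nat -> bool) (lev : 'I_n -> nat) (s : 'I_n -> bool).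
Hypothesis hc : forall k, #|[pred a | lev a == k]| = ni k.
Hypothesis hr : forall a, (lev a < r)%N.
Hypothesis hu : forall a b, s a -> s b -> lev a = lev b -> a = b.
Hypothesis ht : forall k, ty k <-> exists2 a, s a & lev a = k.
Local Notation w := (weight lev s).
Local Open Scope nat_scope.

Lemma level_sum (g : nat -> nat) : \sum_a g (lev a) = \sum_(i < r) ni i * g i.
Proof.
rewrite (partition_big (fun a => Ordinal (hr a)) xpredT) //=; apply: eq_bigr => i _.
rewrite -hc -sum_nat_const; apply: eq_big => [a|a /eqP <- //].
by rewrite -val_eqE.
Qed.

Lemma special_level_sum (g : nat -> nat) : \sum_(a | s a) g (lev a) = \sum_(i < r) ty i * g i.
Proof.
rewrite (partition_big (fun a => Ordinal (hr a)) xpredT) //=; apply: eq_bigr => i _.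
case: (boolP (ty i)) => [/ht[a sa ea]|no]; last first.
  rewrite mul0n big_pred0 // => a; apply/negP => /andP[sa /eqP e].
  by case/negP: no; apply/ht; exists a; rewrite // -e.
rewrite mul1n (big_pred1 a) ?ea // => b; apply/andP/eqP => [[sb /eqP e]|->].
  by apply: hu => //; rewrite ea -e.
by split; rewrite // -val_eqE /= ea.
Qed.

Lemma upper_sum (g : 'I_n -> 'I_n -> nat) : (forall a b, g a b = g b a) ->
  2 * \sum_(p in upper n) g p.1 p.2 = \sum_a \sum_b g a b + \sum_a g a a.
Proof.
move=> gC; have pairE (Q : 'I_n -> 'I_n -> bool) (h : 'I_n -> 'I_n -> nat) :
    \sum_(p : 'I_n * 'I_n | Q p.1 p.2) h p.1 p.2 = \sum_a \sum_(b | Q a b) h a b.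
  by rewrite pair_big_dep.
rewrite (eq_bigl (fun p : 'I_n * 'I_n => p.1 <= p.2)); last by move=> p; rewrite inE.
rewrite (pairE (fun a b : 'I_n => a <= b)).
have {1}-> : \sum_a \sum_b g a b =
    \sum_(a : 'I_n) \sum_(b : 'I_n | a <= b) g a b + \sum_(a : 'I_n) \sum_(b : 'I_n | b < a) g a b.
  rewrite -big_split; apply: eq_bigr => a _ /=.
  rewrite (bigID (fun b : 'I_n => a <= b)) /=; congr (_ + _).
  by apply: eq_bigl => b; rewrite ltnNge.
rewrite mul2n -addnn -addnA; congr (_ + _).
rewrite (exchange_big_dep xpredT) //= -big_split; apply: eq_bigr => b _ /=.
rewrite (bigD1 b) //= addnC; congr (_ + _).
apply: eq_big => [a|a _]; last exact: gC.
by rewrite ltn_neqAle andbC.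
Qed.

Lemma cross_sum (h : nat -> nat -> nat) : (forall i j, h i j = h j i) ->
  \sum_(i < r) \sum_(j < r) h i j = 2 * \sum_(i < r) \sum_(j < r | i < j) h i j + \sum_(i < r) h i i.
Proof.
move=> hC.
have -> : \sum_(i < r) \sum_(j < r) h i j = \sum_(i < r) \sum_(j < r | i < j) h i j +
    \sum_(i < r) \sum_(j < r | j < i) h i j + \sum_(i < r) h i i.
  rewrite -!big_split; apply: eq_bigr => i _ /=.
  rewrite (bigID (fun j : 'I_r => i < j)) /= -addnA; congr (_ + _).
  rewrite (bigD1 i) ?ltnn //= addnC; congr (_ + _); apply: eq_bigl => j.
  by rewrite -leqNgt ltn_neqAle andbC.
rewrite mul2n -addnn; congr (_ + _ + _).
by rewrite (exchange_big_dep xpredT) //=; apply: eq_bigr => i _; apply: eq_bigr => j _.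
Qed.

(** Twice the upper sum is the full sum W plus the diagonal D, and the maximum of two levels is
    their sum minus their minimum. The minima M give the cross terms and, with the total level La,
    the d_i. One t comes from D, another from S2 = 2 cI - t with cI the total rank of type I;
    halving leaves one t, and n - cI is c. The adjacency terms S3 give b. *)
Lemma weight_exponent :
  ((\sum_(p in upper n) (w p.1 p.2 + (p.1 == p.2)))%:Z -
   (\sum_(p : 'I_n * 'I_n) (w p.1 p.2 - lev p.1))%:Z)%R =
  ((\sum_(i < r) ty i)%:Z + (\sum_(i < r) \sum_(j < r | i < j) i * ni i * ni j)%:Z +
   (\sum_(i < r) (i * (ni i * (ni i).+1) %/ 2))%:Z -
   (\sum_(i < r) (ty i && ty i.+1))%:Z + (\sum_(i < r | ~~ ty i) ni i)%:Z)%R.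
Proof.
set t := \sum_(i < r) ty i; set cr := \sum_(i < r) \sum_(j < r | _) _.
set sd := \sum_(i < r) (_ %/ 2); set bb := \sum_(i < r) (ty i && _); set c := \sum_(i < r | _) _.
pose U := \sum_(p in upper n) w p.1 p.2; pose W := \sum_a \sum_b w a b.
pose La := \sum_a lev a; pose D := \sum_a w a a.
pose cI := \sum_(i < r | ty i) ni i.
pose sq := \sum_(i < r) i * ni i * ni i.
have Lr : La = \sum_(i < r) ni i * i by rewrite /La (level_sum id).
have e0 : \sum_(p in upper n) (w p.1 p.2 + (p.1 == p.2)) = U + n.
  rewrite big_split /=; congr (_ + _).
  rewrite (eq_bigl (fun p : 'I_n * 'I_n => true && (p.1 <= p.2))); last by move=> p; rewrite inE.
  rewrite -(pair_big_dep xpredT (fun a b : 'I_n => a <= b) (fun a b : 'I_n => (a == b) : nat)) /=.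
  rewrite (eq_bigr (fun=> 1)) ?sum1_card ?card_ord // => a _.
  by rewrite (bigD1 a) //= eqxx big1 // => b /andP[_ ne]; rewrite eq_sym (negPf ne).
have e1 : \sum_(p : 'I_n * 'I_n) (w p.1 p.2 - lev p.1) + n * La = W.
  rewrite -(pair_bigA _ (fun a b => w a b - lev a)) /=.
  have -> : n * La = \sum_(a : 'I_n) \sum_(b : 'I_n) lev a.
    by rewrite big_distrr /=; apply: eq_bigr => a _; rewrite sum_nat_const card_ord.
  rewrite -big_split; apply: eq_bigr => a _; rewrite -big_split; apply: eq_bigr => b _ /=.
  by rewrite subnK //; have := weight_max lev s a b; lia.
have e2 : 2 * U = W + D by apply: upper_sum => a b; exact: weightC.
have e3 : D = La + t.
  rewrite /D (eq_bigr (fun a => lev a + s a)) => [|a _]; last first.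
    by rewrite /weight eqxx maxnn orbb; lia.
  rewrite big_split /=; congr (_ + _).
  rewrite (eq_bigr (fun a => if s a then 1 else 0)); last by move=> a _; case: (s a).
  rewrite -big_mkcond (special_level_sum (fun=> 1)).
  by apply: eq_bigr => i _; rewrite muln1.
pose S2 := \sum_a \sum_b ((lev a == lev b) && (s a || s b)).
pose S3 := \sum_a \sum_b (s a && s b && (((lev a).+1 == lev b) || ((lev b).+1 == lev a))).
pose M := \sum_a \sum_b minn (lev a) (lev b).
have e4 : W + M = 2 * (n * La) + S2 + S3.
  have -> : 2 * (n * La) = \sum_(a : 'I_n) \sum_(b : 'I_n) (lev a + lev b).
    rewrite (eq_bigr (fun a => n * lev a + La)); last first.
      by move=> a _; rewrite big_split /= sum_nat_const card_ord.
    by rewrite big_split /= sum_nat_const card_ord -big_distrr /= mul2n -addnn.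
  rewrite -!big_split; apply: eq_bigr => a _; rewrite -!big_split; apply: eq_bigr => b _ /=.
  rewrite /weight; lia.
have e5 : M = 2 * cr + sq.
  have -> : M = \sum_(i < r) \sum_(j < r) (minn i j * ni i * ni j).
    rewrite /M (eq_bigr (fun a => \sum_(j < r) ni j * minn (lev a) j)); last first.
      by move=> a _; rewrite (level_sum (minn (lev a))).
    rewrite (level_sum (fun i => \sum_(j < r) ni j * minn i j)); apply: eq_bigr => i _.
    by rewrite big_distrr; apply: eq_bigr => j _ /=; ring.
  rewrite (cross_sum (h := fun i j => minn i j * ni i * ni j)); last first.
    by move=> i j; rewrite minnC mulnAC.
  congr (2 * _ + _); last by apply: eq_bigr => i _; rewrite minnn.
  by apply: eq_bigr => i _; apply: eq_bigr => j ij; rewrite (minn_idPl (ltnW ij)).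
have eI : \sum_(i < r) ty i * ni i = cI.
  by rewrite /cI [RHS]big_mkcond; apply: eq_bigr => i _; case: (ty i); rewrite ?mul1n.
have e6 : S2 + t = 2 * cI.
  have -> : t = \sum_a \sum_b ((lev a == lev b) && (s a && s b)).
    rewrite (eq_bigr (fun a => if s a then 1 else 0)); last first.
      move=> a _; case: (boolP (s a)) => sa; last by rewrite big1 // => b _; rewrite andbF.
      rewrite (bigD1 a) //= eqxx sa big1 ?addn0 // => b ne; apply/eqP; rewrite eqb0.
      by apply: contra ne => /andP[/eqP e sb]; apply/eqP/esym/hu.
    rewrite -big_mkcond (special_level_sum (fun=> 1)).
    by apply: eq_bigr => i _; rewrite muln1.
  have h : \sum_a \sum_b ((lev a == lev b) && s a) = cI.
    rewrite (eq_bigr (fun a => if s a then ni (lev a) else 0)).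
      by rewrite -big_mkcond (special_level_sum ni).
    move=> a _; case: (s a); last by rewrite big1 // => b _; rewrite andbF.
    rewrite -hc -sum1_card [RHS]big_mkcond; apply: eq_bigr => b _.
    by rewrite inE eq_sym andbT; case: eqP.
  have h' : \sum_a \sum_b ((lev a == lev b) && s b) = cI.
    by rewrite exchange_big -h; apply: eq_bigr => a _; apply: eq_bigr => b _; rewrite eq_sym.
  rewrite mul2n -addnn -{1}h -h'.
  rewrite -!big_split; apply: eq_bigr => a _; rewrite -!big_split; apply: eq_bigr => b _ /=.
  by case: eqP; case: (s a); case: (s b).
have e7 : S3 = 2 * bb.
  have h : \sum_a \sum_b (s a && s b && ((lev a).+1 == lev b)) = bb.
    rewrite (eq_bigr (fun a => if s a then (ty (lev a).+1 : nat) else 0)).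
      rewrite -big_mkcond (special_level_sum (fun i => ty i.+1)).
      by apply: eq_bigr => i _; case: (ty i); case: (ty i.+1).
    move=> a _; case: (s a); last by rewrite big1.
    case: (boolP (ty (lev a).+1)) => [/ht[b sb eb]|no].
      rewrite (bigD1 b) //= sb eb eqxx big1 // => b' ne; apply/eqP; rewrite eqb0.
      by apply: contra ne => /andP[sb' /eqP e]; apply/eqP/hu; rewrite // -e.
    rewrite big1 // => b _; apply/eqP; rewrite eqb0.
    by apply: contra no => /andP[sb /eqP e]; apply/ht; exists b.
  have h' : \sum_a \sum_b (s a && s b && ((lev b).+1 == lev a)) = bb.
    by rewrite exchange_big -h; apply: eq_bigr => a _; apply: eq_bigr => b _; rewrite (andbC (s b)).
  rewrite mul2n -addnn -{1}h -h'.
  rewrite -!big_split; apply: eq_bigr => a _; rewrite -!big_split; apply: eq_bigr => b _ /=.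
  by case: (s a && s b) => //=; lia.
have e8 : 2 * sd = sq + La.
  rewrite Lr big_distrr -big_split; apply: eq_bigr => i _ /=.
  have : 2 %| ni i * (ni i).+1 by rewrite dvdn2 oddM /= andbN.
  by move=> /(dvdn_mull i)/divnK; rewrite mulnC => ->; lia.
have e9 : n = cI + c.
  rewrite -[LHS]card_ord -sum1_card (level_sum (fun=> 1)).
  rewrite (bigID (fun i : 'I_r => ty i)) /=.
  by congr (_ + _); apply: eq_bigr => i _; rewrite muln1.
rewrite e0; move: (\sum_(p : 'I_n * 'I_n) _) e1 => W1 e1.
(* Taken as one variable, the product n La cancels and the identity is linear. *)
move: (n * La) e1 e4 => nL e1 e4; lia.
Qed.

End Exponent.

Theorem theorem5p2
    (R : realType)
    (* Q_2, its finite unramified extension F, and A/2A *)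
    (K : fieldType) (nrm : K -> R) (hK : is_Q2 nrm)
    (F : fieldExtType K) (A : set F) (hA : A = ring_of_integers nrm F)
    (hF : unramified A)
    (kappa : finFieldType) (pi : F -> kappa) (hpi : is_residue_map A pi)
    (f : nat) (hf : f = #|kappa|)
    (* the quadratic lattice L = A^n *)
    (n : nat) (q : 'cV[F]_n -> F) (hq : is_quadratic_form q)
    (hqL : forall x, lattice_L A x -> A (q x))
    (hbL : forall x y, lattice_L A x -> lattice_L A y -> A (bil q x y))
    (hnd : nondegenerate_quad q)
    (* a Jordan splitting *)
    (r : nat) (ni : nat -> nat) (J : forall i, 'M[F]_(n, ni i))
    (hJ : is_jordan_splitting A q r J)
    (* the forms omega_M, omega_Q, omega^ld and the measure |omega^ld| *)
    (mu : forall d : nat, borel_measure R A f 1 d)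
    (hmu : forall d, is_haar (mu d))
    (cM cQ : F)
    (hcM : normalized_form (mu (n * n)%N) cM)
    (hcQ : normalized_form (mu #|upper n|) cQ)
    (omega : 'M[F]_n -> 'M[F]_('C(n, 2), n * n) -> F)
    (homega : is_quotient_form (gram q) cM cQ omega)
    (nu : borel_measure R A f n n)
    (hnu : is_form_measure (gram q) (mu 'C(n, 2)) omega nu) :
  local_density (gram q) nu =
  ((index_OV_SOV (gram q))%:R^-1
   * f%:R ^ N_exponent A q r J
   * f%:R ^ (- ('C(n, 2))%:Z)
   * (ncard (special_points A q pi))%:R)%:E.
Proof.
have cd := ring_of_integers_complete_dvr hK hA hF hpi.
have Su := gram_unit hq hnd.
have hf1 : (1 < f)%N by rewrite hf card_finNzRing_gt1.
have [P0 [G0 [lev [[iP0 dP0 iG0 dG0] [bG0 gP0 hcount hlev htype]]]]] := jordan_basis cd hq hJ.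
have [P [G [s [fr hs]]]] := adapt_basis cd hpi hq iP0 dP0 iG0 dG0 bG0 gP0.
have tb := tan_basis_tangent_basis cd hq fr Su.
have uME (E : comAlgType F) (T : set E) (hT : is_A_subalgebra A T) := uM_coords cd hq fr Su hT.
rewrite /local_density (Aut_L_measure cd hpi tb hf hmu hcM hcQ homega hnu).
rewrite (card_special_points cd hpi tb uME) /tb_volume.
rewrite (tan_basis_volume cd fr R hf1) (target_basis_volume cd fr R hf1).
have ht k : type_I A q J k <-> exists2 a, s a & lev a = k.
  by rewrite htype hs.
have hN := weight_exponent hcount hlev (fr_uniq fr) ht.
rewrite -EFinM; congr (_%:E).
have f0 : (f%:R : R) != 0 by rewrite pnatr_eq0 -lt0n ltnW.
have -> : N_exponent A q r J = _ := esym hN.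
rewrite expfzDr // -!exprnN invrK.
have aux (a b c x y : R) : a * (y * (b * (c * x))) = a * (x * c) * b * y by ring.
exact: aux.
Qed.
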